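(* Let $d\ge1$, $T>0$ and $B\in C^1_b(\mathbb R^d,\mathbb R^d)$, and let $f_0\in L^1(\mathbb R^d)\cap L^2(\mathbb R^d)$. Then the PDE with initial datum $f_0$ has at most one weak solution in the space $\mathcal X$: if $p_1,p_2\in\mathcal X$ are both weak solutions with initial datum $f_0$, then $p_1=p_2$ almost everywhere.
   Context: Notation: write $x=(x^1,\tilde x)\in\mathbb R\times\mathbb R^{d-1}$ and $(m,x)=(m,x^1,\tilde x)\in\mathbb R^{d+1}$; $\mathcal T:=\{(m,x)\in\mathbb R\times\mathbb R^d: m\ge x^1\}$. For $\Phi\in C^2(\mathbb R^{d+1})$, $\mathcal L\Phi(m,x)=\sum_{i=1}^d B^i(x)\partial_{x^i}\Phi(m,x)+\frac12\sum_{i=1}^d\partial^2_{x^ix^i}\Phi(m,x)$. The space $\mathcal X$: the set of real functions $p$ on $]0,T]\times\mathcal T$ such that (a) $\sup_{t\in]0,T]}\int_{\mathbb R^d}\big[\int_{m\ge x^1}|p(m,x;t)|\,dm\big]^2dx<\infty$; (c) for all $t\in]0,T]$, $(m,\tilde x)\mapsto\sup_{u>0}p(m,m-u,\tilde x;t)$ belongs to $L^1(\mathbb R^d)$, and for almost every $(m,\tilde x)$ the map $x^1\mapsto p(m,x^1,\tilde x;t)$ is continuous on $]-\infty,m[$ and $\lim_{u\to0^+}p(m,m-u,\tilde x;t)$ exists, denoted $p(m,m,\tilde x;t)$; (b) $(m,\tilde x;s)\mapsto p(m,m,\tilde x;s)$ belongs to $L^1(]0,T];L^2(\mathbb R^d))$.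 Weak solution with initial datum $f_0$: $p\in\mathcal X$ such that for every $\Phi\in C^2_c(\mathbb R^{d+1})$ and $t\in]0,T]$, $$\int_{\mathcal T}\Phi(m,x)p(m,x;t)\,dm\,dx=\int_{\mathbb R^d}\Phi(m,m,\tilde x)f_0(m,\tilde x)\,dm\,d\tilde x+\int_0^t\!\!\int_{\mathcal T}p(m,x;s)\mathcal L\Phi(m,x)\,dm\,dx\,ds+\frac12\int_0^t\!\!\int_{\mathbb R^d}\frac{\partial\Phi}{\partial m}(m,m,\tilde x)\,p(m,m,\tilde x;s)\,dm\,d\tilde x\,ds,$$ where $\frac{\partial\Phi}{\partial m}(m,m,\tilde x)$ is the derivative of $\Phi$ in its first variable evaluated at $(m,m,\tilde x)$. *)

(* Defs.v *)
From HB Require Import structures.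
From mathcomp Require Import all_boot all_order all_algebra.
From mathcomp Require Import all_classical all_reals all_analysis.
Set Implicit Arguments. Unset Strict Implicit. Unset Printing Implicit Defensive.
Import Order.TTheory GRing.Theory Num.Theory.
Import numFieldNormedType.Exports.
Local Open Scope classical_set_scope.
Local Open Scope ring_scope.

Section Defs.
Variable R : realType.

(* Lebesgue integral over R^n = 'rV[R]_n, defined as the iterated
   one-dimensional Lebesgue integral (coordinate 0 outermost). *)
Fixpoint lint (n : nat) : ('rV[R]_n -> \bar R) -> \bar R :=
  match n return ('rV[R]_n -> \bar R) -> \bar R with
  | 0 => fun f => f 0
  | n'.+1 => fun f =>
      (\int[@lebesgue_measure R]_t lint (fun y : 'rV[R]_n' => f (row_mx t%:M y)))%E
  end.

Definition borel (n : nat) (A : set 'rV[R]_n) : Prop := <<s @open 'rV[R]_n >> A.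

Definition rmeas (n : nat) (f : 'rV[R]_n -> \bar R) : Prop :=
  forall a : R, borel (f @^-1` [set e | (a%:E < e)%E]).

Definition ae (n : nat) (P : 'rV[R]_n -> Prop) : Prop :=
  exists N : set 'rV[R]_n, borel N /\ lint (fun y => (\1_N y)%:E) = 0%E /\
    forall y, ~ N y -> P y.

Definition L1 (n : nat) (f : 'rV[R]_n -> \bar R) : Prop :=
  exists g : 'rV[R]_n -> \bar R, rmeas g /\ ae (fun y => f y = g y) /\
    (lint (fun y => `|g y|) < +oo)%E.

(* Points of R^d (d = k+1) written x = (x^1, xt) and of R^(d+1) written
   (m, x^1, xt); (m, x) is written row_mx m x. *)
Definition xpt (k : nat) (x1 : R) (xt : 'rV[R]_k) : 'rV[R]_k.+1 := row_mx x1%:M xt.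
Definition zpt (k : nat) (m : R) (x : 'rV[R]_k.+1) : 'rV[R]_k.+2 := row_mx m%:M x.
Definition pt (k : nat) (m x1 : R) (xt : 'rV[R]_k) : 'rV[R]_k.+2 := zpt m (xpt x1 xt).
Definition stpt (k : nat) (z : 'rV[R]_k.+2) (t : R) : 'rV[R]_(k.+2 + 1) := row_mx z t%:M.

Definition zm (k : nat) (z : 'rV[R]_k.+2) : R := z ord0 ord0.
Definition zx1 (k : nat) (z : 'rV[R]_k.+2) : R := z ord0 (lift ord0 ord0).

Definition inT (k : nat) (z : 'rV[R]_k.+2) : Prop := zx1 z <= zm z.

Definition pd (n : nat) (f : 'rV[R]_n -> R) (j : 'I_n) (z : 'rV[R]_n) : R :=
  derive f z (delta_mx ord0 j).

Definition C1b (n : nat) (B : 'rV[R]_n -> 'rV[R]_n) : Prop :=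
  (exists M : R, forall x, `|B x| <= M) /\
  forall i j : 'I_n,
    (forall x, derivable (fun y => B y ord0 i) x (delta_mx ord0 j)) /\
    continuous (pd (fun y => B y ord0 i) j) /\
    (exists M : R, forall x, `|pd (fun y => B y ord0 i) j x| <= M).

Definition C2c (n : nat) (Phi : 'rV[R]_n -> R) : Prop :=
  compact (closure [set z | Phi z != 0]) /\
  forall i j : 'I_n,
    (forall z, derivable Phi z (delta_mx ord0 i)) /\
    continuous (pd Phi i) /\
    (forall z, derivable (pd Phi i) z (delta_mx ord0 j)) /\
    continuous (pd (pd Phi i) j).

Definition gen (k : nat) (B : 'rV[R]_k.+1 -> 'rV[R]_k.+1)
    (Phi : 'rV[R]_k.+2 -> R) (z : 'rV[R]_k.+2) : R :=
  \sum_(i < k.+1) B (rsubmx (z : 'rV[R]_(1 + k.+1))) ord0 i * pd Phi (lift ord0 i) z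
  + 2^-1 * \sum_(i < k.+1) pd (pd Phi (lift ord0 i)) (lift ord0 i) z.

Definition trace (k : nat) (p : 'rV[R]_k.+2 -> R -> R) (y : 'rV[R]_k.+1) (t : R) : R :=
  let m := y ord0 ord0 in
  let xt := rsubmx (y : 'rV[R]_(1 + k)) in
  lim ((fun u => p (pt m (m - u) xt) t) @ at_right 0).

Definition esqrt (e : \bar R) : \bar R :=
  match e with EFin r => (Num.sqrt r)%:E | +oo%E => +oo%E | -oo%E => 0%E end.

(* The space X.  p is a real function on ]0,T] x T; we take it as a function
   on R^(d+1) x R whose values outside ]0,T] x T are irrelevant. *)
Definition inX (k : nat) (T : R) (p : 'rV[R]_k.+2 -> R -> R) : Prop :=
  rmeas (fun w : 'rV[R]_(k.+2 + 1) =>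
     let z := lsubmx w in
     let t := rsubmx w ord0 ord0 in
     if `[< 0 < t <= T /\ inT z >] then (p z t)%:E else 0%E) /\
  (ereal_sup [set lint (fun x : 'rV[R]_k.+1 =>
        let I := (\int[@lebesgue_measure R]_(m in [set m | (x ord0 ord0 <= m)%R])
                     `|p (zpt m x) t|%:E)%E in (I * I)%E)
     | t in `]0%R, T]%classic] < +oo)%E /\
  (forall t, 0 < t <= T ->
     L1 (fun y : 'rV[R]_k.+1 =>
       ereal_sup [set (p (pt (y ord0 ord0) (y ord0 ord0 - u)
                         (rsubmx (y : 'rV[R]_(1 + k)))) t)%:E
                 | u in `]0%R, +oo[%classic]) /\
     ae (fun y : 'rV[R]_k.+1 =>
       let m := y ord0 ord0 in
       let xt := rsubmx (y : 'rV[R]_(1 + k)) in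
       {within `]-oo, m[, continuous (fun x1 => p (pt m x1 xt) t)} /\
       cvg ((fun u => p (pt m (m - u) xt) t) @ at_right 0))) /\
  (exists g : 'rV[R]_(k.+1 + 1) -> R,
     rmeas (fun w => (g w)%:E) /\
     ae (fun w : 'rV[R]_(k.+1 + 1) =>
       let y := lsubmx w in
       let s := rsubmx w ord0 ord0 in
       0 < s <= T -> trace p y s = g w) /\
     (\int[@lebesgue_measure R]_(s in `]0%R, T]%classic)
        esqrt (lint (fun y : 'rV[R]_k.+1 => ((g (row_mx y s%:M)) ^+ 2)%:E)) < +oo)%E).

Definition weak_solution (k : nat) (T : R) (B : 'rV[R]_k.+1 -> 'rV[R]_k.+1)
    (f0 : 'rV[R]_k.+1 -> R) (p : 'rV[R]_k.+2 -> R -> R) : Prop :=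
  inX T p /\
  forall Phi : 'rV[R]_k.+2 -> R, C2c Phi ->
  forall t, 0 < t <= T ->
    lint (fun z => if `[< inT z >] then (Phi z * p z t)%:E else 0%E)
    = (lint (fun y : 'rV[R]_k.+1 =>
          (Phi (pt (y ord0 ord0) (y ord0 ord0) (rsubmx (y : 'rV[R]_(1 + k))))
           * f0 y)%:E)
       + \int[@lebesgue_measure R]_(s in `]0%R, t]%classic)
           lint (fun z => if `[< inT z >] then (p z s * gen B Phi z)%:E else 0%E)
       + (2^-1)%:E * \int[@lebesgue_measure R]_(s in `]0%R, t]%classic)
           lint (fun y : 'rV[R]_k.+1 =>
             (pd Phi ord0 (pt (y ord0 ord0) (y ord0 ord0) (rsubmx (y : 'rV[R]_(1 + k))))
              * trace p y s)%:E))%E.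

End Defs.

(* Main.v *)
(* Let p be the difference of two solutions and, for a level a, let F_a(x; t) be the integral of
   p(m, x; t) over m <= a; it is in L^2 by condition (a). Testing the equation with smooth
   approximations of 1_{m <= a} psi(x), where psi vanishes on x^1 = a, makes the trace term
   disappear in the limit, thanks to condition (b): F_a is a weak solution of the forward equation
   on {x^1 < a} with Dirichlet condition on x^1 = a and zero initial datum. Localise F_a to a box
   with face x^1 = a and expand it in products of sines. Each coefficient solves a scalar linear
   equation whose dissipation absorbs the drift and cutoff terms; summing the resulting bounds
   with Parseval and Bessel gives |F_a(t)|^2 <= C int_0^t |F_a(s)|^2 ds with C independent of
   the box. Letting the box grow, Gronwall's lemma yields F_a = 0 for every a, hence p = 0. *)

(* Condition (a) controls the integral of |p| over m in L^2(x), not p itself, so no energy method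
   applies to p directly; as the generator does not act on m, integrating over m <= a yields a
   function of x alone with an equation of its own. Nothing is known on the regularity of F_a in x,
   so it cannot be its own test function: only its coefficients against smooth functions are
   available, and each of these is the primitive in time of a bounded function. The drift and the
   derivatives of the cutoff produce terms in which one sine has become a cosine. Products with one
   cosine are again orthonormal, so Bessel bounds these terms, and Parseval is kept for the quantity
   to be estimated. Test functions are products throughout, which reduces partial derivatives to
   derivatives in one variable. The trace is a limit that is only almost everywhere equal to a
   measurable function, while the iterated integral of the definitions accepts arbitrary functions;
   hence the care with null sets in the measure-theoretic part. *)
Require Import Defs.
From HB Require Import structures.
From mathcomp Require Import all_boot all_order all_algebra.
From mathcomp Require Import all_classical all_reals all_analysis.
From mathcomp Require Import measurable_realfun ring lra zify.
Import Order.TTheory GRing.Theory Num.Theory.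
Import numFieldNormedType.Exports.
Local Open Scope classical_set_scope.
Local Open Scope ring_scope.
Set Implicit Arguments.
Unset Strict Implicit.
Unset Printing Implicit Defensive.
Import HBNNSimple.

(** * Borel structure and Lebesgue measure on R^n *)

Section BorelRV.
Variable R : realType.
Local Notation V n := (g_sigma_algebraType (@open 'rV[R]_n)).

(** The boxes are indexed by a countable type, so measurability of a map into R^n reduces to its
    coordinates. A rational half-side r below half the radius and a rational centre within r of x
    keep the box inside the ball. *)
Lemma open_rV_boxes n (U : set 'rV[R]_n) : open U ->
  exists S : set ('rV[rat]_n * rat),
    U = \bigcup_(c in S) [set y | forall i, `|y ord0 i - ratr (c.1 ord0 i)| < ratr c.2].
Proof.
move=> oU.
pose box (c : 'rV[rat]_n * rat) : set 'rV[R]_n :=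
  [set y | forall i, `|y ord0 i - ratr (c.1 ord0 i)| < ratr c.2].
exists [set c | box c `<=` U]; apply/seteqP; split; last by move=> x [c /= cU] /cU.
move=> x Ux; have /nbhs_ballP[e /= e0 eU] : nbhs x U by exact: open_nbhs_nbhs.
have e4 : 0 < e / 2 by rewrite divr_gt0.
have [r] := rat_in_itvoo e4; rewrite in_itv /= => /andP[r0 re].
have rc (i : 'I_n) : exists q : rat, `|x ord0 i - ratr q| < ratr r.
  have [q] := @rat_in_itvoo R (x ord0 i - ratr r) (x ord0 i) ltac:(lra).
  by rewrite in_itv /= => /andP[q1 q2]; exists q; rewrite ger0_norm; lra.
have [q qP] := choice rc.
exists (\row_i q i, r) => /=; last by move=> i /=; rewrite mxE.
move=> y /= yb; apply: eU; split => // i j; rewrite ord1.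
have := yb j; have := qP j; rewrite mxE.
rewrite /ball /= => h1 h2; rewrite -(subrK (ratr (q j)) (x ord0 j)) -addrA.
apply: (le_lt_trans (ler_normD _ _)); rewrite distrC in h2; lra.
Qed.

Lemma measurable_fun_rV d (T : measurableType d) n (f : T -> V n) :
  (forall i, measurable_fun setT (fun x => (f x : 'rV[R]_n) ord0 i)) ->
  measurable_fun setT f.
Proof.
move=> mf; apply: (measurability _ (erefl : @measurable _ (V n) = <<s @open 'rV[R]_n >>)).
move=> _ [U oU <-]; rewrite setTI.
have [S ->] := open_rV_boxes oU.
rewrite preimage_bigcup bigcup_mkcond.
apply: countable_bigcupT_measurable => [|c]; first exact: countableP.
case: ifP => // _.
have -> : f @^-1` [set y : 'rV[R]_n | forall i, `|y ord0 i - ratr (c.1 ord0 i)| < ratr c.2]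
  = \bigcap_(i in [set: 'I_n]) ((fun x => `|(f x : 'rV[R]_n) ord0 i - ratr (c.1 ord0 i)|)
        @^-1` `]-oo, ratr c.2[).
  apply/seteqP; split => x /= h.
    by move=> i _ /=; rewrite in_itv /=; exact: h.
  by move=> i; have := h i I; rewrite /= in_itv.
apply: fin_bigcap_measurable => //.
move=> i _; rewrite -[X in measurable X]setTI.
by apply: measurableT_comp => //; exact: measurable_funB.
Qed.

Lemma measurable_coord n (i : 'I_n) :
  measurable_fun setT (fun x : V n => (x : 'rV[R]_n) ord0 i).
Proof.
apply: (measurability _ (RGenOpens.measurableE R)) => _ [_ [a [b ->]] <-].
rewrite setTI; apply: sub_sigma_algebra.
have := @coord_continuous R 1 n ord0 i.
by move/continuousP; apply; exact: interval_open.
Qed.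

Lemma rmeasP n (f : 'rV[R]_n -> \bar R) :
  rmeas f <-> measurable_fun setT (f : V n -> \bar R).
Proof.
split=> [mf|mf a].
  apply: (measurability _ (ErealGenOInfty.measurableE R)) => // _ [_ [a ->] <-].
  rewrite setTI; have := mf a; rewrite /borel.
  by congr (measurable (_ : set (V n))); apply/seteqP; split => x /=;
    rewrite in_itv /= andbT.
have := emeasurable_fun_o_infty (@measurableT _ (V n)) mf a%:E.
by rewrite setTI.
Qed.

Definition cons0 n (p : R * V n) : V n.+1 := row_mx (p.1%:M : 'rV_1) (p.2 : 'rV[R]_n).

Lemma cons0E n t (y : 'rV[R]_n) : cons0 (t, y) = row_mx (t%:M : 'rV_1) y.
Proof. by []. Qed.

Lemma row_mx_ord0 n (t : R) (y : 'rV[R]_n) :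
  (row_mx (t%:M : 'rV_1) y : 'rV_n.+1) ord0 ord0 = t.
Proof.
have -> : (ord0 : 'I_(1 + n)) = lshift n (ord0 : 'I_1) by exact/val_inj.
by apply: etrans (row_mxEl _ _ _ _) _; rewrite mxE mulr1n.
Qed.

Lemma row_mx_lift n (t : R) (y : 'rV[R]_n) i :
  (row_mx (t%:M : 'rV_1) y : 'rV_n.+1) ord0 (lift ord0 i) = y ord0 i.
Proof.
have -> : (lift ord0 i : 'I_(1 + n)) = rshift 1 i by exact/val_inj.
exact: row_mxEr.
Qed.

Lemma measurable_cons0 n : measurable_fun setT (@cons0 n).
Proof.
apply: measurable_fun_rV => i.
have [->|[j ->]] : i = ord0 \/ exists j, i = lift ord0 j.
- by case: (unliftP ord0 i) => [j ->|->]; [right; exists j|left].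
- rewrite (_ : (fun _ => _) = fst)//.
  by apply/funext => x; exact: row_mx_ord0.
- rewrite (_ : (fun _ => _) = (fun x : V n => (x : 'rV[R]_n) ord0 j) \o snd).
    by apply: measurableT_comp; [exact: measurable_coord|].
  by apply/funext => x; exact: row_mx_lift.
Qed.

End BorelRV.

Section LebesgueRV.
Variable R : realType.
Local Notation V n := (g_sigma_algebraType (@open 'rV[R]_n)).
Local Notation leb := (@lebesgue_measure R).

Definition uncons0 n (z : V n.+1) : R * V n :=
  ((z : 'rV[R]_n.+1) ord0 ord0, rsubmx (z : 'rV[R]_(1 + n)) : V n).

Lemma cons0K n : cancel (@cons0 R n) (@uncons0 n).
Proof.
move=> [t y]; rewrite /uncons0 cons0E row_mx_ord0; congr pair.
exact: row_mxKr.
Qed.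

Lemma uncons0K n : cancel (@uncons0 n) (@cons0 R n).
Proof.
move=> z; rewrite /uncons0 cons0E; apply/rowP => i.
case: (unliftP ord0 i) => [j ->|->]; last by rewrite row_mx_ord0.
by rewrite row_mx_lift mxE; congr (z _ _); exact/val_inj.
Qed.

Lemma measurable_uncons0 n : measurable_fun setT (@uncons0 n).
Proof.
apply/measurable_fun_pairP; split; first exact: measurable_coord.
apply: measurable_fun_rV => j /=.
rewrite (_ : (fun _ => _) = (fun x : V n.+1 => (x : 'rV[R]_n.+1) ord0 (lift ord0 j))).
  exact: measurable_coord.
by apply/funext => z /=; rewrite mxE; congr (z _ _); exact/val_inj.
Qed.

Section consm.
Variables (n : nat) (mu : {sigma_finite_measure set (V n) -> \bar R}).

Definition consm := pushforward (leb \x mu)%E (@cons0 R n).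

HB.instance Definition _ := Measure.copy consm
  (measure_function_pushforward__canonical__measure_function_Measure
     (leb \x mu)%E (@measurable_cons0 R n)).

Let consm_sigma_finite : sigma_finite setT consm.
Proof.
have /sigma_finiteP[F [FT ndF Foo]] := sigma_finiteT leb.
have /sigma_finiteP[G [GT ndG Goo]] := sigma_finiteT mu.
exists (fun i => @uncons0 n @^-1` (F i `*` G i)).
  rewrite -preimage_bigcup; apply/esym; rewrite -subTset => z _ /=.
  have [i _ Fi] : (\bigcup_i F i) (uncons0 z).1 by rewrite -FT.
  have [j _ Gj] : (\bigcup_i G i) (uncons0 z).2 by rewrite -GT.
  exists (maxn i j) => //; split.
    by move: (uncons0 z).1 Fi; exact/subsetPset/ndF/leq_maxl.
  by move: (uncons0 z).2 Gj; exact/subsetPset/ndG/leq_maxr.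
move=> i; have [mF Fi] := Foo i; have [mG Gi] := Goo i; split.
  rewrite -[X in measurable X]setTI; apply: measurable_uncons0 => //.
  exact: measurableX.
rewrite /consm /pushforward -comp_preimage.
rewrite (_ : @uncons0 n \o @cons0 R n = id); last first.
  by apply/funext => x /=; exact: cons0K.
by rewrite preimage_id product_measure1E// lte_mul_pinfty// ge0_fin_numE.
Qed.

HB.instance Definition _ := Measure_isSigmaFinite.Build _ _ _ consm
  consm_sigma_finite.

End consm.

(** Built one coordinate at a time with the first one outermost, in the order of [lint], so that
    both agree on nonnegative measurable functions ([ge0_lintE]) and on integrable ones
    ([lint_integral]). *)
Fixpoint lebV n : {sigma_finite_measure set (V n) -> \bar R} :=
  match n with
  | 0 => \d_ ((0 : 'rV[R]_0) : V 0)
  | n'.+1 => consm (lebV n')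
  end.

Lemma measurable_row_mx n (t : R) :
  measurable_fun setT (fun y : V n => (row_mx (t%:M : 'rV_1) (y : 'rV[R]_n)) : V n.+1).
Proof.
rewrite (_ : (fun _ => _) = (@cons0 R n) \o (fun y => (t, y))); last exact/funext.
by apply: measurableT_comp; [exact: measurable_cons0|exact: measurable_pair1].
Qed.

Lemma ge0_integral_lebVS n (f : V n.+1 -> \bar R) :
  measurable_fun setT f -> (forall x, (0 <= f x)%E) ->
  (\int[lebV n.+1]_x f x =
   \int[leb]_t \int[lebV n]_y f (row_mx (t%:M : 'rV_1) (y : 'rV[R]_n)))%E.
Proof.
move=> mf f0; rewrite ge0_integral_pushforward//=; last exact: measurable_cons0.
rewrite preimage_setT fubini_tonelli1//=.
exact: measurableT_comp mf (@measurable_cons0 R n).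
Qed.

Lemma ge0_lintE n (f : V n -> \bar R) :
  measurable_fun setT f -> (forall x, (0 <= f x)%E) ->
  lint f = (\int[lebV n]_x f x)%E.
Proof.
elim: n f => [|n IHn] f mf f0.
  by rewrite /= integral_dirac// diracT mul1e.
rewrite ge0_integral_lebVS//=; apply: eq_integral => t _.
rewrite IHn// /comp.
exact: measurableT_comp mf (@measurable_row_mx n t).
Qed.

End LebesgueRV.

(** * Integrals of arbitrary functions and null sets *)

Section AeArbitrary.
Context d (T : measurableType d) (R : realType) (mu : {measure set T -> \bar R}).

Lemma aeS (P Q : T -> Prop) : (forall x, P x -> Q x) ->
  {ae mu, forall x, P x} -> {ae mu, forall x, Q x}.
Proof. by move=> PQ; apply: filterS. Qed.

Lemma aeI (P Q : T -> Prop) : {ae mu, forall x, P x} -> {ae mu, forall x, Q x} ->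
  {ae mu, forall x, P x /\ Q x}.
Proof. by move=> p q; apply: filterS2 p q. Qed.

(** A simple function below [f], set to zero on the null set, lies below [g] everywhere and keeps
    its integral. *)
Lemma ge0_le_integral_ae_any (f g : T -> \bar R) :
  (forall x, (0 <= f x)%E) -> (forall x, (0 <= g x)%E) ->
  {ae mu, forall x, f x = g x} ->
  (\int[mu]_x f x <= \int[mu]_x g x)%E.
Proof.
move=> f0 g0 [N [mN N0 Nfg]].
rewrite ge0_integralTE// [leRHS]ge0_integralTE//.
apply: ge_ereal_sup => _ [h hf <-].
pose h' := mul_nnsfun h (indic_nnsfun R (measurableC mN)).
suff h'g : (sintegral mu h' <= ereal_sup [set sintegral mu h | h in [set h : {nnsfun T >-> R} | forall x, (h x)%:E <= g x]])%E; first apply: le_trans h'g; last first.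
  apply: ereal_sup_ubound; exists h' => // x /=.
  change ((h x * \1_(~` N) x)%:E <= g x)%E.
  rewrite indicE; case: (boolP (x \in ~` N)) => xN; last by rewrite mulr0.
  rewrite mulr1; apply: (le_trans (hf x)).
  suff -> : f x = g x by [].
  by apply: contrapT => fg; move: xN; rewrite inE; apply; exact: Nfg.
rewrite -!integralT_nnsfun le_eqVlt; apply/orP; left; apply/eqP.
apply: ae_eq_integral => //.
- exact/measurable_EFinP.
- exact/measurable_EFinP.
exists N; split => // x; rewrite /mkset => hx; apply: contrapT => Nx; apply: hx => _.
change ((h x)%:E = (h x * \1_(~` N) x)%:E).
by rewrite indicE mem_set// mulr1.
Qed.

(* No measurability is required: the integral is a supremum over simple functions,
   hence insensitive to modifications on a null set. *)
Lemma integral_ae_any (D : set T) (f g : T -> \bar R) :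
  {ae mu, forall x, D x -> f x = g x} ->
  (\int[mu]_(x in D) f x = \int[mu]_(x in D) g x)%E.
Proof.
move=> fg.
rewrite integral_mkcond [RHS]integral_mkcond integralE [RHS]integralE.
have {}fg : {ae mu, forall x, (f \_ D) x = (g \_ D) x}.
  apply: filterS fg => x; rewrite !patchE; case: ifPn => //.
  by rewrite inE => Dx /(_ Dx).
have gf : {ae mu, forall x, (g \_ D) x = (f \_ D) x}.
  by apply: filterS fg => x ->.
by congr (_ - _)%E; apply/eqP; rewrite eq_le; apply/andP; split;
  apply: ge0_le_integral_ae_any => //;
  [apply: filterS fg|apply: filterS gf|apply: filterS fg|apply: filterS gf] => x;
  rewrite ?funeposE ?funenegE => ->.
Qed.

End AeArbitrary.

Section Lint.
Variable R : realType.
Local Notation V n := (g_sigma_algebraType (@open 'rV[R]_n)).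
Local Notation leb := (@lebesgue_measure R).

Lemma aeP n (P : 'rV[R]_n -> Prop) : ae P <-> {ae lebV R n, forall y, P y}.
Proof.
have iN (N : set (V n)) : measurable N ->
    lint (fun y => (\1_N y)%:E) = lebV R n N.
  move=> mN; rewrite ge0_lintE//.
  - by rewrite integral_indic// setIT.
  - by apply/measurable_EFinP; exact: measurable_indic.
split=> [[N [mN [N0 NP]]]|[N [mN N0 NP]]].
  exists N; split => //; first by rewrite -iN.
  by move=> y /= Py; apply: contrapT => /NP.
exists N; split => //; split; first by rewrite iN.
by move=> y Ny; apply: contrapT => Py; apply: Ny; exact: NP.
Qed.

(** Tonelli for the indicator of the null set: the measures of its slices integrate to zero, so
    almost every slice is null. *)
Lemma ae_lebVS n (P : 'rV[R]_n.+1 -> Prop) :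
  {ae lebV R n.+1, forall z, P z} ->
  {ae leb, forall t : R, {ae lebV R n, forall y : 'rV[R]_n, P (row_mx (t%:M : 'rV_1) y)}}.
Proof.
move=> [N [mN N0 NP]].
have m1 : measurable_fun setT (fun z : V n.+1 => (\1_N z)%:E : \bar R).
  by apply/measurable_EFinP; exact: measurable_indic.
have h : (\int[leb]_t \int[lebV R n]_y
    (\1_N (row_mx (t%:M : 'rV_1) (y : 'rV[R]_n)))%:E = 0)%E.
  rewrite -(ge0_integral_lebVS m1)//.
  by apply: etrans N0; rewrite integral_indic// setIT.
have m2 : measurable_fun setT (fun t : R => \int[lebV R n]_y
    (\1_N (row_mx (t%:M : 'rV_1) (y : 'rV[R]_n)))%:E)%E.
  apply: (measurable_fun_fubini_tonelli_F (m2 := lebV R n)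
    (fun p => (\1_N (@cons0 R n p))%:E)) => //.
  exact: measurableT_comp m1 (@measurable_cons0 R n).
have [+ _] := ae_eq_integral_abs leb measurableT m2.
move=> /(_ _)-[].
  rewrite -h; apply: eq_integral => t _.
  by rewrite gee0_abs// integral_ge0.
move=> M [mM M0 MP]; exists M; split => // t /= ht; apply: MP => /= /(_ I) h0; apply: ht.
have mr : measurable ((fun y : V n => (row_mx (t%:M : 'rV_1) (y : 'rV[R]_n)) : V n.+1) @^-1` N).
  by rewrite -[X in measurable X]setTI; exact: measurable_row_mx.
exists ((fun y : V n => (row_mx (t%:M : 'rV_1) (y : 'rV[R]_n)) : V n.+1) @^-1` N); split => //.
  by rewrite -h0 -[X in lebV R n X]setIT -(integral_indic (lebV R n) measurableT mr).
by move=> y /= ny; apply: NP.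
Qed.

(** Almost every slice of a null set is null, and at each level the integral ignores null sets.
    Measurability is not assumed, which allows [trace] to be replaced by a measurable representative
    in the weak formulation. *)
Lemma lint_ae n (f g : 'rV[R]_n -> \bar R) :
  {ae lebV R n, forall z, f z = g z} -> lint f = lint g.
Proof.
elim: n f g => [|n IHn] f g fg.
  have [N [mN N0 NP]] := fg => /=; apply: contrapT => fg0.
  have N00 : N (0 : 'rV[R]_0) by exact: NP.
  by move: N0; rewrite /= diracE mem_set//= => /eqP; rewrite onee_eq0.
apply: integral_ae_any; apply: aeS (ae_lebVS fg) => t ht _.
exact: IHn.
Qed.

Section integral_cons0.
Variables (n : nat) (f : V n.+1 -> \bar R).
Hypothesis fi : (lebV R n.+1).-integrable setT f.

Let fic : ((leb \x lebV R n)%E).-integrable setT (f \o @cons0 R n).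
Proof.
have mf := measurable_int (lebV R n.+1) fi.
apply/integrableP; split; first exact: measurableT_comp mf (@measurable_cons0 R n).
have /integrableP[_] := fi.
rewrite ge0_integral_pushforward//=; last 2 first.
- exact: measurable_cons0.
- exact: measurableT_comp.
Qed.

Lemma ae_integrable_cons0 : {ae leb, forall t : R, (lebV R n).-integrable setT
  (fun y : V n => f (row_mx (t%:M : 'rV_1) (y : 'rV[R]_n)))}.
Proof. exact: ae_integrable1 fic. Qed.

Lemma integral_lebVS : (\int[lebV R n.+1]_x f x =
  \int[leb]_t \int[lebV R n]_y f (row_mx (t%:M : 'rV_1) (y : 'rV[R]_n)))%E.
Proof.
have mf := measurable_int (lebV R n.+1) fi.
rewrite integral_pushforward ?preimage_setT//; last exact: measurable_cons0.
by rewrite -(integral12_prod_meas1 fic).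
Qed.

End integral_cons0.

(** Slices of an integrable function are integrable only for almost every value of the first
    coordinate, so Fubini is combined with [integral_ae_any]. *)
Lemma lint_integral n (f : 'rV[R]_n -> \bar R) :
  (lebV R n).-integrable setT f -> lint f = (\int[lebV R n]_x f x)%E.
Proof.
elim: n f => [|n IHn] f fi.
  by have mf := measurable_int (lebV R 0) fi; rewrite /= integral_dirac// diracT mul1e.
rewrite (integral_lebVS fi).
apply: integral_ae_any; apply: aeS (ae_integrable_cons0 fi) => t ft _.
exact: IHn.
Qed.

End Lint.

(** * Splitting off the last coordinate, which carries the time *)

Section LastCoordinate.
Variable R : realType.
Local Notation V n := (g_sigma_algebraType (@open 'rV[R]_n)).
Local Notation leb := (@lebesgue_measure R).

Lemma row_mx_vall m n (A : 'rV[R]_m) (B : 'rV[R]_n) (j : 'I_(m + n)) (i : 'I_m) :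
  nat_of_ord j = i -> row_mx A B ord0 j = A ord0 i.
Proof.
by move=> ji; rewrite (_ : j = lshift n i) ?row_mxEl//; exact/val_inj.
Qed.

Lemma row_mx_valr m n (A : 'rV[R]_m) (B : 'rV[R]_n) (j : 'I_(m + n)) (i : 'I_n) :
  nat_of_ord j = (m + i)%N -> row_mx A B ord0 j = B ord0 i.
Proof.
by move=> ji; rewrite (_ : j = rshift m i) ?row_mxEr//; exact/val_inj.
Qed.

Definition snocV n (p : V n * R) : V (n + 1) := row_mx (p.1 : 'rV[R]_n) (p.2%:M : 'rV_1).

Lemma measurable_snocV n : measurable_fun setT (@snocV n).
Proof.
apply: measurable_fun_rV => i; rewrite /snocV.
case: (split_ordP i) => j ->.
  rewrite (_ : (fun _ => _) = (fun x : V n => (x : 'rV[R]_n) ord0 j) \o fst).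
    by apply: measurableT_comp; [exact: measurable_coord|].
  by apply/funext => x /=; rewrite row_mxEl.
rewrite (_ : (fun _ => _) = snd)//.
by apply/funext => x /=; rewrite row_mxEr mxE (ord1 j) eqxx.
Qed.

Lemma measurable_lsubmx n : measurable_fun setT (fun w : V (n + 1) => lsubmx (w : 'rV[R]_(n + 1)) : V n).
Proof.
apply: measurable_fun_rV => i.
rewrite (_ : (fun _ => _) = (fun w : V (n + 1) => (w : 'rV[R]_(n + 1)) ord0 (lshift 1 i))).
  exact: measurable_coord.
by apply/funext => w; rewrite mxE.
Qed.

(** [lebV] is built from the first coordinate while time is the last one; the induction peels off
    first coordinates until the last one remains alone. *)
Lemma ge0_integral_lebV_snoc n (f : V (n + 1) -> \bar R) :
  measurable_fun setT f -> (forall x, (0 <= f x)%E) ->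
  (\int[lebV R (n + 1)]_w f w = \int[lebV R n]_z \int[leb]_t f (snocV (z, t)))%E.
Proof.
elim: n f => [|n IHn] f mf f0.
  rewrite ge0_integral_lebVS// integral_dirac//; last first.
    apply: (measurable_fun_fubini_tonelli_F (m2 := leb)
      (fun p => f (@snocV 0 p))) => //.
    exact: measurableT_comp mf (@measurable_snocV 0).
  rewrite diracT mul1e; apply: eq_integral => t _.
  rewrite integral_dirac//; last exact: measurableT_comp mf (@measurable_row_mx R 0 t).
  rewrite diracT mul1e; congr f; apply/rowP => i; rewrite /snocV ord1.
  transitivity t; first exact: row_mx_ord0.
  apply/esym; apply: etrans (row_mx_valr _ _ (_ : _ = (0 + (ord0 : 'I_1))%N)) _ => //.
  by rewrite mxE eqxx.
have mfs := measurableT_comp mf (@measurable_snocV n.+1).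
rewrite (ge0_integral_lebVS mf)// ge0_integral_lebVS//; last 2 first.
- by apply: (measurable_fun_fubini_tonelli_F (m2 := leb) (f \o @snocV n.+1)) => // x; exact: f0.
- by move=> x; exact: integral_ge0.
apply: eq_integral => t1 _.
have mft : measurable_fun setT (fun y : V (n + 1) => f (row_mx (t1%:M : 'rV_1) (y : 'rV[R]_(n + 1)))).
  exact: measurableT_comp mf (@measurable_row_mx R (n + 1) t1).
apply: etrans (IHn _ mft (fun=> f0 _)) _.
apply: eq_integral => z _; apply: eq_integral => t _; congr f.
rewrite /snocV /=; apply/rowP => i.
case: (unliftP ord0 i) => [j ->|->]; last first.
  rewrite row_mx_ord0; apply/esym.
  by apply: etrans (row_mx_vall _ _ (_ : _ = (ord0 : 'I_n.+1) :> nat)) _ => //; exact: row_mx_ord0.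
rewrite row_mx_lift; case: (split_ordP j) => l ->; apply/esym.
  rewrite row_mxEl.
  by apply: etrans (row_mx_vall _ _ (_ : _ = (lift ord0 l : 'I_n.+1) :> nat)) _ => //; exact: row_mx_lift.
by rewrite row_mxEr; exact: row_mx_valr.
Qed.

Lemma ae_snoc n (P : 'rV[R]_(n + 1) -> Prop) :
  {ae lebV R (n + 1), forall w, P w} ->
  {ae leb, forall t : R, {ae lebV R n, forall z : 'rV[R]_n, P (row_mx z (t%:M : 'rV_1))}}.
Proof.
move=> [N [mN N0 NP]].
have m1 : measurable_fun setT (fun z : V (n + 1) => (\1_N z)%:E : \bar R).
  by apply/measurable_EFinP; exact: measurable_indic.
have m1s := measurableT_comp m1 (@measurable_snocV n).
have m10 x : (0 <= ((fun z : V (n + 1) => (\1_N z)%:E : \bar R) \o @snocV n) x)%E by rewrite lee_fin.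
have h : (\int[leb]_t \int[lebV R n]_z
    (\1_N (row_mx (z : 'rV[R]_n) (t%:M : 'rV_1)))%:E = 0)%E.
  have FT := @fubini_tonelli _ _ _ _ R (lebV R n) leb _ m1s m10.
  rewrite /fubini_F /fubini_G /= /snocV /= in FT; rewrite -FT.
  rewrite -(ge0_integral_lebV_snoc m1)//.
  by apply: etrans N0; rewrite integral_indic// setIT.
have m2 : measurable_fun setT (fun t : R => \int[lebV R n]_z
    (\1_N (row_mx (z : 'rV[R]_n) (t%:M : 'rV_1)))%:E)%E.
  exact: (@measurable_fun_fubini_tonelli_G _ _ _ _ R (lebV R n) _ m1s m10).
have [+ _] := ae_eq_integral_abs leb measurableT m2.
move=> /(_ _)-[].
  rewrite -h; apply: eq_integral => t _.
  by rewrite gee0_abs// integral_ge0.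
move=> M [mM M0 MP]; exists M; split => // t /= ht; apply: MP => /= /(_ I) h0; apply: ht.
have mr : measurable ((fun y : V n => (row_mx (y : 'rV[R]_n) (t%:M : 'rV_1)) : V (n + 1)) @^-1` N).
  rewrite -[X in measurable X]setTI; apply: (_ : measurable_fun _ _) => //.
  exact: measurableT_comp (@measurable_snocV n) (measurable_pair2 t).
exists ((fun y : V n => (row_mx (y : 'rV[R]_n) (t%:M : 'rV_1)) : V (n + 1)) @^-1` N); split => //.
  by rewrite -h0 -[X in lebV R n X]setIT -(integral_indic (lebV R n) measurableT mr).
by move=> y /= ny; apply: NP.
Qed.

End LastCoordinate.

(** * Square-integrable functions and orthonormal systems *)

Section L2.
Context d (T : measurableType d) (R : realType) (mu : {measure set T -> \bar R}).
Implicit Types f g h : T -> R.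

Definition L2 (f : T -> R) :=
  measurable_fun setT f /\ (\int[mu]_x (f x ^+ 2)%:E < +oo)%E.

Definition dot (f g : T -> R) : R := \int[mu]_x (f x * g x).

Lemma L2_meas f : L2 f -> measurable_fun setT f. Proof. by case. Qed.

Lemma L2_sqr_integrable f : L2 f -> mu.-integrable setT (EFin \o (fun x => f x ^+ 2)).
Proof.
move=> [mf foo]; apply/integrableP; split.
  by apply/measurable_EFinP; exact: measurable_funX.
under eq_integral do rewrite /= ger0_norm ?sqr_ge0//.
exact: foo.
Qed.

Lemma L2_mul_integrable f g : L2 f -> L2 g ->
  mu.-integrable setT (EFin \o (fun x => f x * g x)).
Proof.
move=> Lf Lg.
apply: (@le_integrable _ _ _ mu setT measurableT _
   ((EFin \o (fun x => f x ^+ 2)) \+ (EFin \o (fun x => g x ^+ 2)))).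
- by apply/measurable_EFinP; apply: measurable_funM; [exact: (L2_meas Lf)|exact: (L2_meas Lg)].
- move=> x _ /=; rewrite lee_fin [leRHS]ger0_norm ?addr_ge0 ?sqr_ge0//.
  by rewrite ler_norml; apply/andP; split; nra.
- exact: integrableD (L2_sqr_integrable Lf) (L2_sqr_integrable Lg).
Qed.

Lemma L2_le f g : measurable_fun setT f -> (forall x, `|f x| <= `|g x|) -> L2 g -> L2 f.
Proof.
move=> mf fg [mg goo]; split => //; apply: le_lt_trans goo.
apply: ge0_le_integral => //.
- by move=> x _; rewrite lee_fin sqr_ge0.
- by apply/measurable_EFinP; exact: measurable_funX.
- by apply/measurable_EFinP; exact: measurable_funX.
- move=> x _; rewrite lee_fin -(real_normK (num_real (f x))) -(real_normK (num_real (g x))).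
  by rewrite lerXn2r ?nnegrE.
Qed.

Lemma L2D f g : L2 f -> L2 g -> L2 (fun x => f x + g x).
Proof.
move=> Lf Lg; split.
  by apply: measurable_funD; [exact: (L2_meas Lf)|exact: (L2_meas Lg)].
apply: (@le_lt_trans _ _ (\int[mu]_x ((2 * f x ^+ 2)%:E + (2 * g x ^+ 2)%:E)))%E.
  apply: ge0_le_integral => //.
  - by move=> x _; rewrite lee_fin sqr_ge0.
  - apply/measurable_EFinP; apply: measurable_funX; apply: measurable_funD;
    [exact: (L2_meas Lf)|exact: (L2_meas Lg)].
  - by apply: emeasurable_funD; apply/measurable_EFinP; apply: measurable_funM => //;
      apply: measurable_funX; [exact: (L2_meas Lf)|exact: (L2_meas Lg)].
  - move=> x _; rewrite -EFinD lee_fin -subr_ge0.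
    by rewrite (_ : _ - _ = (f x - g x) ^+ 2) ?sqr_ge0//; ring.
have i2 h : L2 h -> mu.-integrable setT (fun x => (2 * h x ^+ 2)%:E).
  by move=> Lh; exact: integrableZl (L2_sqr_integrable Lh).
by rewrite integralD ?i2// ltey_eq fin_numD !integrable_fin_num// i2.
Qed.

Lemma L2Z k f : L2 f -> L2 (fun x => k * f x).
Proof.
move=> Lf; split; first by apply: measurable_funM => //; exact: L2_meas.
have i2 := integrableZl measurableT (k ^+ 2) (L2_sqr_integrable Lf).
have := integrable_fin_num measurableT i2; rewrite ltey_eq => h.
by apply/orP; left; move: h; under eq_integral do rewrite /= -EFinM -exprMn.
Qed.

Lemma L2N f : L2 f -> L2 (fun x => - f x).
Proof. by move=> /(@L2Z (-1)); under eq_fun do rewrite mulN1r. Qed.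

Lemma L2B f g : L2 f -> L2 g -> L2 (fun x => f x - g x).
Proof. by move=> Lf /L2N; exact: L2D. Qed.

Lemma L20 : L2 (fun=> 0).
Proof.
split => //; under eq_integral do rewrite expr0n/=.
by rewrite integral0.
Qed.

Lemma L2_sum (I : Type) (s : seq I) (f : I -> T -> R) :
  (forall i, L2 (f i)) -> L2 (fun x => \sum_(i <- s) f i x).
Proof.
move=> Lf; elim: s => [|i s IHs]; first by under eq_fun do rewrite big_nil; exact: L20.
by under eq_fun do rewrite big_cons; exact: L2D.
Qed.

Lemma L2_bounded_mul (M : R) f g : measurable_fun setT g -> (forall x, `|g x| <= M) ->
  L2 f -> L2 (fun x => g x * f x).
Proof.
move=> mg gM Lf; apply: (@L2_le _ (fun x => M * f x)); last exact: L2Z.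
  by apply: measurable_funM => //; exact: L2_meas.
move=> x; rewrite !normrM ler_wpM2r//; apply: le_trans (gM x) _; exact: ler_norm.
Qed.

Lemma dotC f g : dot f g = dot g f.
Proof. by rewrite /dot; under eq_Rintegral do rewrite mulrC. Qed.

Lemma dotDl f g h : L2 f -> L2 g -> L2 h -> dot (fun x => f x + g x) h = dot f h + dot g h.
Proof.
move=> Lf Lg Lh; rewrite /dot -RintegralD//; try exact: L2_mul_integrable.
by apply: eq_Rintegral => x _; rewrite mulrDl.
Qed.

Lemma dotZl k f h : L2 f -> L2 h -> dot (fun x => k * f x) h = k * dot f h.
Proof.
move=> Lf Lh; rewrite /dot -RintegralZl//; last exact: L2_mul_integrable.
by apply: eq_Rintegral => x _; rewrite mulrA.
Qed.

Lemma dotBl f g h : L2 f -> L2 g -> L2 h -> dot (fun x => f x - g x) h = dot f h - dot g h.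
Proof.
move=> Lf Lg Lh; rewrite /dot -RintegralB//; try exact: L2_mul_integrable.
by apply: eq_Rintegral => x _; rewrite mulrBl.
Qed.

Lemma dot_suml (I : Type) (s : seq I) (f : I -> T -> R) h : (forall i, L2 (f i)) -> L2 h ->
  dot (fun x => \sum_(i <- s) f i x) h = \sum_(i <- s) dot (f i) h.
Proof.
move=> Lf Lh; elim: s => [|i s IHs].
  rewrite big_nil /dot; under eq_Rintegral do rewrite big_nil mul0r.
  by rewrite /Rintegral integral0.
rewrite big_cons -IHs -dotDl//; last exact: L2_sum.
by congr (dot _ h); apply/funext => x; rewrite big_cons.
Qed.

Lemma dot_ge0 f : 0 <= dot f f.
Proof. by apply: Rintegral_ge0 => x _; rewrite -expr2 sqr_ge0. Qed.

Lemma dotE f : L2 f -> (dot f f)%:E = (\int[mu]_x (f x ^+ 2)%:E)%E.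
Proof.
move=> Lf; rewrite /dot /Rintegral; under eq_integral do rewrite -expr2.
by rewrite fineK// integrable_fin_num//; exact: L2_sqr_integrable.
Qed.

Lemma dotBB f g : L2 f -> L2 g ->
  dot (fun x => f x - g x) (fun x => f x - g x) = dot f f - 2 * dot f g + dot g g.
Proof.
move=> Lf Lg; have Lfg := L2B Lf Lg.
rewrite dotBl// (dotC f) (dotC g) !dotBl// (dotC g f); ring.
Qed.

Lemma cauchy_schwarz f g : L2 f -> L2 g -> dot f g ^+ 2 <= dot f f * dot g g.
Proof.
move=> Lf Lg.
have h t : 0 <= dot f f - 2 * t * dot f g + t ^+ 2 * dot g g.
  have := dot_ge0 (fun x => f x - t * g x).
  rewrite dotBB//; last exact: L2Z.
  rewrite dotZl//; last exact: L2Z.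
  rewrite (dotC f) (dotC g (fun x => t * g x)) !dotZl// (dotC g f) => hh.
  by apply: le_trans hh _; rewrite le_eqVlt; apply/orP; left; apply/eqP; ring.
have gg := dot_ge0 g.
have [g0|g0] := eqVneq (dot g g) 0.
  rewrite g0 mulr0; have [->|fg0] := eqVneq (dot f g) 0; first by rewrite expr0n.
  (* With [dot g g = 0] the quadratic is affine in t; this value of t makes it equal to -1. *)
  have := h ((dot f f + 1) / (2 * dot f g)); rewrite g0 mulr0 addr0.
  have -> : 2 * ((dot f f + 1) / (2 * dot f g)) * dot f g = dot f f + 1 by field.
  lra.
have {}gg : 0 < dot g g by rewrite lt_neqAle eq_sym g0.
have := h (dot f g / dot g g).
have -> : dot f f - 2 * (dot f g / dot g g) * dot f g + (dot f g / dot g g) ^+ 2 * dot g g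
  = (dot f f * dot g g - dot f g ^+ 2) / dot g g by field.
by rewrite pmulr_lge0 ?invr_gt0// subr_ge0.
Qed.

Definition orthonormal_seq (e : nat -> T -> R) :=
  (forall j, L2 (e j)) /\ (forall i j, dot (e i) (e j) = (i == j)%:R).

(** Completing the square in each coefficient. The last sum vanishes when the [c j] are the
    coefficients of [f], which gives both Bessel's inequality and the distance to the span. *)
Lemma dot_sub_proj e f (c : nat -> R) n : orthonormal_seq e -> L2 f ->
  let g := fun x => \sum_(j < n) c j * e j x in
  dot (fun x => f x - g x) (fun x => f x - g x) =
  dot f f - \sum_(j < n) dot f (e j) ^+ 2 + \sum_(j < n) (c j - dot f (e j)) ^+ 2.
Proof.
move=> [Le oe] Lf g.
have Lc j : L2 (fun x => c j * e j x) by exact: L2Z.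
have Lg : L2 g.
  exact: (L2_sum _ (fun j : 'I_n => Lc j)).
rewrite dotBB//.
have -> : dot f g = \sum_(j < n) c j * dot f (e j).
  rewrite dotC /g (dot_suml _ (fun j : 'I_n => Lc j))//.
  by apply: eq_bigr => j _; rewrite dotZl// dotC.
have -> : dot g g = \sum_(j < n) c j ^+ 2.
  rewrite {1}/g (dot_suml _ (fun j : 'I_n => Lc j))//.
  apply: eq_bigr => j _; rewrite dotZl// dotC /g (dot_suml _ (fun j : 'I_n => Lc j))//.
  rewrite (bigD1 j)//= big1 ?addr0 => [|i ij].
    by rewrite dotZl// oe eqxx mulr1 expr2.
  by rewrite dotZl// oe -val_eqE/= in ij *; rewrite (negbTE ij) mulr0.
rewrite -addrA -[RHS]addrA; congr (_ + _).
rewrite mulr_sumr -!sumrN -!big_split/=; apply: eq_bigr => j _; ring.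
Qed.

Lemma bessel_fin e f n : orthonormal_seq e -> L2 f ->
  \sum_(j < n) dot f (e j) ^+ 2 <= dot f f.
Proof.
move=> oe Lf; have h := dot_sub_proj (fun j => dot f (e j)) n oe Lf.
have := dot_ge0 (fun x => f x - \sum_(j < n) dot f (e j) * e j x).
rewrite h [X in _ + X]big1 ?addr0 ?subr_ge0// => j _.
by rewrite subrr expr0n.
Qed.

End L2.

(** * Closed span of an orthonormal sequence *)

Section Completeness.
Context d (T : measurableType d) (R : realType) (mu : {measure set T -> \bar R}).
Variable e : nat -> T -> R.
Hypothesis oe : orthonormal_seq mu e.
Implicit Types f g h : T -> R.

(** By [defectE] this is the squared distance from [f] to the span of the first [n] vectors; in
    terms of the coefficients it is visibly nonincreasing in [n]. *)
Definition defect n f : R := dot mu f f - \sum_(j < n) dot mu f (e j) ^+ 2.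

(* The L2-closure of the linear span of [e], described by vanishing of the distances to the
   finite-dimensional spans. *)
Definition inspan f := L2 mu f /\ forall eps, 0 < eps -> exists n, defect n f < eps.

Let Le j : L2 mu (e j). Proof. exact: oe.1. Qed.

Lemma defectE n f : L2 mu f -> defect n f =
  dot mu (fun x => f x - \sum_(j < n) dot mu f (e j) * e j x)
         (fun x => f x - \sum_(j < n) dot mu f (e j) * e j x).
Proof.
move=> Lf; rewrite (dot_sub_proj (fun j => dot mu f (e j)) n oe Lf).
by rewrite [X in _ + X]big1 ?addr0// => j _; rewrite subrr expr0n.
Qed.

Lemma defect_ge0 n f : L2 mu f -> 0 <= defect n f.
Proof. by move=> Lf; rewrite defectE//; exact: dot_ge0. Qed.

Lemma defect_le m n f : (m <= n)%N -> defect n f <= defect m f.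
Proof.
move=> mn; rewrite lerD2l lerN2 -(subnKC mn) big_split_ord/= lerDl.
by apply: sumr_ge0 => j _; exact: sqr_ge0.
Qed.

Lemma defect_le_dot n f : defect n f <= dot mu f f.
Proof. by rewrite gerBl sumr_ge0// => j _; exact: sqr_ge0. Qed.

Lemma dotDD_le f g : L2 mu f -> L2 mu g ->
  dot mu (fun x => f x + g x) (fun x => f x + g x) <= 2 * dot mu f f + 2 * dot mu g g.
Proof.
move=> Lf Lg; have := dot_ge0 mu (fun x => f x - g x); rewrite dotBB// => h.
rewrite dotDl//; last exact: L2D.
rewrite (dotC mu f) (dotC mu g) !dotDl// (dotC mu g f); lra.
Qed.

Lemma defectD n f g : L2 mu f -> L2 mu g ->
  defect n (fun x => f x + g x) <= 2 * defect n f + 2 * defect n g.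
Proof.
move=> Lf Lg; rewrite !defectE//; last exact: L2D.
have Lp h : L2 mu h -> L2 mu (fun x => h x - \sum_(j < n) dot mu h (e j) * e j x).
  move=> Lh; apply: L2B => //.
  by apply: (@L2_sum _ _ _ _ _ _ (fun j : 'I_n => _)) => j; exact: L2Z.
apply: le_trans (dotDD_le (Lp _ Lf) (Lp _ Lg)).
rewrite le_eqVlt; apply/orP; left; apply/eqP; congr (dot mu _ _); apply/funext => x;
  under eq_bigr do rewrite dotDl// mulrDl; rewrite big_split/=; ring.
Qed.

Lemma inspan_e j : inspan (e j).
Proof.
split=> // eps e0; exists j.+1; apply: le_lt_trans e0.
rewrite /defect (bigD1 ord_max)//= !oe.2 eqxx expr1n opprD addrA subrr add0r oppr_le0.
by apply: sumr_ge0 => i _; exact: sqr_ge0.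
Qed.

Lemma inspanD f g : inspan f -> inspan g -> inspan (fun x => f x + g x).
Proof.
move=> [Lf hf] [Lg hg]; split=> [|eps e0]; first exact: L2D.
have e4 : 0 < eps / 4 by rewrite divr_gt0.
have [n hn] := hf _ e4; have [m hm] := hg _ e4; exists (maxn n m).
apply: le_lt_trans (defectD _ Lf Lg) _.
have := defect_le f (leq_maxl n m); have := defect_le g (leq_maxr n m); lra.
Qed.

Lemma inspanZ k f : inspan f -> inspan (fun x => k * f x).
Proof.
move=> [Lf hf]; split=> [|eps e0]; first exact: L2Z.
have k0 : 0 < k ^+ 2 + 1 by rewrite ltr_wpDl// sqr_ge0.
have [n hn] := hf _ (divr_gt0 e0 k0); exists n.
have -> : defect n (fun x => k * f x) = k ^+ 2 * defect n f.
  rewrite /defect mulrBr mulr_sumr dotZl//; last exact: L2Z.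
  rewrite dotC dotZl//; congr (_ - _); first by ring.
  by apply: eq_bigr => j _; rewrite dotZl// exprMn.
apply: (@le_lt_trans _ _ ((k ^+ 2 + 1) * defect n f)).
  by rewrite ler_wpM2r ?defect_ge0// lerDl.
by rewrite mulrC -ltr_pdivlMr.
Qed.

Lemma inspan0 : inspan (fun=> 0).
Proof.
have := inspanZ 0 (inspan_e 0); congr inspan; apply/funext => x.
by rewrite mul0r.
Qed.

Lemma inspanB f g : inspan f -> inspan g -> inspan (fun x => f x - g x).
Proof.
move=> hf /(inspanZ (-1)) hg; have := inspanD hf hg.
by congr inspan; apply/funext => x; rewrite mulN1r.
Qed.

Lemma inspan_sum (I : Type) (s : seq I) (f : I -> T -> R) :
  (forall i, inspan (f i)) -> inspan (fun x => \sum_(i <- s) f i x).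
Proof.
move=> hf; elim: s => [|i s IHs]; first by under eq_fun do rewrite big_nil; exact: inspan0.
by under eq_fun do rewrite big_cons; exact: inspanD.
Qed.

(** Dominated convergence turns pointwise convergence into convergence in L2. Then [defectD] splits
    [h] into [h - h_ N], small in norm, and [h_ N], whose defect is small. *)
Lemma inspan_lim (h_ : nat -> T -> R) h G : (forall n, inspan (h_ n)) ->
  measurable_fun setT h -> L2 mu G -> (forall n x, `|h_ n x| <= G x) ->
  (forall x, `|h x| <= G x) ->
  {ae mu, forall x, h_ n x @[n --> \oo] --> h x} -> inspan h.
Proof.
move=> hn mh LG hG hhG hlim.
have Lh : L2 mu h.
  by apply: L2_le LG => // x; apply: le_trans (hhG x) _; exact: ler_norm.
split=> // eps e0.
have Lhn n : L2 mu (h_ n) by exact: (hn n).1.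
pose f_ n := EFin \o (fun x => (h x - h_ n x) * (h x - h_ n x)).
have [] := @dominated_convergence _ _ _ mu setT measurableT f_ (cst 0)
  (EFin \o (fun x => 4 * (G x ^+ 2))).
- move=> n; apply/measurable_EFinP; apply: measurable_funM; apply: measurable_funB => //;
  exact: (L2_meas (Lhn n)).
- by [].
- apply: aeS hlim => x hx _ /=; apply/cvg_EFin; first by near=> n.
  rewrite /comp/=.
  have h0 : h x - h_ n x @[n --> \oo] --> (0 : R).
    by rewrite -[X in _ --> X](subrr (h x)); apply: cvgB => //; exact: cvg_cst.
  have := cvgM h0 h0; rewrite mulr0; exact.
- exact: integrableZl (L2_sqr_integrable LG).
- apply: aeW => x n _; rewrite lee_fin ger0_norm -?expr2 ?sqr_ge0//.
  have := hG n x; have := hhG x; rewrite !ler_norml => /andP[? ?] /andP[? ?].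
  nra.
move=> _ _; rewrite integral0 => /fine_cvgP[_ /cvgrPdist_lt].
have e4 : 0 < eps / 4 by rewrite divr_gt0.
move=> /(_ _ e4) [N _ /(_ N (leqnn N))]; rewrite /= sub0r normrN.
rewrite -[fine _]/(dot mu (fun x => h x - h_ N x) (fun x => h x - h_ N x)).
rewrite ger0_norm ?dot_ge0// => hN.
have [n hnn] := (hn N).2 _ e4; exists n.
have -> : h = (fun x => (h x - h_ N x) + h_ N x) by apply/funext => x; rewrite subrK.
apply: le_lt_trans (defectD n (L2B Lh (Lhn N)) (Lhn N)) _.
have := defect_le_dot n (fun x => h x - h_ N x); lra.
Unshelve. all: by end_near. Qed.

End Completeness.

Lemma L2_indic d (T : measurableType d) (R : realType) (mu : {measure set T -> \bar R}) A :
  measurable A -> (mu A < +oo)%E -> L2 mu (\1_A : T -> R).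
Proof.
move=> mA Aoo; split; first exact: measurable_indic.
rewrite (_ : (fun _ => _) = (fun x => (\1_A x)%:E)); last first.
  by apply/funext => x; rewrite indicE; case: (_ \in _); rewrite ?expr1n ?expr0n.
by rewrite integral_indic// setIT.
Qed.

(** * Completeness of the sine system *)

Section TrigSystems.
Variables (R : realType) (a b : R).
Hypothesis ab : a < b.
Local Notation leb := (@lebesgue_measure R).

Definition freq : R := pi / (b - a).
(** L2 normalisation: the squares of the sines and cosines below have mean 1/2 over the interval. *)
Definition sysc : R := Num.sqrt (2 / (b - a)).
(** Index [j] stands for frequency [j + 1], so that inside the interval [cosI j] is, up to a factor,
    the derivative of [sinI j]. The cosines leave out the constant mode: they only enter through
    Bessel's inequality. *)
Definition sinI (j : nat) (x : R) : R :=
  sysc * sin (freq * j.+1%:R * (x - a)) * \1_`[a, b]%classic x.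
Definition cosI (j : nat) (x : R) : R :=
  sysc * cos (freq * j.+1%:R * (x - a)) * \1_`[a, b]%classic x.

Let ba0 : 0 < b - a. Proof. by rewrite subr_gt0. Qed.

Lemma freq_gt0 : 0 < freq. Proof. by rewrite divr_gt0// pi_gt0. Qed.

Lemma sysc2 : sysc * sysc = 2 / (b - a).
Proof. by rewrite -expr2 sqr_sqrtr// divr_ge0// ltW. Qed.

Lemma sin_pi_nat (k : nat) : sin (pi *+ k) = 0 :> R.
Proof. by elim: k => [|k IHk]; rewrite ?mulr0n ?sin0// mulrSr sinDpi IHk oppr0. Qed.

Lemma continuous_cos_affine (k x0 : R) : continuous (fun x : R => cos (k * (x - x0))).
Proof.
move=> x; apply: continuous_comp; last exact: continuous_cos.
by apply: cvgM; [exact: cvg_cst|apply: cvgB; [exact: cvg_id|exact: cvg_cst]].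
Qed.

Lemma continuous_sin_affine (k x0 : R) : continuous (fun x : R => sin (k * (x - x0))).
Proof.
move=> x; apply: continuous_comp; last exact: continuous_sin.
by apply: cvgM; [exact: cvg_cst|apply: cvgB; [exact: cvg_id|exact: cvg_cst]].
Qed.

Lemma Rintegral_cos (k : nat) :
  \int[leb]_(x in `[a, b]) cos (freq * k%:R * (x - a)) = if k == 0%N then b - a else 0.
Proof.
case: k => [|k].
  under eq_Rintegral do rewrite mulr0 mul0r cos0.
  by rewrite Rintegral_cst//= lebesgue_measure_itv/= lte_fin ab mul1r -EFinD.
have k0 : freq * k.+1%:R != 0 by rewrite mulf_neq0 ?pnatr_eq0// gt_eqF// freq_gt0.
rewrite /Rintegral.
rewrite (@continuous_FTC2 _ _ (fun x => sin (freq * k.+1%:R * (x - a)) / (freq * k.+1%:R)))//.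
- rewrite subrr mulr0 sin0 mul0r sube0/=.
  have -> : freq * k.+1%:R * (b - a) = pi *+ k.+1.
    by rewrite -mulr_natr /freq; field; rewrite gt_eqF.
  by rewrite sin_pi_nat mul0r.
- by apply: continuous_subspaceT; exact: continuous_cos_affine.
- split.
  + move=> x _; exact: ex_derive.
  + apply: cvg_at_right_filter; apply: cvgM; last exact: cvg_cst.
    exact: continuous_sin_affine.
  + apply: cvg_at_left_filter; apply: cvgM; last exact: cvg_cst.
    exact: continuous_sin_affine.
- move=> x _; rewrite derive1E.
  have D : is_derive x 1 (fun x => sin (freq * k.+1%:R * (x - a)) / (freq * k.+1%:R))
     (cos (freq * k.+1%:R * (x - a))).
    apply: is_derive_eq.
    rewrite /GRing.scale/=; field.
    by rewrite nat1r pnatr_eq0/= gt_eqF// freq_gt0.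
  by rewrite derive_val.
Qed.


Lemma sin_mul_sin (x y : R) : sin x * sin y = (cos (x - y) - cos (x + y)) / 2.
Proof. by rewrite cosB cosD; field. Qed.

Lemma cos_mul_cos (x y : R) : cos x * cos y = (cos (x - y) + cos (x + y)) / 2.
Proof. by rewrite cosB cosD; field. Qed.

Let I := `[a, b]%classic.

Let mI : measurable I. Proof. exact: measurable_itv. Qed.

Lemma L2_indicI : L2 leb (\1_I).
Proof.
apply: L2_indic => //.
by rewrite /I /= lebesgue_measure_itv/= lte_fin ab -EFinD ltry.
Qed.

Lemma L2_mul_indicI (f : R -> R) (M : R) : continuous f -> (forall x, `|f x| <= M) ->
  L2 leb (fun x => f x * \1_I x).
Proof.
move=> cf fM.
by apply: (@L2_bounded_mul _ _ R leb) fM L2_indicI; exact: continuous_measurable_fun.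
Qed.

Let cI k : leb.-integrable I (EFin \o (fun x => cos (freq * k%:R * (x - a)))).
Proof.
apply: continuous_compact_integrable; first exact: segment_compact.
by apply: continuous_subspaceT; exact: continuous_cos_affine.
Qed.

Lemma sysc_ge0 : 0 <= sysc. Proof. exact: sqrtr_ge0. Qed.

Lemma normr_sinI j x : `|sinI j x| <= sysc * \1_I x.
Proof.
rewrite /sinI !normrM (ger0_norm sysc_ge0) (@ger0_norm _ (\1__ _)) ?indicE// ler_wpM2r//.
by rewrite ler_piMr ?sysc_ge0// ler_norml sin_geN1 sin_le1.
Qed.

Lemma normr_cosI j x : `|cosI j x| <= sysc * \1_I x.
Proof.
rewrite /cosI !normrM (ger0_norm sysc_ge0) (@ger0_norm _ (\1__ _)) ?indicE// ler_wpM2r//.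
by rewrite ler_piMr ?sysc_ge0// ler_norml cos_geN1 cos_le1.
Qed.

Lemma measurable_sinI j : measurable_fun setT (sinI j).
Proof.
apply: measurable_funM; last exact: measurable_indic.
apply: measurable_funM => //; apply: continuous_measurable_fun.
exact: continuous_sin_affine.
Qed.

Lemma measurable_cosI j : measurable_fun setT (cosI j).
Proof.
apply: measurable_funM; last exact: measurable_indic.
apply: measurable_funM => //; apply: continuous_measurable_fun.
exact: continuous_cos_affine.
Qed.

Lemma L2_sinI j : L2 leb (sinI j).
Proof.
apply: (@L2_le _ _ R leb _ (fun x => sysc * \1_I x)); last exact: L2Z L2_indicI.
  exact: measurable_sinI.
by move=> x; apply: le_trans (normr_sinI j x) _; exact: ler_norm.
Qed.

Lemma L2_cosI j : L2 leb (cosI j).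
Proof.
apply: (@L2_le _ _ R leb _ (fun x => sysc * \1_I x)); last exact: L2Z L2_indicI.
  exact: measurable_cosI.
by move=> x; apply: le_trans (normr_cosI j x) _; exact: ler_norm.
Qed.

Let cos_sub (i j : nat) x : (i <= j)%N ->
  cos (freq * i.+1%:R * x - freq * j.+1%:R * x) = cos (freq * (j - i)%N%:R * x).
Proof.
by move=> ij; rewrite -[LHS]cosN natrB//; congr cos; rewrite -!natr1; ring.
Qed.

Let cos_add (i j : nat) x :
  cos (freq * i.+1%:R * x + freq * j.+1%:R * x) = cos (freq * (i + j).+2%:R * x).
Proof. by congr cos; rewrite -!natr1 natrD; ring. Qed.

Lemma orthonormal_sinI : orthonormal_seq leb sinI.
Proof.
split=> [|i j]; first exact: L2_sinI.
wlog ij : i j / (i <= j)%N.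
  move=> H; have [/H//|/ltnW ji] := leqP i j.
  by rewrite dotC H// eq_sym.
transitivity (\int[leb]_(x in I) ((b - a)^-1 * (cos (freq * (j - i)%N%:R * (x - a)) -
    cos (freq * (i + j).+2%:R * (x - a))))).
  rewrite Rintegral_mkcond; apply: eq_Rintegral => x _.
  rewrite patchE /sinI indicE -/I; case: (x \in I); last by rewrite !mulr0.
  rewrite !mulr1 mulrACA sysc2 sin_mul_sin cos_sub// cos_add.
  by field; rewrite gt_eqF.
rewrite RintegralZl//; last first.
  by apply: (@integrableB _ _ R leb I mI _ _ (cI (j - i)) (cI (i + j).+2)).
rewrite RintegralB// !Rintegral_cos/= subr0 subn_eq0 eqn_leq ij/=.
by case: leqP => _; rewrite ?mulr0// mulVf// gt_eqF.
Qed.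

Lemma orthonormal_cosI : orthonormal_seq leb cosI.
Proof.
split=> [|i j]; first exact: L2_cosI.
wlog ij : i j / (i <= j)%N.
  move=> H; have [/H//|/ltnW ji] := leqP i j.
  by rewrite dotC H// eq_sym.
transitivity (\int[leb]_(x in I) ((b - a)^-1 * (cos (freq * (j - i)%N%:R * (x - a)) +
    cos (freq * (i + j).+2%:R * (x - a))))).
  rewrite Rintegral_mkcond; apply: eq_Rintegral => x _.
  rewrite patchE /cosI indicE -/I; case: (x \in I); last by rewrite !mulr0.
  rewrite !mulr1 mulrACA sysc2 cos_mul_cos cos_sub// cos_add.
  by field; rewrite gt_eqF.
rewrite RintegralZl//; last first.
  by apply: (@integrableD _ _ R leb I mI _ _ (cI (j - i)) (cI (i + j).+2)).
rewrite RintegralD// !Rintegral_cos/= addr0 subn_eq0 eqn_leq ij/=.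
by case: leqP => _; rewrite ?mulr0// mulVf// gt_eqF.
Qed.

End TrigSystems.

Section SineComplete.
Variables (R : realType) (a b : R).
Hypothesis ab : a < b.
Local Notation leb := (@lebesgue_measure R).
Let I := `[a, b]%classic.
Let ba0 : 0 < b - a. Proof. by rewrite subr_gt0. Qed.
Let w := freq a b.
Local Notation inspan := (inspan leb (sinI a b)).
Let oe := orthonormal_sinI ab.

Let u j (x : R) : R := sin (w * j.+1%:R * (x - a)) * \1_I x.
Let sysc0 : 0 < sysc a b. Proof. by rewrite sqrtr_gt0 divr_gt0. Qed.


Let inspan_u j : inspan (u j).
Proof.
have := inspanZ oe (sysc a b)^-1 (inspan_e oe j); congr inspan; apply/funext => x.
by rewrite /sinI /u -!mulrA mulKf// gt_eqF.
Qed.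

(** Multiplication by the cosine stays in the span: 2 sin(j t) cos(t) = sin((j+1) t) + sin((j-1) t),
    and for the lowest sine the second term is zero. *)
Lemma inspan_sin_poly_cos (p : {poly R}) j :
  inspan (fun x => u j x * p.[cos (w * (x - a))]).
Proof.
elim/poly_ind: p j => [|p c IHp] j.
  have := inspan0 oe; congr inspan; apply/funext => x.
  by rewrite horner0 mulr0.
have {}IHp : inspan (fun x => u j x * cos (w * (x - a)) * p.[cos (w * (x - a))]).
  case: j => [|j].
    have := inspanZ oe 2^-1 (IHp 1%N); congr inspan; apply/funext => x; rewrite /u mulr1.
    have -> : w * 2 * (x - a) = w * (x - a) + w * (x - a) by ring.
    by rewrite sinD; field.
  have := inspanZ oe 2^-1 (inspanD oe (IHp j.+2) (IHp j)); congr inspan.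
  apply/funext => x; rewrite /u.
  have -> : w * j.+3%:R * (x - a) = w * j.+2%:R * (x - a) + w * (x - a).
    by rewrite -natr1; ring.
  have -> : w * j.+1%:R * (x - a) = w * j.+2%:R * (x - a) - w * (x - a).
    by rewrite -[j.+2%:R]natr1; ring.
  by rewrite sinD sinB; field.
have := inspanD oe IHp (inspanZ oe c (inspan_u j)); congr inspan.
by apply/funext => x; rewrite hornerMXaddC; ring.
Qed.

End SineComplete.

(* The polynomials [(1 - v ^+ n) ^+ (2 ^ n)] of the elementary proof of the Stone-Weierstrass
   theorem converge boundedly on [0, 1] to the indicator of [v < 1/2]. *)
Section StepPolynomials.
Variable R : realType.
Implicit Types v y : R.

Lemma bernoulli_ge y n : 0 <= y <= 1 -> 1 - n%:R * y <= (1 - y) ^+ n.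
Proof.
move=> /andP[y0 y1]; elim: n => [|n IHn]; first by rewrite mul0r subr0 expr0.
have y1' : 0 <= 1 - y by lra.
have := ler_wpM2r y1' IHn; rewrite -exprSr; apply: le_trans.
rewrite -natr1; have : 0 <= n%:R * y ^+ 2 by rewrite mulr_ge0// sqr_ge0.
nra.
Qed.

(** Bernoulli's inequality bounds n y by (1 + y)^n, and (1 + y)^n (1 - y)^n = (1 - y^2)^n is at most
    1. *)
Lemma bernoulli_le y n : 0 <= y <= 1 -> n%:R * y * (1 - y) ^+ n <= 1.
Proof.
move=> /andP[y0 y1].
have h : 1 + n%:R * y <= (1 + y) ^+ n.
  elim: n => [|n IHn]; first by rewrite mul0r addr0 expr0.
  have y1' : 0 <= 1 + y by lra.
  have := ler_wpM2r y1' IHn; rewrite -exprSr; apply: le_trans.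
  rewrite -natr1; have : 0 <= n%:R * y ^+ 2 by rewrite mulr_ge0// sqr_ge0.
  nra.
have p0 : 0 <= (1 - y) ^+ n by rewrite exprn_ge0//; lra.
apply: (@le_trans _ _ ((1 + y) ^+ n * (1 - y) ^+ n)).
  by rewrite ler_wpM2r//; lra.
rewrite -exprMn exprn_ile1//; nra.
Qed.

Definition steppoly n v := (1 - v ^+ n) ^+ (2 ^ n).

Lemma steppoly_itv n v : 0 <= v <= 1 -> 0 <= steppoly n v <= 1.
Proof.
move=> /andP[v0 v1]; have := exprn_ile1 n v0 v1; have := exprn_ge0 n v0 => h1 h2.
by rewrite exprn_ge0 ?exprn_ile1; lra.
Qed.

Lemma steppoly_cvg1 v : 0 <= v < 1/2 -> steppoly n v @[n --> \oo] --> (1 : R).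
Proof.
move=> /andP[v0 v1].
apply: (@squeeze_cvgr _ _ _ _ (fun n => 1 - (2 * v) ^+ n) (fun=> 1)).
- near=> n.
  have vn : 0 <= v ^+ n <= 1 by rewrite exprn_ge0// exprn_ile1; lra.
  have /andP[_ ->] : 0 <= steppoly n v <= 1 by apply: steppoly_itv; lra.
  rewrite andbT exprMn -natrX; exact: bernoulli_ge.
- rewrite -[X in _ --> X]subr0; apply: cvgB; first exact: cvg_cst.
  by apply: cvg_expr; rewrite ger0_norm; lra.
- exact: cvg_cst.
Unshelve. all: by end_near. Qed.

Lemma steppoly_cvg0 v : 1/2 < v <= 1 -> steppoly n v @[n --> \oo] --> (0 : R).
Proof.
move=> /andP[v0 v1].
apply: (@squeeze_cvgr _ _ _ _ (fun=> 0) (fun n => ((2 * v)^-1) ^+ n)).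
- near=> n.
  have vn : 0 <= v ^+ n <= 1 by rewrite exprn_ge0 ?exprn_ile1; lra.
  have /andP[-> _] : 0 <= steppoly n v <= 1 by apply: steppoly_itv; lra.
  have v2 : 0 < (2 * v) ^+ n by rewrite exprn_gt0//; lra.
  rewrite exprVn -[leRHS]mul1r ler_pdivlMr// mulrC exprMn -natrX.
  exact: bernoulli_le.
- exact: cvg_cst.
- apply: cvg_expr; rewrite ger0_norm ?invr_ge0; last lra.
  by rewrite invf_lt1; lra.
Unshelve. all: by end_near. Qed.

End StepPolynomials.

Section SineParseval.
Variables (R : realType) (a b : R).
Hypothesis ab : a < b.
Local Notation leb := (@lebesgue_measure R).
Let I := `[a, b]%classic.
Let ba0 : 0 < b - a. Proof. by rewrite subr_gt0. Qed.
Let w := freq a b.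
Local Notation inspan := (inspan leb (sinI a b)).
Let oe := orthonormal_sinI ab.
(** The lowest sine, positive inside the interval. A function supported in the interval is [u] times
    some g up to the endpoints, so it suffices to approximate g by simple functions. *)
Let u (x : R) : R := sin (w * 1 * (x - a)) * \1_I x.

Let angleI x : I x -> w * (x - a) \in `[0, pi].
Proof.
rewrite /I /= !in_itv/= => /andP[ax xb].
have w0 : 0 < w by exact: freq_gt0.
have -> : pi = w * (b - a) by rewrite /w /freq divfK// gt_eqF.
by rewrite mulr_ge0 ?subr_ge0 ?(ltW w0)//= ler_wpM2l ?(ltW w0)// lerD2r.
Qed.

Let u_norm x : `|u x| <= \1_I x.
Proof.
rewrite /u normrM (@ger0_norm _ (\1__ _)) ?indicE// ler_piMl//.
by rewrite ler_norml sin_geN1 sin_le1.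
Qed.

Let inspan_u_poly (p : {poly R}) : inspan (fun x => u x * p.[cos (w * (x - a))]).
Proof. exact: (inspan_sin_poly_cos ab p 0). Qed.

Let inspan_u : inspan u.
Proof.
by have := inspan_u_poly 1; congr inspan; apply/funext => x; rewrite hornerC mulr1.
Qed.

Let measurable_u : measurable_fun setT u.
Proof. exact: (L2_meas inspan_u.1). Qed.

(** Cosine is decreasing on [0, pi], so within the interval x > y reads cos(w (x - a)) < c: step
    polynomials in the cosine converge to the indicator of the ray, except possibly at y. *)
Lemma inspan_u_ray y : inspan (fun x => u x * \1_`]y, +oo[ x).
Proof.
have [ya|ay] := leP y a.
  have := inspan_u; congr inspan; apply/funext => x; rewrite /u !indicE.
  case: (boolP (x \in I)) => [|_]; last by rewrite !mulr0 mul0r.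
  rewrite inE /I /= in_itv/= => /andP[ax _].
  case: (boolP (x \in _)) => [_|]; first by rewrite !mulr1.
  rewrite notin_setE/= in_itv/= andbT => /negP; rewrite -leNgt => xy.
  by rewrite (_ : x = a) ?subrr ?mulr0 ?sin0 ?mul0r//; lra.
have [yb|by_] := ltP y b; last first.
  have := inspan0 oe; congr inspan; apply/funext => x; rewrite /u !indicE.
  case: (boolP (x \in I)) => [|_]; last by rewrite !mulr0 mul0r.
  rewrite inE /I /= in_itv/= => /andP[_ xb].
  case: (boolP (x \in _)) => [|_]; last by rewrite mulr0.
  by rewrite inE/= in_itv/= andbT; lra.
pose c := cos (w * (y - a)).
(* The affine map sends z to (z - c) / 4 + 1/2, which stays in [0, 1] for z and c in [-1, 1] and
   puts the threshold z = c at 1/2. *)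
pose P n : {poly R} := (1 - (4^-1 *: ('X - c%:P) + (2^-1)%:P) ^+ n) ^+ (2 ^ n).
have PE n z : (P n).[z] = steppoly n ((z - c) / 4 + 1 / 2).
  rewrite /P /steppoly !hornerE; congr ((1 - _ ^+ _) ^+ _); ring.
have c1 : -1 <= c <= 1 by rewrite cos_geN1 cos_le1.
have v01 x : 0 <= (cos (w * (x - a)) - c) / 4 + 1 / 2 <= 1.
  have := cos_geN1 (w * (x - a)); have := cos_le1 (w * (x - a)); lra.
apply: (inspan_lim oe (h_ := fun n x => u x * (P n).[cos (w * (x - a))]) (G := \1_I)) => //.
- by apply: measurable_funM => //; exact: measurable_indic.
- exact: L2_indicI.
- move=> n x; rewrite normrM; apply: le_trans (u_norm x); rewrite ler_piMr//.
  rewrite PE; have /andP[p0 p1] := steppoly_itv n (v01 x).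
  by rewrite ger0_norm.
- move=> x; rewrite normrM; apply: le_trans (u_norm x); rewrite ler_piMr//.
  by rewrite ger0_norm indicE// lern1 leq_b1.
exists [set y]; split; first exact: measurable_set1.
  exact: lebesgue_measure_set1.
move=> x /= hx; apply: contrapT => /eqP xy; apply: hx.
have [xI|xI] := boolP (x \in I); last first.
  rewrite (_ : u x = 0) ?mul0r; last by rewrite /u indicE (negbTE xI) mulr0.
  by under eq_fun do rewrite mul0r; exact: cvg_cst.
apply: cvgM; first exact: cvg_cst.
under eq_fun do rewrite PE.
have yI : I y by rewrite /I/= in_itv/= !ltW.
rewrite inE in xI.
have := v01 x; rewrite indicE; case: (boolP (x \in _)) => yx vx.
  apply: steppoly_cvg1.
  suff : cos (w * (x - a)) < c by move: vx; lra.
  rewrite /c ltr_cos ?angleI// ltr_pM2l ?freq_gt0// ltrD2r.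
  by move: yx; rewrite inE/= in_itv/= andbT.
apply: steppoly_cvg0.
suff : c < cos (w * (x - a)) by move: vx; lra.
rewrite /c ltr_cos ?angleI// ltr_pM2l ?freq_gt0// ltrD2r.
move: yx; rewrite notin_setE/= in_itv/= andbT => /negP; rewrite -leNgt => yx.
by rewrite lt_neqAle xy.
Qed.

(** Dynkin's theorem: open rays are stable under intersection and generate the Borel sets.
    Complements are differences with [u], and countable disjoint unions are limits dominated by the
    indicator of the interval. *)
Lemma inspan_u_indic (A : set R) : measurable A -> inspan (fun x => u x * \1_A x).
Proof.
move=> mA.
have GI : setI_closed (@RGenOInfty.G R).
  move=> _ _ [x ->] [y ->]; exists (Num.max x y).
  apply/seteqP; split => z /=; rewrite !in_itv/= !andbT gt_max.
    by move=> [-> ->].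
  by move=> /andP[].
suff H : <<d @RGenOInfty.G R >> `<=`
    [set A | @measurable _ R A /\ inspan (fun x => u x * \1_A x)].
  apply: (H A _).2; rewrite setI_closed_g_dynkin_g_sigma_algebra//.
  by move: mA; rewrite -[measurable _]/((ocitv (R:=R)).-sigma.-measurable A) RGenOInfty.measurableE.
apply: smallest_sub; last first.
  by move=> _ [x ->] /=; split; [exact: measurable_itv|exact: inspan_u_ray].
split.
- split; first exact: measurableT.
  by have := inspan_u; congr inspan; apply/funext => x; rewrite indicT mulr1.
- move=> B [mB hB]; split; first exact: measurableC.
  have := inspanB oe inspan_u hB; congr inspan; apply/funext => x.
  by rewrite indicC indicE; case: (x \in B); rewrite ?mulr1 ?mulr0 ?subrr ?subr0.
move=> F tF hF /=.
have mF : measurable (\bigcup_k F k) by apply: bigcup_measurable => k _; exact: (hF k).1.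
split=> //.
have sF x : (\sum_(0 <= n < N) (\1_(F n) x)%:E)%E @[N --> \oo] --> ((\1_(\bigcup_k F k) x)%:E : \bar R).
  by rewrite indic_bigcup//; apply: is_cvg_nneseries => n _ _; rewrite lee_fin.
have sF1 N x : 0 <= \sum_(n < N) (\1_(F n) x : R) <= 1.
  rewrite sumr_ge0//= -lee_fin -sumEFin.
  apply: (@le_trans _ _ (\1_(\bigcup_k F k) x)%:E); last first.
    by rewrite lee_fin indicE lern1 leq_b1.
  rewrite indic_bigcup//.
  rewrite -(big_mkord xpredT (fun n => (\1_(F n) x)%:E : \bar R)).
  by apply: nneseries_lim_ge => n _ _; rewrite lee_fin.
apply: (inspan_lim oe (h_ := fun N x => \sum_(n < N) u x * \1_(F n) x) (G := \1_I)).
- by move=> N; apply: (inspan_sum oe _ (fun n : 'I_N => _)) => n; exact: (hF n).2.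
- by apply: measurable_funM => //; exact: measurable_indic.
- exact: L2_indicI.
- move=> N x; rewrite -mulr_sumr normrM; apply: le_trans (u_norm x); rewrite ler_piMr//.
  by have /andP[s0 s1] := sF1 N x; rewrite ger0_norm.
- move=> x; rewrite normrM; apply: le_trans (u_norm x); rewrite ler_piMr//.
  by rewrite ger0_norm indicE// lern1 leq_b1.
apply: aeW => x; under eq_fun do rewrite -mulr_sumr.
apply: cvgM; first exact: cvg_cst.
have := sF x; under eq_fun do rewrite sumEFin big_mkord.
by move/fine_cvgP => [_].
Qed.

Let u_gt0 x : a < x < b -> 0 < u x.
Proof.
move=> /andP[ax xb]; rewrite /u indicE mem_set ?mulr1 /I/= ?in_itv/= ?ltW//.
apply: sin_gt0_pi; have w0 : 0 < w by exact: freq_gt0.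
have -> : pi = w * (b - a) by rewrite /w /freq divfK// gt_eqF.
by rewrite mulr_gt0 ?subr_gt0//= ltr_pM2l// ltrD2r.
Qed.

(** Write f = u g with g = f / u inside the interval. Simple functions [phi n] increase to g, and u
    times [phi n] stays below f, which is the majorant required by [inspan_lim]. *)
Let inspan_nonneg f : L2 leb f -> (forall x, 0 <= f x) -> (forall x, ~ I x -> f x = 0) ->
  inspan f.
Proof.
move=> Lf f0 fI.
pose g := (fun x => f x * (sin (w * 1 * (x - a)))^-1) \_ `]a, b[.
have us x : a < x < b -> u x = sin (w * 1 * (x - a)).
  by move=> /andP[ax xb]; rewrite /u indicE mem_set ?mulr1// /I/= in_itv/= !ltW.
have mg : measurable_fun setT (EFin \o g).
  apply/measurable_EFinP; apply/(measurable_restrictT _ (measurable_itv _)).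
  apply: measurable_funM; first exact: measurable_funTS (L2_meas Lf).
  apply: open_continuous_measurable_fun; first exact: interval_open.
  move=> x; rewrite inE/= in_itv/= => xab; apply: cvgV.
    by apply: lt0r_neq0; have := u_gt0 xab; rewrite us.
  exact: continuous_sin_affine.
have g0 x : 0 <= g x.
  rewrite /g patchE; case: ifPn => //.
  by rewrite inE/= in_itv/= => xab; rewrite divr_ge0// -us// ltW// u_gt0.
have ug x : a < x < b -> u x * g x = f x.
  move=> xab; rewrite /g patchE ifT; last by rewrite inE/= in_itv.
  have s0 : sin (w * 1 * (x - a)) != 0 by rewrite -us// gt_eqF// u_gt0.
  by rewrite us//=; field.
pose phi := nnsfun_approx measurableT mg.
have phi_cvg x : phi n x @[n --> \oo] --> g x.
  have := cvg_nnsfun_approx measurableT mg (fun x _ => g0 x) (Logic.I : setT x).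
  by move/fine_cvgP => [_].
have phi_le n x : phi n x <= g x.
  have -> : g x = limn (phi^~ x) by apply/esym; apply: cvg_lim.
  apply: nondecreasing_cvgn_le.
    by move=> i j ij; have /lefP := nd_nnsfun_approx measurableT mg ij.
  by apply/cvg_ex; exists (g x).
have ab0 x : ~ a < x < b -> g x = 0.
  by move=> xab; rewrite /g patchE ifF//; apply/negP; rewrite inE/= in_itv.
have phi0 n x : 0 <= phi n x by exact: fun_ge0.
apply: (inspan_lim oe (h_ := fun n x => u x * phi n x) (G := f)) => //.
- move=> n; rewrite (_ : (fun _ => _) =
    (fun x => \sum_(y <- finmap.enum_fset (fset_set (range (phi n)))) y * (u x * \1_(phi n @^-1` [set y]) x))).
    apply: (inspan_sum oe _ (fun y : R => _)) => y; apply: inspanZ => //.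
    by apply: inspan_u_indic; exact: measurable_sfunP.
  apply/funext => x; rewrite {1}(fimfunE (phi n) x) fsbig_finite//= mulr_sumr.
  by apply: eq_bigr => y _; ring.
- exact: (L2_meas Lf).
- move=> n x; have [xab|xab] := pselect (a < x < b).
    have ux := u_gt0 xab.
    rewrite -ug// ger0_norm; last by rewrite mulr_ge0// ltW.
    by rewrite ler_wpM2l// ltW.
  have -> : phi n x = 0 by apply/eqP; rewrite eq_le phi0 andbT -(ab0 _ xab).
  by rewrite mulr0 normr0.
- by move=> x; rewrite ger0_norm.
(* At the endpoints [u] vanishes but [f] may not: they form the exceptional null set. *)
exists ([set a] `|` [set b]); split.
- by apply: measurableU; exact: measurable_set1.
- apply/eqP; rewrite -measure_le0; apply: le_trans (measureU2 _ _ _) _; try exact: measurable_set1.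
  by rewrite /= !lebesgue_measure_set1 adde0.
move=> x /= hx; apply: contrapT => /not_orP[xa xb]; apply: hx.
have [xab|xab] := pselect (a < x < b).
  by rewrite -ug//; apply: cvgM; [exact: cvg_cst|exact: phi_cvg].
rewrite fI; last first.
  rewrite /I/= in_itv/= => /andP[ax bx]; apply: xab.
  by rewrite !lt_neqAle ax bx !andbT eq_sym; apply/andP; split; exact/eqP.
rewrite (_ : (fun _ => _) = fun=> 0); first exact: cvg_cst.
apply/funext => n; rewrite (_ : phi n x = 0) ?mulr0//.
by apply/eqP; rewrite eq_le phi0 andbT -(ab0 _ xab).
Qed.

Lemma inspan_sine f : L2 leb f -> (forall x, ~ I x -> f x = 0) -> inspan f.
Proof.
move=> Lf fI.
have Lm h : L2 leb h -> L2 leb (fun x => Num.max (h x) 0).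
  move=> Lh; apply: (@L2_le _ _ R leb _ h) => //.
    by apply: measurable_maxr => //; exact: (L2_meas Lh).
  by move=> x; have [h0|h0] := leP (h x) 0; rewrite ?normr0// ger0_norm// ltW.
have h1 : inspan (fun x => Num.max (f x) 0).
  apply: inspan_nonneg (Lm _ Lf) _ _ => x; first by rewrite le_max lexx orbT.
  by move=> xI; rewrite fI// maxxx.
have h2 : inspan (fun x => Num.max (- f x) 0).
  apply: inspan_nonneg (Lm _ (L2N Lf)) _ _ => x; first by rewrite le_max lexx orbT.
  by move=> xI; rewrite fI// oppr0 maxxx.
have := inspanB oe h1 h2; congr inspan; apply/funext => x.
by have [h0|h0] := leP (f x) 0; have [h3|h3] := leP (- f x) 0; lra.
Qed.

Lemma sine_parseval f : L2 leb f -> (forall x, ~ I x -> f x = 0) ->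
  ((dot leb f f)%:E <= \sum_(0 <= j <oo) (dot leb f (sinI a b j) ^+ 2)%:E)%E.
Proof.
move=> Lf fI; apply/lee_addgt0Pr => eps e0.
have [_ /(_ _ e0) [n hn]] := inspan_sine Lf fI.
apply: (@le_trans _ _ ((\sum_(j < n) dot leb f (sinI a b j) ^+ 2)%:E + eps%:E)%E).
  by rewrite -EFinD lee_fin -lerBlDl ltW.
rewrite leeD2r// -sumEFin -(big_mkord xpredT (fun j => (dot leb f (sinI a b j) ^+ 2)%:E)).
by apply: nneseries_lim_ge => j _ _; rewrite lee_fin sqr_ge0.
Qed.

End SineParseval.

Lemma bessel d (T : measurableType d) (R : realType) (mu : {measure set T -> \bar R})
  (e : nat -> T -> R) (f : T -> R) : orthonormal_seq mu e -> L2 mu f ->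
  (\sum_(0 <= j <oo) (dot mu f (e j) ^+ 2)%:E <= (dot mu f f)%:E)%E.
Proof.
move=> oe Lf; apply: lime_le.
  by apply: is_cvg_nneseries => j _ _; rewrite lee_fin sqr_ge0.
by apply: nearW => n; rewrite sumEFin lee_fin big_mkord; exact: bessel_fin.
Qed.

(** * Tensor products of orthonormal bases *)

Lemma measurable_integral2 d1 d2 (T1 : measurableType d1) (T2 : measurableType d2)
    (R : realType) (mu : {sigma_finite_measure set T2 -> \bar R}) (h : T1 * T2 -> \bar R) :
  measurable_fun setT h -> measurable_fun setT (fun x => \int[mu]_y h (x, y))%E.
Proof.
move=> mh.
rewrite (_ : (fun _ => _) = (fun x => \int[mu]_y h^\+ (x, y) - \int[mu]_y h^\- (x, y))%E).
  apply: emeasurable_funB.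
    apply: (measurable_fun_fubini_tonelli_F (m2 := mu) (h^\+)%E) => //.
    exact: measurable_funepos.
  apply: (measurable_fun_fubini_tonelli_F (m2 := mu) (h^\-)%E) => //.
  exact: measurable_funeneg.
apply/funext => x; rewrite integralE; congr (_ - _)%E; apply: eq_integral => y _;
  by rewrite ?funeposE ?funenegE.
Qed.

Lemma measurable_Rintegral2 d1 d2 (T1 : measurableType d1) (T2 : measurableType d2)
    (R : realType) (mu : {sigma_finite_measure set T2 -> \bar R}) (h : T1 * T2 -> R) :
  measurable_fun setT h -> measurable_fun setT (fun x => \int[mu]_y h (x, y)).
Proof.
move=> mh; apply: (measurableT_comp (@fine_measurable R setT measurableT)).
by apply: (@measurable_integral2 _ _ _ _ _ mu (EFin \o h)); exact/measurable_EFinP.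
Qed.

(** * Sums over multi-indices *)

Section MultiSum.
Variable R : realType.

(** The head of the multi-index is summed innermost: the series over the first coordinate is handled
    by a one-dimensional inequality, the remaining ones by induction on slices. *)
Fixpoint multisum (n : nat) (F : seq nat -> \bar R) : \bar R :=
  match n with
  | 0 => F [::]
  | n'.+1 => multisum n' (fun s => \sum_(0 <= j <oo) F (j :: s))%E
  end.

Lemma multisum_ge0 n F : (forall s, 0 <= F s)%E -> (0 <= multisum n F)%E.
Proof.
elim: n F => [|n IHn] F F0 /=; first exact: F0.
by apply: IHn => s; apply: nneseries_ge0.
Qed.

Lemma le_multisum n F G : (forall s, 0 <= F s)%E -> (forall s, F s <= G s)%E ->
  (multisum n F <= multisum n G)%E.
Proof.
elim: n F G => [|n IHn] F G F0 FG /=; first exact: FG.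
by apply: IHn => s; [exact: nneseries_ge0|exact: lee_nneseries].
Qed.

Lemma eq_multisum n F G : (forall s, F s = G s) -> multisum n F = multisum n G.
Proof. by move=> FG; congr multisum; exact/funext. Qed.

Lemma multisumD n F G : (forall s, 0 <= F s)%E -> (forall s, 0 <= G s)%E ->
  multisum n (fun s => F s + G s)%E = (multisum n F + multisum n G)%E.
Proof.
elim: n F G => [|n IHn] F G F0 G0 //=.
rewrite -IHn//; try by move=> s; exact: nneseries_ge0.
by apply: eq_multisum => s; rewrite nneseriesD.
Qed.

Lemma multisum_sum (I : Type) (r : seq I) n (F : I -> seq nat -> \bar R) :
  (forall i s, 0 <= F i s)%E ->
  multisum n (fun s => \sum_(i <- r) F i s)%E = (\sum_(i <- r) multisum n (F i))%E.
Proof.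
move=> F0; elim: r => [|i r IHr].
  rewrite big_nil; under eq_fun do rewrite big_nil.
  elim: n {F F0} => [//|n IHn] /=.
  by rewrite -[RHS]IHn; apply: eq_multisum => s; exact: eseries0.
rewrite big_cons -IHr -multisumD//; last by move=> s; exact: sume_ge0.
by apply: eq_multisum => s; rewrite big_cons.
Qed.

Context d (T : measurableType d) (mu : {measure set T -> \bar R}).

Lemma measurable_multisum n (F : seq nat -> T -> \bar R) :
  (forall s, measurable_fun setT (F s)) -> (forall s x, 0 <= F s x)%E ->
  measurable_fun setT (fun x => multisum n (F^~ x)).
Proof.
elim: n F => [|n IHn] F mF F0 /=; first exact: mF.
apply: (IHn (fun s x => \sum_(0 <= j <oo) F (j :: s) x)%E) => s.
  by apply: ge0_emeasurable_sum.
by move=> x; exact: nneseries_ge0.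
Qed.

Lemma integral_multisum D n (F : seq nat -> T -> \bar R) : measurable D ->
  (forall s, measurable_fun setT (F s)) -> (forall s x, 0 <= F s x)%E ->
  (\int[mu]_(x in D) multisum n (F^~ x) = multisum n (fun s => \int[mu]_(x in D) F s x))%E.
Proof.
move=> mD; elim: n F => [|n IHn] F mF F0 //=.
rewrite (IHn (fun s x => \sum_(0 <= j <oo) F (j :: s) x)%E); last 2 first.
- by move=> s; apply: ge0_emeasurable_sum.
- by move=> s x; exact: nneseries_ge0.
apply: eq_multisum => s; rewrite integral_nneseries// => j.
exact: measurable_funTS.
Qed.

End MultiSum.

Section Tensor.
Variable R : realType.
Local Notation V n := (g_sigma_algebraType (@open 'rV[R]_n)).
Local Notation leb := (@lebesgue_measure R).
Implicit Types h : nat -> R -> R.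

Definition tprod n h (x : 'rV[R]_n) : R := \prod_(i < n) h i (x ord0 i).

Lemma tprodS n h t (y : 'rV[R]_n) :
  tprod h (row_mx (t%:M : 'rV_1) y : 'rV_n.+1) = h 0%N t * tprod (fun i => h i.+1) y.
Proof.
rewrite /tprod big_ord_recl row_mx_ord0; congr (_ * _).
by apply: eq_bigr => i _; rewrite row_mx_lift.
Qed.

Lemma measurable_tprod n h : (forall i, measurable_fun setT (h i)) ->
  measurable_fun setT (tprod h : V n -> R).
Proof.
move=> mh; apply: measurable_prod => i _.
exact: measurableT_comp (mh i) (@measurable_coord R n i).
Qed.

Definition slice n (f : 'rV[R]_n.+1 -> R) (t : R) (y : 'rV[R]_n) : R :=
  f (row_mx (t%:M : 'rV_1) y).

Lemma measurable_slice n (f : V n.+1 -> R) t : measurable_fun setT f ->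
  measurable_fun setT (slice f t : V n -> R).
Proof. by move=> mf; exact: measurableT_comp mf (@measurable_row_mx R n t). Qed.

Lemma ae_L2_slice n (f : V n.+1 -> R) : L2 (lebV R n.+1) f ->
  {ae leb, forall t : R, L2 (lebV R n) (slice f t)}.
Proof.
move=> Lf; apply: aeS (ae_integrable_cons0 (L2_sqr_integrable Lf)) => t ti.
split; first exact: measurable_slice (L2_meas Lf).
have := integrable_fin_num measurableT ti.
by rewrite ge0_fin_numE//; apply: integral_ge0 => y _; rewrite lee_fin sqr_ge0.
Qed.

Lemma L2_tprod n h : (forall i, L2 leb (h i)) -> L2 (lebV R n) (tprod h : V n -> R).
Proof.
elim: n h => [|n IHn] h Lh; have mt := @measurable_tprod _ h (fun i => L2_meas (Lh i)).
  split; first exact: mt.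
  rewrite /= integral_dirac// ?diracT ?mul1e ?ltry//.
  by apply/measurable_EFinP; apply: measurable_funX; exact: mt.
split; first exact: mt.
rewrite ge0_integral_lebVS; last 2 first.
- by apply/measurable_EFinP; apply: measurable_funX; exact: mt.
- by move=> x; rewrite lee_fin sqr_ge0.
have [mS Soo] := IHn (fun i => h i.+1) (fun i => Lh i.+1).
set c := (\int[_]_x _)%E in Soo.
have c0 : (0 <= c)%E by apply: integral_ge0 => x _; rewrite lee_fin sqr_ge0.
apply: (@le_lt_trans _ _ (\int[leb]_t ((h 0%N t ^+ 2)%:E * c))%E).
  rewrite le_eqVlt; apply/orP; left; apply/eqP; apply: eq_integral => t _.
  rewrite /c -ge0_integralZl ?lee_fin ?sqr_ge0//.
  - by apply: eq_integral => y _; rewrite tprodS exprMn.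
  - by apply/measurable_EFinP; apply: measurable_funX; exact: mS.
  - by move=> y _; rewrite lee_fin sqr_ge0.
have [m0 h0] := Lh 0%N.
rewrite ge0_integralZr//.
- have i0 : (0 <= \int[leb]_x (h 0%N x ^+ 2)%:E)%E.
    by apply: integral_ge0 => x _; rewrite lee_fin sqr_ge0.
  by apply: lte_mul_pinfty => //; rewrite ge0_fin_numE.
- by apply/measurable_EFinP; apply: measurable_funX.
- by move=> x _; rewrite lee_fin sqr_ge0.
Qed.

Definition tens n (e : nat -> nat -> R -> R) (s : seq nat) : 'rV[R]_n -> R :=
  tprod (fun i => e i (nth 0%N s i)).

Section coefficient.
Variables (n : nat) (f : V n.+1 -> R) (h : nat -> R -> R).
Hypotheses (Lf : L2 (lebV R n.+1) f) (Lh : forall i, L2 leb (h i)).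

(** Partial coefficient: all coordinates but the first are integrated out against h 1, h 2, ...,
    leaving a function of the first coordinate. *)
Definition coef t : R := dot (lebV R n) (slice f t) (tprod (fun i => h i.+1)).

Lemma measurable_coef : measurable_fun setT coef.
Proof.
apply: (@measurable_Rintegral2 _ _ _ _ _ (lebV R n) (fun p : R * V n =>
  f (cons0 p) * tprod (fun i => h i.+1) p.2)).
apply: measurable_funM.
  exact: measurableT_comp (L2_meas Lf) (@measurable_cons0 R n).
have mt := @measurable_tprod n _ (fun i => L2_meas (Lh i.+1)).
exact: measurableT_comp mt measurable_snd.
Qed.

Lemma integral_slice_sqr : (\int[leb]_t \int[lebV R n]_y (slice f t y ^+ 2)%:E =
  (dot (lebV R n.+1) f f)%:E)%E.
Proof.
rewrite dotE// ge0_integral_lebVS//.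
- by apply/measurable_EFinP; apply: measurable_funX; exact: (L2_meas Lf).
- by move=> x; rewrite lee_fin sqr_ge0.
Qed.

Lemma measurable_slice_sqr :
  measurable_fun setT (fun t : R => (\int[lebV R n]_y (slice f t y ^+ 2)%:E)%E).
Proof.
apply: (@measurable_integral2 _ _ _ _ _ (lebV R n) (fun p : R * V n =>
  (f (cons0 p) ^+ 2)%:E)).
apply/measurable_EFinP; apply: measurable_funX.
exact: measurableT_comp (L2_meas Lf) (@measurable_cons0 R n).
Qed.

Lemma L2_coef : L2 leb coef.
Proof.
split; first exact: measurable_coef.
have Lt := @L2_tprod n _ (fun i => Lh i.+1).
set c := dot (lebV R n) (tprod (fun i => h i.+1)) (tprod (fun i => h i.+1)).
have c0 : 0 <= c by exact: dot_ge0.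
apply: (@le_lt_trans _ _ (\int[leb]_t (c%:E * \int[lebV R n]_y (slice f t y ^+ 2)%:E)))%E.
  apply: ae_ge0_le_integral => //.
  - by move=> t _; rewrite lee_fin sqr_ge0.
  - by apply/measurable_EFinP; apply: measurable_funX; exact: measurable_coef.
  - by move=> t _; rewrite mule_ge0 ?lee_fin// integral_ge0// => y _; rewrite lee_fin sqr_ge0.
  - by apply: emeasurable_funM => //; exact: measurable_slice_sqr.
  - apply: aeS (ae_L2_slice Lf) => t Lt1 _.
    by rewrite -dotE// -EFinM lee_fin mulrC; exact: cauchy_schwarz.
rewrite ge0_integralZl ?lee_fin//.
- by rewrite integral_slice_sqr -EFinM ltry.
- exact: measurable_slice_sqr.
- by move=> t _; apply: integral_ge0 => y _; rewrite lee_fin sqr_ge0.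
Qed.

Lemma dot_coef : dot leb coef (h 0%N) = dot (lebV R n.+1) f (tprod h).
Proof.
have Lt := @L2_tprod n _ (fun i => Lh i.+1).
rewrite /dot /Rintegral integral_lebVS; last first.
  exact: L2_mul_integrable Lf (@L2_tprod n.+1 _ Lh).
congr fine; apply: integral_ae_any; apply: aeS (ae_L2_slice Lf) => t Ltf _.
have i1 := L2_mul_integrable Ltf Lt.
rewrite /coef mulrC EFinM.
rewrite /dot /Rintegral fineK; last exact: integrable_fin_num.
rewrite -integralZl//; apply: eq_integral => y _.
by rewrite tprodS /slice -EFinM mulrCA.
Qed.

End coefficient.

(** Bessel in the first coordinate for the partial coefficients [c s], exchange of the integral with
    the remaining sums, then the induction hypothesis on almost every slice. *)
Lemma bessel_tens n (e : nat -> nat -> R -> R) (f : V n -> R) :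
  (forall i, orthonormal_seq leb (e i)) -> L2 (lebV R n) f ->
  (multisum n (fun s => (dot (lebV R n) f (tens e s) ^+ 2)%:E) <= (dot (lebV R n) f f)%:E)%E.
Proof.
elim: n e f => [|n IHn] e f oe Lf.
  have mf := L2_meas Lf.
  rewrite lee_fin /tens /dot /Rintegral !integral_dirac//; last 2 first.
  - by apply/measurable_EFinP; exact: measurable_funM.
  - apply/measurable_EFinP; apply: measurable_funM => //.
    by apply: measurable_tprod => i; exact: (L2_meas ((oe i).1 _)).
  by rewrite diracT !mul1e/= /tprod big_ord0 mulr1 expr2.
have Lh s i : L2 leb (e i (nth 0%N s i)) by exact: (oe i).1.
(* The head [0] is a placeholder: [coef] reads only the entries of index at least 1. *)
pose c s t := coef f (fun i => e i (nth 0%N (0%N :: s) i)) t.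
have Lc s : L2 leb (c s) by apply: L2_coef => // i; exact: (Lh (0%N :: s) i).
rewrite /=.
apply: (@le_trans _ _ (multisum n (fun s => \int[leb]_t (c s t ^+ 2)%:E)%E)).
  apply: le_multisum => s; first by apply: nneseries_ge0 => j _ _; rewrite lee_fin sqr_ge0.
  rewrite -(dotE (Lc s)); apply: le_trans (bessel (oe 0%N) (Lc s)).
  apply: lee_nneseries => j _; first by rewrite lee_fin sqr_ge0.
  by rewrite -(@dot_coef n f (fun i => e i (nth 0%N (j :: s) i)))//= => i; exact: (Lh (j :: s)).
rewrite -integral_multisum//; last 2 first.
- by move=> s; apply/measurable_EFinP; apply: measurable_funX; exact: (L2_meas (Lc s)).
- by move=> s t; rewrite lee_fin sqr_ge0.
rewrite -integral_slice_sqr//.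
apply: ae_ge0_le_integral => //.
- by move=> t _; apply: multisum_ge0 => s; rewrite lee_fin sqr_ge0.
- apply: measurable_multisum => s; last by move=> t; rewrite lee_fin sqr_ge0.
  by apply/measurable_EFinP; apply: measurable_funX; exact: (L2_meas (Lc s)).
- by move=> t _; apply: integral_ge0 => y _; rewrite lee_fin sqr_ge0.
- exact: measurable_slice_sqr.
- apply: aeS (ae_L2_slice Lf) => t Lt _.
  by rewrite -dotE//; exact: (IHn (fun i => e i.+1) (slice f t) (fun i => oe i.+1) Lt).
Qed.

(** The induction of [bessel_tens] with the inequalities reversed. [J i] is the set on which the
    system [e i] is complete; as [f] vanishes once any coordinate leaves it, slices and partial
    coefficients inherit the support condition. *)
Lemma parseval_tens n (e : nat -> nat -> R -> R) (J : nat -> set R) (f : V n -> R) :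
  (forall i, orthonormal_seq leb (e i)) ->
  (forall i g, L2 leb g -> (forall x, ~ J i x -> g x = 0) ->
    ((dot leb g g)%:E <= \sum_(0 <= j <oo) (dot leb g (e i j) ^+ 2)%:E)%E) ->
  L2 (lebV R n) f ->
  (forall (x : 'rV[R]_n) (i : 'I_n), ~ J i (x ord0 i) -> f x = 0) ->
  ((dot (lebV R n) f f)%:E <= multisum n (fun s => (dot (lebV R n) f (tens e s) ^+ 2)%:E))%E.
Proof.
elim: n e J f => [|n IHn] e J f oe pe Lf fJ.
  have mf := L2_meas Lf.
  rewrite lee_fin /tens /dot /Rintegral !integral_dirac//; last 2 first.
  - apply/measurable_EFinP; apply: measurable_funM => //.
    by apply: measurable_tprod => i; exact: (L2_meas ((oe i).1 _)).
  - by apply/measurable_EFinP; exact: measurable_funM.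
  by rewrite diracT !mul1e/= /tprod big_ord0 mulr1 expr2.
have Lh s i : L2 leb (e i (nth 0%N s i)) by exact: (oe i).1.
pose c s t := coef f (fun i => e i (nth 0%N (0%N :: s) i)) t.
have Lc s : L2 leb (c s) by apply: L2_coef => // i; exact: (Lh (0%N :: s) i).
rewrite /=.
apply: (@le_trans _ _ (multisum n (fun s => \int[leb]_t (c s t ^+ 2)%:E)%E)); last first.
  apply: le_multisum => s; first by apply: integral_ge0 => t _; rewrite lee_fin sqr_ge0.
  rewrite -(dotE (Lc s)); apply: le_trans (pe 0%N _ (Lc s) _) _.
    move=> t Jt; rewrite /c /coef /dot /Rintegral (eq_integral (cst 0%E)) ?integral0//.
    by move=> y _; rewrite /slice (fJ _ ord0) ?mul0r// row_mx_ord0.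
  apply: lee_nneseries => j _; first by rewrite lee_fin sqr_ge0.
  by rewrite -(@dot_coef n f (fun i => e i (nth 0%N (j :: s) i)))//= => i; exact: (Lh (j :: s)).
rewrite -integral_multisum//; last 2 first.
- by move=> s; apply/measurable_EFinP; apply: measurable_funX; exact: (L2_meas (Lc s)).
- by move=> s t; rewrite lee_fin sqr_ge0.
rewrite -integral_slice_sqr//.
apply: ae_ge0_le_integral => //.
- by move=> t _; apply: integral_ge0 => y _; rewrite lee_fin sqr_ge0.
- exact: measurable_slice_sqr.
- by move=> t _; apply: multisum_ge0 => s; rewrite lee_fin sqr_ge0.
- apply: measurable_multisum => s; last by move=> t; rewrite lee_fin sqr_ge0.
  by apply/measurable_EFinP; apply: measurable_funX; exact: (L2_meas (Lc s)).
- apply: aeS (ae_L2_slice Lf) => t Lt _.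
  rewrite -dotE//; apply: (IHn (fun i => e i.+1) (fun i => J i.+1) (slice f t)) => //.
    by move=> i g; exact: pe.
  by move=> y i Ji; rewrite /slice (fJ _ (lift ord0 i))// row_mx_lift.
Qed.

End Tensor.

(** * Test functions *)

Section Jets.
Variable R : realType.
Implicit Types D E : nat -> R -> R.

(** A C^2 function carried along with its derivatives: [D o] is the derivative of order [o], and
    orders above 2 carry no information. *)
Definition jet2 D := [/\ forall x : R, is_derive x 1 (D 0%N) (D 1%N x),
  forall x : R, is_derive x 1 (D 1%N) (D 2%N x) & continuous (D 2%N)].

Lemma jet2_continuous D o : jet2 D -> (o <= 2)%N -> continuous (D o).
Proof.
move=> [D0 D1 D2]; case: o => [|[|[|//]]] _ //.
- by move=> x; apply: differentiable_continuous; apply/derivable1_diffP; exact: ex_derive.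
- by move=> x; apply: differentiable_continuous; apply/derivable1_diffP; exact: ex_derive.
Qed.

Lemma jet2_is_derive D o (x : R) : jet2 D -> (o < 2)%N -> is_derive x 1 (D o) (D o.+1 x).
Proof. by case=> D0 D1 _; case: o => [|[|//]] _. Qed.

Definition jaff D (k c : R) o x := k ^+ o * D o (k * x + c).

Lemma jet2_jaff D k c : jet2 D -> jet2 (jaff D k c).
Proof.
move=> jD; have [D0 D1 D2] := jD.
have A (x : R) : is_derive x 1 (fun x : R => k * x + c) k.
  by apply: is_derive_eq; rewrite /GRing.scale/= mulr1 addr0.
have H o (x : R) : (o < 2)%N -> is_derive x 1 (jaff D k c o) (jaff D k c o.+1 x).
  move=> o2; have Dx := jet2_is_derive (k * x + c) jD o2.
  have H : is_derive x 1 (D o \o (fun x => k * x + c)) (D o.+1 (k * x + c) * k).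
    exact: is_derive1_comp.
  rewrite (_ : jaff D k c o = fun x => k ^+ o * (D o \o (fun x => k * x + c)) x)//.
  apply: is_derive_eq.
  by rewrite /jaff /GRing.scale/= exprSr; ring.
split; [by move=> x; exact: H|by move=> x; exact: H|].
move=> x; apply: cvgM; first exact: cvg_cst.
apply: continuous_comp; last exact: D2.
by apply: cvgD; [apply: cvgM; [exact: cvg_cst|exact: cvg_id]|exact: cvg_cst].
Qed.

Definition jmul D E o x : R := match o with
  | 0 => D 0%N x * E 0%N x
  | 1 => D 1%N x * E 0%N x + D 0%N x * E 1%N x
  | _ => D 2%N x * E 0%N x + 2 * (D 1%N x * E 1%N x) + D 0%N x * E 2%N x
  end.

Lemma jet2_jmul D E : jet2 D -> jet2 E -> jet2 (jmul D E).
Proof.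
move=> jD jE; have [D0 D1 D2] := jD; have [E0 E1 E2] := jE; split.
- move=> x; rewrite /jmul; apply: is_derive_eq.
  by rewrite /GRing.scale/=; ring.
- move=> x; rewrite /jmul; apply: is_derive_eq.
  by rewrite /GRing.scale/=; ring.
- have cD o : (o <= 2)%N -> continuous (D o) by exact: jet2_continuous.
  have cE o : (o <= 2)%N -> continuous (E o) by exact: jet2_continuous.
  move=> x; rewrite /jmul; apply: cvgD; [apply: cvgD|].
  + by apply: cvgM; [exact: cD|exact: cE].
  + by apply: cvgM; [exact: cvg_cst|apply: cvgM; [exact: cD|exact: cE]].
  + by apply: cvgM; [exact: cD|exact: cE].
Qed.

(** For powers of the positive part a quadratic remainder is checked by sign cases, which avoids
    one-sided limits at 0. *)
Lemma is_derive_quad (f : R -> R) x l C :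
  (forall h, `|h| <= 1 -> `|f (h + x) - f x - l * h| <= C * h ^+ 2) -> is_derive x 1 f l.
Proof.
move=> H.
have L : h^-1 *: ((f \o shift x) (h *: 1) - f x) @[h --> 0^'] --> l.
  apply/cvgrPdist_le => e e0; near=> h.
  have h0 : h != 0 by near: h; exact: nbhs_dnbhs_neq.
  have h1 : `|h| <= 1.
    by near: h; apply: dnbhs0_le.
  have hC : `|h| <= e / (`|C| + 1).
    by near: h; apply: dnbhs0_le; rewrite divr_gt0// ltr_wpDl.
  have := H h h1; rewrite /= /GRing.scale/= mulr1 => H1.
  have -> : l - h^-1 * (f (h + x) - f x) = - (h^-1 * (f (h + x) - f x - l * h)) by field.
  rewrite normrN normrM normfV mulrC ler_pdivrMr ?normr_gt0//.
  apply: le_trans H1 _.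
  rewrite -(real_normK (num_real h)) expr2 mulrA ler_wpM2r//.
  apply: (@le_trans _ _ ((`|C| + 1) * `|h|)).
    by rewrite ler_wpM2r// (le_trans (ler_norm C))// lerDl.
  by rewrite mulrC -ler_pdivlMr// ltr_wpDl.
apply: DeriveDef; first exact: cvgP L.
exact: cvg_lim L.
Unshelve. all: by end_near. Qed.

Definition pospart (x : R) : R := Num.max x 0.

Lemma pospart3_quad (x h : R) : `|h| <= 1 ->
  `|pospart (h + x) ^+ 3 - pospart x ^+ 3 - 3 * pospart x ^+ 2 * h| <= (3 * `|x| + 3) * h ^+ 2.
Proof.
rewrite ler_norml => /andP[h1 h2]; rewrite /pospart.
have [hx|hx] := leP (h + x) 0; have [x0|x0] := leP x 0.
- by rewrite !expr0n/= !mulr0 subrr !mul0r subr0 normr0 mulr_ge0 ?sqr_ge0// addr_ge0// mulr_ge0.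
- have h3 : 0 <= x ^+ 2 by exact: sqr_ge0.
  have h4 : x * x <= x * - h by apply: ler_wpM2l; lra.
  have h5 : x * x * x <= x * x * - h by apply: ler_wpM2l; [nra|lra].
  have h6 : x * (x * - h) <= x * (- h * - h) by apply: ler_wpM2l; [lra|nra].
  rewrite (gtr0_norm x0) ler_norml expr0n/=; apply/andP; split; nra.
- have h3 : h + x <= h by lra.
  have h4 : (h + x) ^+ 2 <= h ^+ 2 by nra.
  have h5 : (h + x) ^+ 3 <= h ^+ 2.
    rewrite exprSr; apply: (@le_trans _ _ ((h + x) ^+ 2)); last by [].
    by rewrite ler_piMr ?sqr_ge0//; lra.
  have h6 : 0 <= (h + x) ^+ 3 by rewrite exprn_ge0// ltW.
  have h7 : 0 <= `|x| * h ^+ 2 by rewrite mulr_ge0 ?sqr_ge0.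
  rewrite !expr0n/= mulr0 mul0r !subr0 ger0_norm//; nra.
- rewrite (_ : _ - _ - _ = (3 * x + h) * h ^+ 2); last by ring.
  rewrite normrM (ger0_norm (sqr_ge0 h)) ler_wpM2r ?sqr_ge0//.
  rewrite (gtr0_norm x0) ler_norml; apply/andP; split; lra.
Qed.

Lemma pospart2_quad (x h : R) : `|h| <= 1 ->
  `|pospart (h + x) ^+ 2 - pospart x ^+ 2 - 2 * pospart x * h| <= 1 * h ^+ 2.
Proof.
move=> _; rewrite /pospart mul1r.
have [hx|hx] := leP (h + x) 0; have [x0|x0] := leP x 0.
- by rewrite !expr0n/= !mulr0 subrr !mul0r subr0 normr0 sqr_ge0.
- rewrite ler_norml expr0n/=; apply/andP; split; nra.
- rewrite ler_norml expr0n/=; apply/andP; split; nra.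
- rewrite (_ : _ - _ - _ = h ^+ 2); last by ring.
  by rewrite ger0_norm// sqr_ge0.
Qed.

Definition jcube o x : R := match o with
  | 0 => pospart x ^+ 3
  | 1 => 3 * pospart x ^+ 2
  | _ => 6 * pospart x
  end.

Lemma jet2_jcube : jet2 jcube.
Proof.
split.
- by move=> x; apply: is_derive_quad => h; exact: pospart3_quad.
- move=> x; rewrite /jcube.
  have H : is_derive x 1 (fun x => pospart x ^+ 2) (2 * pospart x).
    by apply: is_derive_quad => h; exact: pospart2_quad.
  by apply: is_derive_eq; rewrite /GRing.scale/=; ring.
- move=> x; apply: cvgM; first exact: cvg_cst.
  by apply: (@continuous_max _ _ id (cst 0)); [exact: cvg_id|exact: cvg_cst].
Qed.

Lemma jet2_lin D E (k : R) : jet2 D -> jet2 E -> jet2 (fun o x => D o x + k * E o x).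
Proof.
move=> jD jE; have [D0 D1 D2] := jD; have [E0 E1 E2] := jE; split.
- by move=> x; apply: is_derive_eq; rewrite /GRing.scale/=; ring.
- by move=> x; apply: is_derive_eq; rewrite /GRing.scale/=; ring.
- by move=> x; apply: cvgD; [exact: D2|apply: cvgM; [exact: cvg_cst|exact: E2]].
Qed.

(* Third finite difference of the truncated cube: a C^2 monotone step from 0 (on x <= 0) to
   1 (on x >= 3), the primitive of a quadratic B-spline. *)
Definition jstep o x : R :=
  0 + 6^-1 * (jaff jcube 1 0 o x + -3 * jaff jcube 1 (-1) o x
              + 3 * jaff jcube 1 (-2) o x + -1 * jaff jcube 1 (-3) o x).

Lemma jet2_cst0 : jet2 (fun _ _ => 0 : R).
Proof. by split=> [x|x|x]; [exact: is_derive_cst|exact: is_derive_cst|exact: cvg_cst]. Qed.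

Lemma jet2_jstep : jet2 jstep.
Proof.
have jc c : jet2 (jaff jcube 1 c) by exact: jet2_jaff jet2_jcube.
have h1 := jet2_lin (-3) (jc 0) (jc (-1)).
have h2 := jet2_lin 3 h1 (jc (-2)).
have h3 := jet2_lin (-1) h2 (jc (-3)).
exact: (jet2_lin 6^-1 jet2_cst0 h3).
Qed.

Lemma jstep_le0 o x : (o <= 2)%N -> x <= 0 -> jstep o x = 0.
Proof.
move=> o2 x0; rewrite /jstep /jaff.
have p (c : R) : c <= 0 -> pospart (1 * x + c) = 0.
  by move=> c0; rewrite /pospart; apply/max_idPr; lra.
by case: o o2 => [|[|[|//]]] _; rewrite /jcube !p; try lra; rewrite ?expr0n/=; ring.
Qed.

Lemma jstep_ge3 o x : (o <= 2)%N -> 3 <= x -> jstep o x = (o == 0%N)%:R.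
Proof.
move=> o2 x3; rewrite /jstep /jaff.
have p (c : R) : -3 <= c -> pospart (1 * x + c) = x + c.
  by move=> c0; rewrite /pospart mul1r; apply/max_idPl; lra.
by case: o o2 => [|[|[|//]]] _; rewrite /jcube !p; try lra; rewrite /=; field.
Qed.

Lemma continuous_bounded (f : R -> R) a b c : a <= b -> continuous f ->
  (forall x, ~~ (a <= x <= b) -> `|f x| <= c) -> exists C, 0 <= C /\ forall x, `|f x| <= C.
Proof.
move=> ab cf fc.
have cnf : {within `[a, b], continuous (fun x => `|f x|)}.
  by apply: continuous_subspaceT => x; apply: cvg_norm; exact: cf.
have [z _ zmax] := EVT_max ab cnf.
exists (Num.max `|f z| c); split; first by rewrite le_max normr_ge0.
move=> x; rewrite le_max; have [xab|xab] := boolP (a <= x <= b).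
  by rewrite zmax// in_itv.
by rewrite fc// orbT.
Qed.

Lemma jstep_bounded : exists C, 0 <= C /\ forall o x, (o <= 2)%N -> `|jstep o x| <= C.
Proof.
have H i : exists C, 0 <= C /\ forall x, (i <= 2)%N -> `|jstep i x| <= C.
  have [i2|i2] := boolP (i <= 2)%N; last by exists 0; split.
  have [C [C0 HC]] : exists C, 0 <= C /\ forall x, `|jstep i x| <= C.
    apply: (@continuous_bounded _ 0 3 1) => //; first exact: jet2_continuous jet2_jstep i2.
    move=> x; rewrite negb_and -!ltNge => /orP[/ltW x0|/ltW x3].
      by rewrite jstep_le0// normr0.
    by rewrite jstep_ge3// ger0_norm// lern1 leq_b1.
  by exists C; split.
have [C HC] := choice H.
exists (C 0%N + C 1%N + C 2%N); split.
  by rewrite !addr_ge0//; exact: (HC _).1.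
move=> o x o2; apply: le_trans ((HC o).2 x o2) _.
have := (HC 0%N).1; have := (HC 1%N).1; have := (HC 2%N).1.
by case: o o2 => [|[|[|//]]] _; lra.
Qed.

End Jets.

(** * Products of functions of one variable as test functions *)

Section TensorTest.
Variable R : realType.
Variables (n : nat) (D : nat -> nat -> R -> R).
Hypothesis jD : forall i, jet2 (D i).

(* [o i] is the order of differentiation in the coordinate [i]. *)
Definition tjet (o : nat -> nat) : 'rV[R]_n -> R := tprod (fun i => D i (o i)).

Definition incr (o : nat -> nat) (j : nat) : nat -> nat :=
  fun i => if i == j then (o i).+1 else o i.

(** Only the factor [j] moves along its axis: the quotient is a one-variable difference quotient
    times the constant [c]. *)
Lemma pd_cvg_tjet (o : nat -> nat) (j : 'I_n) (z : 'rV[R]_n) : (o j < 2)%N ->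
  h^-1 *: ((tjet o \o shift z) (h *: (delta_mx ord0 j : 'rV[R]_n)) - tjet o z) @[h --> 0^'] -->
  tjet (incr o j) z.
Proof.
move=> oj2; have Dj := jet2_is_derive (z ord0 j) (jD j) oj2.
pose c := \prod_(i < n | i != j) D i (o i) (z ord0 i).
have -> : tjet (incr o j) z = D j (o j).+1 (z ord0 j) * c.
  rewrite /tjet /tprod (bigD1 j)//= /incr eqxx; congr (_ * _).
  by apply: eq_bigr => i ij; rewrite -val_eqE/= in ij; rewrite (negbTE ij).
have -> : (fun h => h^-1 *: ((tjet o \o shift z) (h *: (delta_mx ord0 j : 'rV[R]_n)) - tjet o z)) =
  (fun h => (h^-1 *: ((D j (o j) \o shift (z ord0 j)) (h *: 1) - D j (o j) (z ord0 j))) * c).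
  apply/funext => h; rewrite /= /tjet /tprod (bigD1 j)//= [X in _ - X](bigD1 j)//=.
  rewrite (eq_bigr (fun i : 'I_n => D i (o i) (z ord0 i))); last first.
    by move=> i ij; rewrite !mxE/= (negbTE ij) mulr0 add0r.
  by rewrite !mxE /GRing.scale/= -/c eqxx; ring.
apply: cvgM; last exact: cvg_cst.
have := @ex_derive _ _ _ _ _ _ _ Dj; have <- := @derive_val _ _ _ _ _ _ _ Dj.
by [].
Qed.

Lemma derivable_tjet (o : nat -> nat) (j : 'I_n) (z : 'rV[R]_n) : (o j < 2)%N -> derivable (tjet o) z (delta_mx ord0 j).
Proof.
move=> oj; apply/cvg_ex; exists (tjet (incr o j) z).
exact: (@pd_cvg_tjet o j z oj).
Qed.

Lemma pd_tjet (o : nat -> nat) (j : 'I_n) (z : 'rV[R]_n) : (o j < 2)%N -> pd (tjet o) j z = tjet (incr o j) z.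
Proof.
move=> oj; rewrite /pd /derive; apply: cvg_lim => //.
exact: (@pd_cvg_tjet o j z oj).
Qed.

Lemma continuous_tjet (o : nat -> nat) : (forall i, o i <= 2)%N -> continuous (tjet o).
Proof.
move=> o2; rewrite /tjet /tprod.
elim: (index_enum _) => [|i s IHs].
  rewrite (_ : (fun _ => _) = (fun=> 1)); last by apply/funext => z; rewrite big_nil.
  by move=> z; apply: cst_continuous.
rewrite (_ : (fun _ => _) = (fun z : 'rV[R]_n => D i (o i) (z ord0 i) *
  \prod_(l <- s) D l (o l) (z ord0 l))); last by apply/funext => z; rewrite big_cons.
move=> z; apply: (@continuousM _ _ (fun z : 'rV[R]_n => D i (o i) (z ord0 i))); last exact: IHs.
apply: (@continuous_comp _ _ _ (fun z : 'rV[R]_n => z ord0 i) (D i (o i))).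
  exact: coord_continuous.
exact: jet2_continuous (jD i) (o2 i) _.
Qed.

Lemma C2c_tjet (M : R) : (forall i x, M < `|x| -> D i 0%N x = 0) -> C2c (tjet (fun=> 0%N)).
Proof.
move=> DM; split.
  pose K : set 'rV[R]_n := [set z | forall i, `[- M, M]%classic (z ord0 i)].
  have cK : compact K by apply: (@rV_compact R n (fun=> `[- M, M]%classic)) => i; exact: segment_compact.
  apply: (@subclosed_compact _ _ K) => //; first exact: closed_closure.
  have clK : closed K by apply: compact_closed => //; exact: norm_hausdorff.
  rewrite [X in _ `<=` X](closure_id K).1//.
  apply: closure_subset => z /= nz i /=; rewrite in_itv/= -ler_norml leNgt.
  apply/negP => /DM D0; move/eqP: nz; apply.
  by rewrite /tjet /tprod (bigD1 i)//= D0 mul0r.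
move=> i j.
have -> : pd (tjet (fun=> 0%N)) i = tjet (incr (fun=> 0%N) i).
  by apply/funext => z; exact: pd_tjet.
have i1 (l : nat) : (incr (fun=> 0%N) i l < 2)%N by rewrite /incr; case: ifP.
have -> : pd (tjet (incr (fun=> 0%N) i)) j = tjet (incr (incr (fun=> 0%N) i) j).
  by apply/funext => z; exact: pd_tjet.
split; first by move=> z; exact: derivable_tjet.
split; first by apply: continuous_tjet => l; exact: ltnW (i1 l).
split; first by move=> z; exact: derivable_tjet.
by apply: continuous_tjet => l; rewrite {1}/incr; case: ifP => // _; exact: ltnW (i1 l).
Qed.

End TensorTest.

Section SineJet.
Variables (R : realType) (A w x0 : R).

Definition jsin o (x : R) : R := match o with
  | 0 => A * sin (w * (x - x0))
  | 1 => w * (A * cos (w * (x - x0)))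
  | _ => - w ^+ 2 * (A * sin (w * (x - x0)))
  end.

Lemma jet2_jsin : jet2 jsin.
Proof.
split.
- by move=> x; apply: is_derive_eq; rewrite /GRing.scale/=; ring.
- by move=> x; apply: is_derive_eq; rewrite /GRing.scale/=; ring.
- move=> x; apply: cvgM; first exact: cvg_cst.
  by apply: cvgM; [exact: cvg_cst|exact: continuous_sin_affine].
Qed.

End SineJet.

(** * Energy and Gronwall estimates *)

Section OdeEnergy.
Variable R : realType.
Local Notation leb := (@lebesgue_measure R).

Lemma integrable_bounded_itv (g : R -> R) (M a b : R) : measurable_fun setT g ->
  (forall s, `|g s| <= M) -> leb.-integrable `]a, b] (EFin \o g).
Proof.
move=> mg gM; apply: measurable_bounded_integrable => //.
- by rewrite /= lebesgue_measure_itv/=; case: ifP => _; rewrite ?ltry// -EFinD ltry.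
- exact: measurable_funTS.
- exists M; split; first exact: num_real.
  by move=> x Mx s _ /=; apply: le_trans (gM s) (ltW Mx).
Qed.

(** The square ]0, t]^2 is cut along its diagonal into two triangles of equal integral, by symmetry
    of g(s) g(r). This replaces the differentiation of the square of a primitive, as [g] is only
    bounded and measurable. *)
Lemma sqr_primitive (g : R -> R) (M t : R) : measurable_fun setT g -> (forall s, `|g s| <= M) ->
  (\int[leb]_(s in `]0, t]) g s) ^+ 2 =
  2 * \int[leb]_(s in `]0, t]) (g s * \int[leb]_(r in `]0, s]) g r).
Proof.
move=> mg gM.
pose q s := g s * \1_`]0, t] s.
have mq : measurable_fun setT q by apply: measurable_funM => //; exact: measurable_indic.
have qM s : `|q s| <= M * \1_`]0, t] s.
  by rewrite /q normrM ler_pM// ger0_norm// indicE.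
have iq : leb.-integrable setT (EFin \o q).
  have := integrable_bounded_itv 0 t mg gM.
  move/(@integrable_mkcond _ _ R leb _ (EFin \o g) (measurable_itv _)); congr (integrable _ _ _).
  apply/funext => s; rewrite patchE /= /q indicE; case: (_ \in _); rewrite ?mulr1 ?mulr0//.
have qE : \int[leb]_(s in `]0, t]) g s = \int[leb]_s q s.
  rewrite Rintegral_mkcond; apply: eq_Rintegral => s _.
  by rewrite patchE /q indicE; case: (_ \in _); rewrite ?mulr1 ?mulr0.
(* [h] keeps the closed triangle p.2 <= p.1. *)
pose h (p : R * R) : R := q p.1 * q p.2 * \1_`[0, +oo[ (p.1 - p.2).
have mh : measurable_fun setT h.
  apply: measurable_funM; first by apply: measurable_funM; exact: measurableT_comp.
  by apply: measurableT_comp; [exact: measurable_indic|exact: measurable_funB].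
pose hh (p : R * R) : R := q p.1 * q p.2.
have mhh : measurable_fun setT hh by apply: measurable_funM; exact: measurableT_comp.
have iqq : leb.-integrable setT (fun s => `|(q s)%:E|)%E by exact: integrable_abse.
have ihh : (leb \x leb)%E.-integrable setT (EFin \o hh).
  apply/(integrable12ltyP leb leb); first exact/measurable_EFinP.
  apply: (@le_lt_trans _ _ (\int[leb]_s (`|(q s)%:E| * \int[leb]_r `|(q r)%:E|))%E).
    rewrite le_eqVlt; apply/orP; left; apply/eqP; apply: eq_integral => s _.
    rewrite -ge0_integralZl//; last first.
      by apply: measurableT_comp => //; exact/measurable_EFinP.
    by apply: eq_integral => r _; rewrite -abseM.
  have qfin := integrable_fin_num measurableT iqq.
  rewrite ge0_integralZr//; last 2 first.
  - by apply: measurableT_comp => //; exact/measurable_EFinP.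
  - by apply: integral_ge0.
  by rewrite -ge0_fin_numE ?mule_ge0 ?integral_ge0// fin_numM.
have ih : (leb \x leb)%E.-integrable setT (EFin \o h).
  apply: (@le_integrable _ _ R (leb \x leb)%E setT measurableT _ (EFin \o hh)) => //.
    exact/measurable_EFinP.
  move=> p _ /=; rewrite lee_fin normrM ler_piMr// ger0_norm indicE//.
  by rewrite lern1 leq_b1.
have ihs : (leb \x leb)%E.-integrable setT (fun p => (h (p.2, p.1))%:E).
  apply: (@le_integrable _ _ R (leb \x leb)%E setT measurableT _ (EFin \o hh)) => //.
    apply/measurable_EFinP; apply: measurableT_comp mh _.
    by apply: measurable_fun_pair; [exact: measurable_snd|exact: measurable_fst].
  move=> p _ /=; rewrite lee_fin normrM /hh (mulrC (q p.1)) ler_piMr// ger0_norm indicE//.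
  by rewrite lern1 leq_b1.
have iq1 s : leb.-integrable setT (fun r => (h (s, r))%:E).
  apply: (@le_integrable _ _ _ leb setT measurableT _ (fun r => (q s)%:E * (q r)%:E)%E) => //.
  - by apply/measurable_EFinP; exact: measurableT_comp mh (measurable_pair1 s).
  - move=> r _ /=; rewrite lee_fin normrM ler_piMr// ger0_norm indicE//.
    by rewrite lern1 leq_b1.
  - exact: integrableZl iq.
have iq2 s : leb.-integrable setT (fun r => (h (r, s))%:E).
  apply: (@le_integrable _ _ _ leb setT measurableT _ (fun r => (q s)%:E * (q r)%:E)%E) => //.
  - by apply/measurable_EFinP; exact: measurableT_comp mh (measurable_pair2 s).
  - move=> r _ /=; rewrite lee_fin (mulrC (q s)) normrM ler_piMr// ger0_norm indicE//.
    by rewrite lern1 leq_b1.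
  - exact: integrableZl iq.
have qq : (\int[leb]_s \int[leb]_r (h (s, r))%:E + \int[leb]_s \int[leb]_r (h (s, r))%:E =
    ((\int[leb]_s q s) ^+ 2)%:E)%E.
  rewrite [X in (_ + X)%E](Fubini ih) -integralD//; last 2 first.
  - exact: (integrable_fubini_F ih).
  - exact: (integrable_fubini_F ihs).
  have Qe : ((\int[leb]_s q s)%:E = \int[leb]_s (q s)%:E)%E.
    by rewrite /Rintegral fineK//; exact: integrable_fin_num.
  rewrite expr2 EFinM [X in (_ * X)%E]Qe -integralZl//; apply: eq_integral => s _.
  rewrite Qe.
  transitivity (\int[leb]_r ((h (s, r))%:E + (h (r, s))%:E))%E.
    by rewrite (integralD measurableT (iq1 s) (iq2 s)).
  rewrite muleC -integralZl//.
  (* The two closed triangles overlap only at r = s, a null set for fixed [s]. *)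
  apply: integral_ae_any; exists [set s]; split; [exact: measurable_set1|exact: lebesgue_measure_set1|].
  move=> r /= hr; apply: contrapT => /eqP rs; apply: hr => _.
  rewrite -EFinD -EFinM /h /=; congr (_%:E).
  rewrite !indicE !mem_setE !in_itv/= !andbT !subr_ge0.
  have [rs1|rs1] := ltP r s; first by rewrite ?(ltW rs1) ?leNgt ?rs1/=; ring.
  have rs2 : s < r by rewrite lt_neqAle eq_sym rs.
  by rewrite ?(ltW rs2) leNgt rs2/=; ring.
have -> : \int[leb]_(s in `]0, t]) (g s * \int[leb]_(r in `]0, s]) g r) =
    fine (\int[leb]_s \int[leb]_r (h (s, r))%:E).
  rewrite Rintegral_mkcond /Rintegral; congr fine; apply: eq_integral => s _.
  rewrite patchE /h /= /q indicE; case: ifPn => sI.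
    rewrite mulr1 EFinM fineK; last first.
      by apply: integrable_fin_num => //; exact: integrable_bounded_itv mg gM.
    rewrite -integralZl//; last exact: integrable_bounded_itv mg gM.
    rewrite integral_mkcond; apply: eq_integral => r _.
    move: sI; rewrite mem_setE in_itv/= => /andP[s0 st].
    rewrite patchE !indicE !mem_setE !in_itv/= ?andbT ?subr_ge0.
    have [r0|r0] := ltP 0 r; last by rewrite !mulr0 mul0r.
    have [rs|rs] := leP r s; last by rewrite !mulr0.
    by rewrite (le_trans rs st) !mulr1.
  by rewrite integral0_eq// => r _; rewrite mulr0 !mul0r.
rewrite qE; move: qq.
have hf : (\int[leb]_s \int[leb]_r (h (s, r))%:E)%E \is a fin_num.
  by have := integrable_fin_num measurableT (integrable_fubini_F ih).
rewrite -(fineK hf) -EFinD => -[<-]/=; ring.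
Qed.

(* [u] plays the role of a Fourier coefficient at the frequency vector [c]. By AM-GM the
   dissipation [2^-1 * |c|^2 * u^2] absorbs the terms [c i * h i] in which one derivative falls
   on the sine. *)
Lemma energy_ode m (T M : R) (u k : R -> R) (h : 'I_m -> R -> R) (c : 'I_m -> R) :
  measurable_fun setT u -> measurable_fun setT k -> (forall i, measurable_fun setT (h i)) ->
  (forall s, `|u s| <= M) -> (forall s, `|k s| <= M) -> (forall i s, `|h i s| <= M) ->
  (forall t, 0 < t <= T -> u t = \int[leb]_(s in `]0, t])
     (k s + \sum_(i < m) c i * h i s - 2^-1 * (\sum_(i < m) c i ^+ 2) * u s)) ->
  forall t, 0 < t <= T ->
    u t ^+ 2 <= \int[leb]_(s in `]0, t]) (k s ^+ 2 + u s ^+ 2 + \sum_(i < m) h i s ^+ 2).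
Proof.
move=> mu mk mh uM kM hM ueq t t0T.
pose g s := k s + \sum_(i < m) c i * h i s - 2^-1 * (\sum_(i < m) c i ^+ 2) * u s.
have mg : measurable_fun setT g.
  apply: measurable_funB; last exact: measurable_funM.
  apply: measurable_funD => //; apply: measurable_sum => i; exact: measurable_funM.
pose Mg := M + \sum_(i < m) `|c i| * M + `|2^-1 * (\sum_(i < m) c i ^+ 2)| * M.
have gMg s : `|g s| <= Mg.
  apply: le_trans (ler_normB _ _) _; apply: lerD; last by rewrite normrM ler_wpM2l.
  apply: le_trans (ler_normD _ _) _; apply: lerD => //.
  apply: le_trans (ler_norm_sum _ _ _) _; apply: ler_sum => i _.
  by rewrite normrM ler_wpM2l.
have M0 : 0 <= M by exact: le_trans (normr_ge0 (u 0)) (uM 0).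
(* [u] is the primitive of [g], so the inner integral of [sqr_primitive] is [u s] itself. *)
have -> : u t ^+ 2 = 2 * \int[leb]_(s in `]0, t]) (g s * u s).
  rewrite ueq// (sqr_primitive t mg gMg); congr (_ * _).
  apply: eq_Rintegral => s; rewrite mem_setE in_itv/= => /andP[s0 st].
  rewrite -ueq// s0/=; apply: le_trans st _; by case/andP: t0T.
have igu : leb.-integrable `]0, t] (EFin \o (fun s => g s * u s)).
  apply: (@integrable_bounded_itv _ (Mg * M)); first exact: measurable_funM.
  by move=> s; rewrite normrM ler_pM.
have msq (f : R -> R) : measurable_fun setT f -> measurable_fun setT (fun s => f s ^+ 2).
  by move=> mf; exact: measurable_funX.
have bsq (f : R -> R) s : (forall s, `|f s| <= M) -> `|f s ^+ 2| <= M ^+ 2.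
  by move=> fM; rewrite normrX lerXn2r// nnegrE.
rewrite -RintegralZl//; apply: le_Rintegral => //.
- exact: integrableZl igu.
- apply: (@integrable_bounded_itv _ (M ^+ 2 + M ^+ 2 + \sum_(i < m) M ^+ 2)).
    apply: measurable_funD; first by apply: measurable_funD; exact: msq.
    by apply: measurable_sum => i; exact: msq.
  move=> s; apply: le_trans (ler_normD _ _) _; apply: lerD.
    by apply: le_trans (ler_normD _ _) _; apply: lerD; exact: bsq.
  by apply: le_trans (ler_norm_sum _ _ _) _; apply: ler_sum => i _; exact: (bsq (h i)).
move=> s _ /=.
have -> : 2 * (g s * u s) = 2 * (k s * u s) +
    \sum_(i < m) (2 * (c i * h i s * u s) - c i ^+ 2 * u s ^+ 2).
  by rewrite sumrB -mulr_sumr -mulr_suml -[in X in _ - X]mulr_suml /g; field.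
apply: lerD; first by have := sqr_ge0 (k s - u s); rewrite sqrrB; lra.
apply: ler_sum => i _; have := sqr_ge0 (c i * u s - h i s); rewrite sqrrB; nra.
Qed.

(** Advances by intervals of length [tau]: once [y] is zero up to n tau, the inequality halves any
    bound valid on the next interval, and iterating from [A] leaves 0. This form suits a [y] that is
    only bounded and measurable. *)
Lemma gronwall_zero (y : R -> R) (T C A : R) : measurable_fun setT y -> 0 <= C ->
  (forall s, 0 <= y s <= A) ->
  (forall t, 0 < t <= T -> y t <= C * \int[leb]_(s in `]0, t]) y s) ->
  forall t, 0 < t <= T -> y t = 0.
Proof.
move=> my C0 yA yC.
(* Makes C tau at most 1/2; the added 1 keeps the denominator positive when C = 0. *)
pose tau := (2 * (C + 1))^-1.
have tau0 : 0 < tau by rewrite invr_gt0; lra.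
have Ctau : C * tau <= 2^-1.
  rewrite /tau ler_pdivrMr; lra.
have A0 : 0 <= A by have /andP[] := yA 0; exact: le_trans.
suff H n t : 0 < t <= T -> t <= n%:R * tau -> y t = 0.
  move=> t tT; apply: (H (Num.truncn (t / tau)).+1) => //.
  rewrite -ler_pdivrMr//; exact/ltW/truncnS_gt.
elim: n t => [|n IHn] t /andP[t0 tT] tn; first by move: tn; rewrite mul0r; lra.
suff H j t' : 0 < t' <= T -> t' <= n.+1%:R * tau -> y t' <= A / 2 ^+ j.
  apply/eqP; rewrite eq_le; have /andP[-> _] := yA t; rewrite andbT.
  have : A / 2 ^+ j @[j --> \oo] --> (0 : R).
    rewrite -[X in _ --> X](mulr0 A); apply: cvgM; first exact: cvg_cst.
    under eq_fun do rewrite -exprVn; apply: cvg_expr.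
    by rewrite ger0_norm; lra.
  move/cvgr_to_ge; apply; apply: nearW => j; apply: H => //; exact/andP.
elim: j t' => [|j IHj] s /andP[s0 sT] sn; first by rewrite expr0 divr1; have /andP[] := yA s.
apply: le_trans (yC s _) _; first exact/andP.
have [sn'|sn'] := leP s (n%:R * tau).
  rewrite /Rintegral (eq_integral (cst 0%E)) ?integral0 ?mulr0 ?divr_ge0 ?exprn_ge0//.
  move=> r; rewrite inE/= in_itv/= => /andP[r0 rs]; 
  have rT : 0 < r <= T by rewrite r0 (le_trans rs).
  by rewrite (IHn r rT (le_trans rs sn')).
apply: (@le_trans _ _ (C * (A / 2 ^+ j * tau))); last first.
  have -> : A / 2 ^+ j.+1 = A / 2 ^+ j * 2^-1 by rewrite exprSr invfM mulrA.
  by rewrite mulrCA ler_wpM2l// divr_ge0// exprn_ge0.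
rewrite ler_wpM2l//.
have B0 : 0 <= A / 2 ^+ j by rewrite divr_ge0// exprn_ge0.
set J := `]n%:R * tau, s]%classic.
have iJ : leb.-integrable `]0, s] (EFin \o (\1_J : R -> R)).
  apply: (@integrable_bounded_itv _ 1).
    by apply: measurable_indic; exact: measurable_itv.
  by move=> r; rewrite indicE; case: (_ \in _); rewrite ?normr1 ?normr0.
apply: (@le_trans _ _ (\int[leb]_(r in `]0, s]) (A / 2 ^+ j * \1_J r))).
  apply: le_Rintegral => //.
  - apply: (@integrable_bounded_itv _ A) => // r.
    by have /andP[y0 y1] := yA r; rewrite ger0_norm.
  - exact: integrableZl iJ.
  - move=> r; rewrite /= in_itv/= => /andP[r0 rs].
    rewrite indicE mem_setE in_itv/= rs andbT; have [rn|rn] := leP r (n%:R * tau).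
      by rewrite IHn// ?r0 ?(le_trans rs)//= mulr0.
    by rewrite mulr1; apply: IHj; [rewrite r0 (le_trans rs)|exact: le_trans rs sn].
rewrite RintegralZl// ler_wpM2l// /Rintegral integral_indic//; last exact: measurable_itv.
rewrite setIidl; last first.
  move=> r; rewrite /J /= !in_itv/= => /andP[r0 ->]; rewrite andbT.
  by apply: le_lt_trans r0; rewrite mulr_ge0// ltW.
rewrite /= lebesgue_measure_itv/= lte_fin sn' -EFinD/=.
by move: sn; rewrite -natr1; lra.
Qed.

End OdeEnergy.

(** * Integrals over the first variable *)

Lemma Rintegral_dct d (T : measurableType d) (R : realType) (mu : {measure set T -> \bar R})
    (D : set T) (f_ : nat -> T -> R) (f g : T -> R) : measurable D ->
  (forall n, measurable_fun D (f_ n)) -> measurable_fun D f ->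
  {ae mu, forall x, D x -> f_ n x @[n --> \oo] --> f x} ->
  mu.-integrable D (EFin \o g) ->
  {ae mu, forall x, D x -> forall n, `|f_ n x| <= g x} ->
  \int[mu]_(x in D) f_ n x @[n --> \oo] --> \int[mu]_(x in D) f x.
Proof.
move=> mD mf_ mf cf ig fg.
have [|||||If _ H] := @dominated_convergence _ _ _ mu D mD (fun n => EFin \o f_ n) (EFin \o f) (EFin \o g).
- by move=> n; exact/measurable_EFinP.
- exact/measurable_EFinP.
- by apply: aeS cf => x h Dx; apply/cvg_EFin; [near=> n|exact: h].
- exact: ig.
- by apply: aeS fg => x h n Dx; rewrite lee_fin h.
rewrite /Rintegral; apply: fine_cvg; rewrite fineK//; exact: integrable_fin_num.
Unshelve. all: by end_near. Qed.

Lemma normr_dot_le d (T : measurableType d) (R : realType) (mu : {measure set T -> \bar R})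
    (f g : T -> R) : L2 mu f -> L2 mu g -> `|dot mu f g| <= dot mu f f + dot mu g g.
Proof.
move=> Lf Lg; have := cauchy_schwarz Lf Lg; have := dot_ge0 mu f; have := dot_ge0 mu g.
move=> g0 f0 h; rewrite -(@ler_sqr _ `|_|) ?nnegrE ?addr_ge0// real_normK ?num_real//.
apply: le_trans h _; nra.
Qed.

Section MarginalIntegrals.
Variables (R : realType) (k : nat).
Local Notation X := (g_sigma_algebraType (@open 'rV[R]_k.+1)).
Local Notation leb := (@lebesgue_measure R).
Local Notation mu := (lebV R k.+1).
Variables (P : R -> X -> R -> R) (C0 : R).
Hypothesis mP : measurable_fun setT (fun q : (X * R) * R => P q.2 q.1.1 q.1.2).
Hypothesis PT : forall m (x : 'rV[R]_k.+1) s, m < x ord0 ord0 -> P m x s = 0.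

Implicit Types (h g : R -> R) (b : X -> R) (M s t m : R) (x y : X).

(** The inner integral of condition (a). It is finite for almost every x only ([absP_fin]), hence
    the extended values and the pointwise finiteness assumptions below. *)
Definition absP (x : X) (s : R) : \bar R := (\int[leb]_m `|P m x s|%:E)%E.

Hypothesis PC : forall s, (\int[mu]_x (absP x s * absP x s) <= C0%:E)%E.

Definition marg (h : R -> R) (s : R) (x : X) : R := \int[leb]_m (h m * P m x s).

Lemma absP_ge0 x s : (0 <= absP x s)%E.
Proof. by apply: integral_ge0 => m _; rewrite lee_fin. Qed.

Lemma measurable_P x s : measurable_fun setT (fun m => P m x s).
Proof. exact: measurableT_comp mP (measurable_pair1 (x, s)). Qed.

Lemma measurable_absP s : measurable_fun setT (absP^~ s).
Proof.
have h : measurable_fun setT (fun q : X * R => absP q.1 q.2).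
  apply: (@measurable_integral2 _ _ _ _ _ leb (fun q : (X * R) * R => `|P q.2 q.1.1 q.1.2|%:E)).
  by apply/measurable_EFinP; exact: measurableT_comp.
exact: measurableT_comp h (measurable_pair2 s).
Qed.

Lemma absP_fin s : {ae mu, forall x, absP x s \is a fin_num}.
Proof.
have i2 : mu.-integrable setT (fun x => absP x s * absP x s)%E.
  apply/integrableP; split; first by apply: emeasurable_funM; exact: measurable_absP.
  rewrite (@eq_integral _ _ _ _ _ (fun x => absP x s * absP x s)%E); last first.
    by move=> x _; rewrite gee0_abs// mule_ge0// absP_ge0.
  exact: le_lt_trans (PC s) (ltry _).
apply: aeS (integrable_ae measurableT i2) => x /(_ I).
by have := absP_ge0 x s; case: (absP x s).
Qed.

Lemma integrable_hP h M x s : measurable_fun setT h -> (forall m, `|h m| <= M) ->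
  absP x s \is a fin_num -> leb.-integrable setT (EFin \o (fun m => h m * P m x s)).
Proof.
move=> mh hM xfin.
have iP : leb.-integrable setT (fun m => M%:E * (P m x s)%:E)%E.
  apply: integrableZl => //; apply/integrableP; split.
    by apply/measurable_EFinP; exact: measurable_P.
  by rewrite -ge0_fin_numE// absP_ge0.
apply: (@le_integrable _ _ R leb setT measurableT _ _ _ _ iP).
  by apply/measurable_EFinP; apply: measurable_funM => //; exact: measurable_P.
move=> m _ /=; rewrite lee_fin !normrM ler_wpM2r//.
by apply: le_trans (hM m) _; exact: ler_norm.
Qed.

Lemma normr_marg h M x s : measurable_fun setT h -> (forall m, `|h m| <= M) ->
  absP x s \is a fin_num -> `|marg h s x| <= M * fine (absP x s).
Proof.
move=> mh hM xfin.
have ih := integrable_hP mh hM xfin.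
apply: le_trans (le_normr_Rintegral measurableT ih) _.
have i1 : leb.-integrable setT (EFin \o (fun m => `|P m x s|)).
  have := integrable_hP (h := fun=> 1) (M := 1) (measurable_cst _) _ xfin.
  move=> /(_ ltac:(by move=> _; rewrite normr1)) /integrable_abse; congr (integrable _ _ _).
  by apply/funext => m /=; rewrite mul1r.
rewrite -[fine _]/(\int[leb]_m `|P m x s|) -RintegralZl//.
apply: le_Rintegral => //.
- exact: integrable_norm ih.
- exact: integrableZl i1.
by move=> m _; rewrite normrM ler_wpM2r.
Qed.

Lemma measurable_marg2 h : measurable_fun setT h ->
  measurable_fun setT (fun q : X * R => marg h q.2 q.1).
Proof.
move=> mh.
apply: (@measurable_Rintegral2 _ _ _ _ _ leb (fun q : (X * R) * R => h q.2 * P q.2 q.1.1 q.1.2)).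
by apply: measurable_funM => //; exact: measurableT_comp.
Qed.

Lemma measurable_marg h s : measurable_fun setT h -> measurable_fun setT (marg h s).
Proof. by move=> mh; exact: measurableT_comp (measurable_marg2 mh) (measurable_pair2 s). Qed.

Lemma marg_sqr_le h M s : 0 < M -> measurable_fun setT h -> (forall m, `|h m| <= M) ->
  (\int[mu]_x (marg h s x ^+ 2)%:E <= (M ^+ 2 * C0)%:E)%E.
Proof.
move=> M0 mh hM.
apply: (@le_trans _ _ (\int[mu]_x ((M ^+ 2)%:E * (absP x s * absP x s))))%E.
  apply: ge0_le_integral => //.
  - by move=> x _; rewrite lee_fin sqr_ge0.
  - by apply/measurable_EFinP; apply: measurable_funX; exact: measurable_marg.
  - by apply: emeasurable_funM => //; apply: emeasurable_funM; exact: measurable_absP.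
  move=> x _; have := absP_ge0 x s; case E: (absP x s) => [r| |//] r0.
    rewrite -!EFinM lee_fin; have := normr_marg (x := x) (s := s) mh hM.
    rewrite E => /(_ isT)/= H; rewrite -expr2 -exprMn -(real_normK (num_real (marg h s x))).
    by rewrite lerXn2r ?nnegrE ?mulr_ge0// ltW.
  (* Where [absP] is infinite so is the right-hand side, whatever value [marg] takes there. *)
  by rewrite mulyy gt0_muley ?leey// lte_fin exprn_gt0.
rewrite ge0_integralZl ?lee_fin ?sqr_ge0//.
- rewrite [leRHS]EFinM; apply: lee_wpmul2l; last exact: PC.
  by rewrite lee_fin sqr_ge0.
- by apply: emeasurable_funM; exact: measurable_absP.
- by move=> x _; rewrite mule_ge0// absP_ge0.
Qed.

Lemma L2_marg h M s : 0 < M -> measurable_fun setT h -> (forall m, `|h m| <= M) ->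
  L2 mu (marg h s).
Proof.
move=> M0 mh hM; split; first exact: measurable_marg.
exact: le_lt_trans (marg_sqr_le s M0 mh hM) (ltry _).
Qed.

Lemma dot_marg_le h M s : 0 < M -> measurable_fun setT h -> (forall m, `|h m| <= M) ->
  dot mu (marg h s) (marg h s) <= M ^+ 2 * C0.
Proof.
move=> M0 mh hM; rewrite -lee_fin dotE; last exact: L2_marg hM.
exact: marg_sqr_le.
Qed.

Lemma measurable_dot_marg b h : measurable_fun setT b -> measurable_fun setT h ->
  measurable_fun setT (fun s => dot mu b (marg h s)).
Proof.
move=> mb mh.
apply: (@measurable_Rintegral2 _ _ _ _ _ mu (fun q : R * X => b q.2 * marg h q.1 q.2)).
apply: measurable_funM; first exact: measurableT_comp.
have msw : measurable_fun setT (fun q : R * X => (q.2, q.1)).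
  by apply: measurable_fun_pair; [exact: measurable_snd|exact: measurable_fst].
exact: measurableT_comp (measurable_marg2 mh) msw.
Qed.

Section limits.
Variables (alpha M : R) (h_ : nat -> R -> R) (h : R -> R).
Hypotheses (M0 : 0 < M) (mh_ : forall n, measurable_fun setT (h_ n)) (mh : measurable_fun setT h).
Hypotheses (hM_ : forall n m, `|h_ n m| <= M) (hM : forall m, `|h m| <= M).
Hypothesis hh : forall m, alpha <= m -> h_ n m @[n --> \oo] --> h m.
Variable b : X -> R.
Hypotheses (Lb : L2 mu b) (b0 : forall x : 'rV[R]_k.+1, x ord0 ord0 < alpha -> b x = 0).

(** Convergence of [h_] for m >= [alpha] suffices: [P] lives on m >= x^1, and x^1 >= [alpha]. *)
Lemma marg_cvg (x : 'rV[R]_k.+1) s : alpha <= x ord0 ord0 -> absP x s \is a fin_num ->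
  marg (h_ n) s x @[n --> \oo] --> marg h s x.
Proof.
move=> ax xfin.
apply: (@Rintegral_dct _ _ R leb setT _ _ (fun m => M * `|P m x s|)) => //.
- by move=> n; apply: measurable_funM; [exact: mh_|exact: (measurable_P x s)].
- by apply: measurable_funM; [exact: mh|exact: (measurable_P x s)].
- apply: aeW => m _; have [xm|mx] := leP (x ord0 ord0) m.
    by apply: cvgM; [apply: hh; exact: le_trans xm|exact: cvg_cst].
  by rewrite PT// mulr0; under eq_fun do rewrite mulr0; exact: cvg_cst.
- have MM : `|M| <= M by rewrite gtr0_norm.
  have := integrable_abse (integrable_hP (h := fun=> M) (M := M) (measurable_cst _)
    (fun=> MM) xfin).
  by congr (integrable _ _ _); apply/funext => m /=; rewrite normrM gtr0_norm.
- by apply: aeW => m _ n; rewrite normrM ler_wpM2r.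
Qed.

Lemma dot_marg_cvg s : dot mu b (marg (h_ n) s) @[n --> \oo] --> dot mu b (marg h s).
Proof.
have LI : L2 mu (fun x => fine (absP x s)).
  have mI : measurable_fun setT (fun x => fine (absP x s)).
    exact: measurableT_comp (@fine_measurable R setT measurableT) (measurable_absP s).
  split => //; apply: le_lt_trans (ltry C0); apply: le_trans (PC s).
  apply: ge0_le_integral => //.
  - by move=> x _; rewrite lee_fin sqr_ge0.
  - by apply/measurable_EFinP; exact: measurable_funX.
  - by apply: emeasurable_funM; exact: measurable_absP.
  - move=> x _; have := absP_ge0 x s; case: (absP x s) => [r| |//] r0.
      by rewrite -EFinM lee_fin expr2.
    by rewrite /= expr0n/= mule_ge0.
apply: (@Rintegral_dct _ _ R mu setT _ _ (fun x => `|b x * (M * fine (absP x s))|)) => //.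
- by move=> n; apply: measurable_funM; [exact: (L2_meas Lb)|exact: measurable_marg].
- by apply: measurable_funM; [exact: (L2_meas Lb)|exact: measurable_marg].
- apply: aeS (absP_fin s) => x xfin _.
  have [ax|xa] := leP alpha ((x : 'rV[R]_k.+1) ord0 ord0).
    by apply: cvgM; [exact: cvg_cst|exact: marg_cvg].
  by rewrite b0// mul0r; under eq_fun do rewrite mul0r; exact: cvg_cst.
- by apply: integrable_norm; exact: L2_mul_integrable Lb (L2Z M LI).
- apply: aeS (absP_fin s) => x xfin _ n; rewrite !normrM ler_wpM2l//.
  apply: le_trans (normr_marg (mh_ n) (hM_ n) xfin) _.
  by rewrite -normrM ler_norm.
Qed.

Lemma normr_dot_marg g s : measurable_fun setT g -> (forall m, `|g m| <= M) ->
  `|dot mu b (marg g s)| <= dot mu b b + M ^+ 2 * C0.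
Proof.
move=> mg gM; have Lg := L2_marg s M0 mg gM.
by apply: le_trans (normr_dot_le Lb Lg) _; rewrite lerD2l; exact: dot_marg_le.
Qed.

Lemma Rintegral_dot_marg_cvg t :
  \int[leb]_(s in `]0, t]) dot mu b (marg (h_ n) s) @[n --> \oo] -->
  \int[leb]_(s in `]0, t]) dot mu b (marg h s).
Proof.
have mb := L2_meas Lb.
apply: (@Rintegral_dct _ _ R leb _ _ _ (fun=> dot mu b b + M ^+ 2 * C0)) => //.
- by move=> n; apply: measurable_funTS; exact: measurable_dot_marg.
- by apply: measurable_funTS; exact: measurable_dot_marg.
- by apply: aeW => s _; exact: dot_marg_cvg.
- by apply: (@integrable_bounded_itv _ _ `|dot mu b b + M ^+ 2 * C0|).
- by apply: aeW => s _ n; exact: normr_dot_marg.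
Qed.

End limits.

Variable Q : X -> R -> R.
Hypothesis mQ : measurable_fun setT (fun q : R * X => Q q.2 q.1).
Hypothesis QI : forall b, L2 mu b -> (\int[leb]_s \int[mu]_y `|b y * Q y s|%:E < +oo)%E.

(** Condition (b) enters as [QI]. All weights lie below the fixed [g] in L2, so dominated
    convergence applies in y for almost every time, then in time. *)
Lemma boundary_cvg0 (c_ : nat -> X -> R) (g : X -> R) t : L2 mu g ->
  (forall n, measurable_fun setT (c_ n)) -> (forall n y, `|c_ n y| <= g y) ->
  (forall y, c_ n y @[n --> \oo] --> (0 : R)) ->
  \int[leb]_(s in `]0, t]) dot mu (c_ n) (Q^~ s) @[n --> \oo] --> (0 : R).
Proof.
move=> Lg mc cg c0.
have g0 y : 0 <= g y by exact: le_trans (normr_ge0 (c_ 0%N y)) (cg _ _).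
have mg := L2_meas Lg.
have mQs s : measurable_fun setT (Q^~ s) by exact: measurableT_comp mQ (measurable_pair1 s).
pose G s : \bar R := (\int[mu]_y `|g y * Q y s|%:E)%E.
have G0 s : (0 <= G s)%E by apply: integral_ge0 => y _; rewrite lee_fin.
have mG : measurable_fun setT G.
  apply: (@measurable_integral2 _ _ _ _ _ mu (fun q : R * X => `|g q.2 * Q q.2 q.1|%:E)).
  by apply/measurable_EFinP; apply: measurableT_comp => //; apply: measurable_funM => //;
    exact: measurableT_comp.
have iG : leb.-integrable setT G.
  apply/integrableP; split => //; under eq_integral do rewrite gee0_abs//.
  exact: QI.
have aeG : {ae leb, forall s, G s \is a fin_num}.
  by apply: aeS (integrable_ae measurableT iG) => s /(_ I).
have igQ s : G s \is a fin_num -> mu.-integrable setT (EFin \o (fun y => g y * Q y s)).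
  move=> Gs; apply/integrableP; split; first by apply/measurable_EFinP; exact: measurable_funM.
  by have := Gs; rewrite ge0_fin_numE.
have icQ n s : G s \is a fin_num -> mu.-integrable setT (EFin \o (fun y => c_ n y * Q y s)).
  move=> Gs; apply: (@le_integrable _ _ R mu setT measurableT _ _ _ _ (igQ s Gs)).
    by apply/measurable_EFinP; exact: measurable_funM.
  by move=> y _ /=; rewrite lee_fin !normrM ler_wpM2r// (le_trans (cg n y))// ler_norm.
have mdc n : measurable_fun setT (fun s => dot mu (c_ n) (Q^~ s)).
  apply: (@measurable_Rintegral2 _ _ _ _ _ mu (fun q : R * X => c_ n q.2 * Q q.2 q.1)).
  by apply: measurable_funM => //; exact: measurableT_comp.
have z1 : \int[leb]_(s in `]0, t]) (0 : R) = 0 by rewrite /Rintegral integral0_eq.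
have z2 : \int[mu]_y (0 : R) = 0 by rewrite /Rintegral integral0_eq.
rewrite -[X in _ --> X]z1.
apply: (@Rintegral_dct _ _ R leb _ _ _ (fun s => fine (G s))) => //.
- by move=> n; apply: measurable_funTS; exact: mdc.
- apply: aeS aeG => s Gs _.
  rewrite -[X in _ --> X]z2.
  apply: (@Rintegral_dct _ _ R mu _ _ _ (fun y => `|g y * Q y s|)) => //.
  + by move=> n; exact: measurable_funM.
  + apply: aeW => y _; rewrite -[X in _ --> X](mul0r (Q y s)).
    by apply: cvgM; [exact: c0|exact: cvg_cst].
  + exact: integrable_norm (igQ s Gs).
  + by apply: aeW => y _ n; rewrite !normrM ler_wpM2r// (le_trans (cg n y))// ler_norm.
- have : leb.-integrable `]0, t] G by exact: integrableS iG.
  have mfG : measurable_fun `]0, t] (EFin \o (fine \o G)).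
    by apply/measurable_EFinP; apply: measurable_funTS; exact: measurableT_comp.
  move=> h; apply: (@le_integrable _ _ R leb _ (measurable_itv _) _ G) => // s _ /=.
  by have := G0 s; case: (G s) => [r| |]//= _; rewrite normr0 leey.
- apply: aeS aeG => s Gs _ n.
  apply: le_trans (le_normr_Rintegral measurableT (icQ n s Gs)) _.
  rewrite -[fine (G s)]/(\int[mu]_y `|g y * Q y s|).
  apply: le_Rintegral => //.
  + exact: integrable_norm (icQ n s Gs).
  + exact: integrable_norm (igQ s Gs).
  + by move=> y _; rewrite !normrM ler_wpM2r// (le_trans (cg n y))// ler_norm.
Qed.

End MarginalIntegrals.

Section CompactSupport.
Variable R : realType.
Local Notation leb := (@lebesgue_measure R).

Lemma compact_support_bounded (f : R -> R) (M : R) : continuous f ->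
  (forall x, M < `|x| -> f x = 0) -> exists C, 0 <= C /\ forall x, `|f x| <= C.
Proof.
move=> cf fM; apply: (@continuous_bounded _ f (- `|M|) `|M| 0) => //.
  by rewrite ge0_cp.
move=> x; rewrite -ler_norml -ltNge => xM; rewrite fM ?normr0//.
exact: le_lt_trans (ler_norm M) xM.
Qed.

Lemma L2_compact_support (f : R -> R) (M : R) : continuous f ->
  (forall x, M < `|x| -> f x = 0) -> L2 leb f.
Proof.
move=> cf fM; have [C [C0 fC]] := compact_support_bounded cf fM.
have M1 : - `|M| - 1 < `|M| + 1 by have := normr_ge0 M; lra.
have := L2_mul_indicI M1 cf fC; congr (L2 _ _); apply/funext => x.
rewrite indicE mem_setE in_itv/=; case: (boolP (_ && _)) => xM; rewrite ?mulr1// mulr0.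
rewrite fM// ltNge; apply/negP => Mx; move: xM.
have : `|x| <= `|M| + 1 by apply: (le_trans Mx); have := ler_norm M; lra.
by rewrite ler_norml => /andP[h1 h2]; rewrite h2 andbT -ltNge; lra.
Qed.

Lemma jet_lipschitz (D : nat -> R -> R) (L a m : R) : jet2 D ->
  (forall x, `|D 1%N x| <= L) -> a <= m -> `|D 0%N m - D 0%N a| <= L * (m - a).
Proof.
move=> jD DL; rewrite le_eqVlt => /orP[/eqP ->|am]; first by rewrite !subrr normr0 mulr0.
have [D0 _ _] := jD.
have cD : {within `[a, m], continuous (D 0%N)}.
  by apply: continuous_subspaceT; exact: jet2_continuous.
have [c _ ->] := MVT am (fun x _ => D0 x) cD.
have ma0 : 0 <= m - a by rewrite subr_ge0 ltW.
by rewrite normrM (ger0_norm ma0); exact: ler_wpM2r.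
Qed.

End CompactSupport.

(** * Smooth cutoffs of the half-line m <= a *)

Section CutoffInM.
Variables (R : realType) (alpha a : R).

(** The second factor is jstep(3 - (n+1)(m - a)): 1 for m <= a and 0 for m >= a + 3/(n+1). The first
    one, 1 for m >= alpha and 0 for m <= alpha - 3, makes the support compact. *)
Definition etaj (n : nat) : nat -> R -> R :=
  jmul (jaff (@jstep R) 1 (3 - alpha)) (jaff (@jstep R) (- n.+1%:R) (3 + n.+1%:R * a)).

Arguments etaj : simpl never.

Lemma jet2_etaj n : jet2 (etaj n).
Proof. by apply: jet2_jmul; apply: jet2_jaff; exact: jet2_jstep. Qed.

Lemma etaj_bounded : exists C, 0 < C /\ forall n m, `|etaj n 0%N m| <= C.
Proof.
have [C [C0 HC]] := jstep_bounded R; exists (C * C + 1); split.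
  by rewrite ltr_wpDl// mulr_ge0.
move=> n m; rewrite /etaj /jmul /jaff !expr0 !mul1r normrM.
by apply: (@le_trans _ _ (C * C)); [rewrite ler_pM// HC|rewrite lerDl].
Qed.

Lemma etaj0_supp n m : m <= alpha - 3 \/ a + 3 <= m -> etaj n 0%N m = 0.
Proof.
rewrite /etaj /jmul /jaff !expr0 !mul1r => -[h|h].
  by rewrite jstep_le0 ?mul0r//; lra.
suff -> : jstep 0 (- n.+1%:R * m + (3 + n.+1%:R * a)) = 0 :> R by rewrite mulr0.
rewrite jstep_le0// -natr1.
have h1 : 0 <= n%:R :> R by rewrite ler0n.
have h2 : 0 <= n%:R * (m - a) by rewrite mulr_ge0//; lra.
lra.
Qed.

Lemma etaj0E n m : alpha <= m -> etaj n 0%N m = jstep 0 (3 - n.+1%:R * (m - a)).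
Proof.
move=> am; rewrite /etaj /jmul /jaff !expr0 !mul1r (@jstep_ge3 _ 0 (m + _)) ?mul1r//; last lra.
by congr (jstep _ _); ring.
Qed.

Lemma etaj1E n m : alpha <= m ->
  etaj n 1%N m = - n.+1%:R * jstep 1 (3 - n.+1%:R * (m - a)).
Proof.
move=> am; rewrite /etaj /jmul /jaff !expr0 !expr1 !mul1r.
rewrite (@jstep_ge3 _ 1 (m + _))//; last lra.
rewrite (@jstep_ge3 _ 0 (m + _))//; last lra.
by rewrite mul0r add0r mul1r; congr (_ * jstep _ _); ring.
Qed.

Let big_n m : a < m -> \forall n \near \oo, 3 <= n.+1%:R * (m - a).
Proof.
move=> am; near=> n; rewrite -ler_pdivrMr ?subr_gt0//.
apply: (@le_trans _ _ n%:R); last by rewrite ler_nat.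
by near: n; exact: nbhs_infty_ger.
Unshelve. all: by end_near. Qed.

Lemma etaj0_cvg m : alpha <= m -> etaj n 0%N m @[n --> \oo] --> (\1_`]-oo, a] m : R).
Proof.
move=> alm; rewrite indicE mem_setE in_itv/=.
apply: cvg_near_cst; have [ma|am] := leP m a.
  near=> n => /=; rewrite etaj0E// jstep_ge3//.
  have : 0 <= n.+1%:R * (a - m) by rewrite mulr_ge0// subr_ge0.
  lra.
have := big_n am; apply: filterS => n h /=; rewrite etaj0E// jstep_le0//; lra.
Unshelve. all: by end_near. Qed.

Lemma etaj1_cvg m : alpha <= m -> etaj n 1%N m @[n --> \oo] --> (0 : R).
Proof.
move=> alm; apply: cvg_near_cst; have [ma|am] := leP m a.
  near=> n => /=; rewrite etaj1E// jstep_ge3 ?mulr0//.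
  have : 0 <= n.+1%:R * (a - m) by rewrite mulr_ge0// subr_ge0.
  lra.
have := big_n am; apply: filterS => n h /=; rewrite etaj1E// jstep_le0 ?mulr0//; lra.
Unshelve. all: by end_near. Qed.

(* The derivative of the cutoff is of order n, on an interval of length 3/n on which a function
   vanishing at [a] is of order 1/n. *)
Lemma etaj1_mul_bounded (D : nat -> R -> R) L : jet2 D -> D 0%N a = 0 ->
  (forall x, `|D 1%N x| <= L) -> (forall x, x < alpha -> D 0%N x = 0) ->
  exists C, 0 <= C /\ forall n m, `|etaj n 1%N m * D 0%N m| <= C * \1_`[alpha, a + 3] m.
Proof.
move=> jD Da DL D0.
have L0 : 0 <= L by exact: le_trans (normr_ge0 _) (DL 0).
(* The derivative of the cutoff is at most (n+1) C, the function at most L (m - a), and (n+1)(m - a)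
   <= 3 where the derivative is nonzero. *)
have [C [C0 HC]] := jstep_bounded R; exists (C * (3 * L)); split.
  by rewrite !mulr_ge0.
move=> n m; rewrite indicE mem_setE in_itv/=.
have [alm|mal] := leP alpha m => /=; last by rewrite D0// mulr0 normr0 mulr0.
rewrite etaj1E//; set z := n.+1%:R * (m - a).
have n0 : 0 < n.+1%:R :> R by [].
have [z3|z3] := leP 3 z.
  rewrite jstep_le0//; last lra.
  by rewrite mulr0 mul0r normr0 !mulr_ge0// ler0n.
have [z0|z0] := leP z 0.
  rewrite jstep_ge3//; last lra.
  by rewrite mulr0 mul0r normr0 !mulr_ge0// ler0n.
have am : a < m by move: z0; rewrite /z pmulr_rgt0// subr_gt0.
have ma3 : m <= a + 3.
  have : m - a <= z by rewrite /z ler_peMl ?ler1n//; lra.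
  lra.
rewrite ma3 mulr1 -mulrA normrM normrN mulrC normrM (ger0_norm (ltW n0)).
rewrite -mulrA; apply: ler_pM => //; first exact: HC.
have := jet_lipschitz jD DL (ltW am); rewrite Da subr0 => h.
apply: (@le_trans _ _ (L * z)); last by rewrite mulrC ler_wpM2r// ltW.
by rewrite /z mulrCA [leLHS]mulrC ler_wpM2l// ltW.
Qed.

End CutoffInM.

(** * The equation with a sharp cutoff *)

Section WeakFormulation.
Variables (R : realType) (k : nat).
Local Notation X := (g_sigma_algebraType (@open 'rV[R]_k.+1)).
Local Notation leb := (@lebesgue_measure R).
Local Notation mu := (lebV R k.+1).
Variables (B : 'rV[R]_k.+1 -> 'rV[R]_k.+1) (MB : R).
Hypotheses (mB : forall i, measurable_fun setT (fun x : X => B x ord0 i))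
  (BM : forall x i, `|B x ord0 i| <= MB).

Definition ord_zero : nat -> nat := fun=> 0%N.

(* The generator applied to a tensor product of functions of the coordinates of x. *)
Definition genx (psi : nat -> nat -> R -> R) (x : 'rV[R]_k.+1) : R :=
  \sum_(i < k.+1) B x ord0 i * tjet psi (incr ord_zero i) x +
  2^-1 * \sum_(i < k.+1) tjet psi (incr (incr ord_zero i) i) x.

(** The weak formulation with zero initial datum, for products eta(m) psi_0(x^1) psi_1(x^2) ... as
    test functions. [Q] stands for the trace, and [marg] carries out the integral in m first. *)
Definition weak_tensor_identity (T : R) (P : R -> X -> R -> R) (Q : X -> R -> R) :=
  forall (eta : nat -> R -> R) (psi : nat -> nat -> R -> R) (M : R),
  jet2 eta -> (forall i, jet2 (psi i)) ->
  (forall x, M < `|x| -> eta 0%N x = 0) ->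
  (forall i o x, (o <= 2)%N -> M < `|x| -> psi i o x = 0) ->
  forall t, 0 < t <= T ->
  dot mu (tjet psi ord_zero) (marg P (eta 0%N) t) =
  \int[leb]_(s in `]0, t]) dot mu (genx psi) (marg P (eta 0%N) s) +
  2^-1 * \int[leb]_(s in `]0, t])
    dot mu (fun y : X => eta 1%N ((y : 'rV[R]_k.+1) ord0 ord0) * tjet psi ord_zero y) (Q^~ s).

Lemma incr_le2 i l : (incr (incr ord_zero i) i l <= 2)%N.
Proof. by rewrite /incr /ord_zero; case: (l == i). Qed.

Lemma incr1_le2 i l : (incr ord_zero i l <= 2)%N.
Proof. by rewrite /incr /ord_zero; case: (l == i). Qed.

Section tensor_L2.
Variables (psi : nat -> nat -> R -> R) (M : R).
Hypotheses (jpsi : forall i, jet2 (psi i))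
  (psiM : forall i o x, (o <= 2)%N -> M < `|x| -> psi i o x = 0).

Lemma L2_tjet o : (forall i, o i <= 2)%N -> L2 mu (tjet psi o : X -> R).
Proof.
move=> o2; apply: L2_tprod => i; apply: (@L2_compact_support _ _ M).
  exact: jet2_continuous.
by move=> x; exact: psiM.
Qed.

Lemma L2_genx : L2 mu (genx psi : X -> R).
Proof.
apply: L2D.
  apply: (@L2_sum _ _ _ mu _ _ (fun (i : 'I_k.+1) (x : X) => B x ord0 i * tjet psi (incr ord_zero i) x)) => i.
  apply: (L2_bounded_mul (mB i) (M := MB)); first by move=> x; exact: BM.
  by apply: L2_tjet => l; exact: incr1_le2.
apply: L2Z.
apply: (@L2_sum _ _ _ mu _ _ (fun (i : 'I_k.+1) (x : X) => tjet psi (incr (incr ord_zero i) i) x)) => i.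
by apply: L2_tjet => l; exact: incr_le2.
Qed.

End tensor_L2.

Section sharp_cutoff.
Variables (T C0 : R) (P : R -> X -> R -> R) (Q : X -> R -> R).
Hypothesis mP : measurable_fun setT (fun q : (X * R) * R => P q.2 q.1.1 q.1.2).
Hypothesis PT : forall m (x : 'rV[R]_k.+1) s, m < x ord0 ord0 -> P m x s = 0.
Hypothesis PC : forall s, (\int[mu]_x (absP P x s * absP P x s) <= C0%:E)%E.
Hypothesis mQ : measurable_fun setT (fun q : R * X => Q q.2 q.1).
Hypothesis QI : forall b, L2 mu b -> (\int[leb]_s \int[mu]_y `|b y * Q y s|%:E < +oo)%E.
Hypothesis W : weak_tensor_identity T P Q.

(* Smooth cutoffs [etaj] of [m <= a] are supported, in their derivative, in [a, a + 3 / n]. As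
   [psi 0 0] vanishes at [a], the product [etaj' * psi] on the diagonal stays bounded and tends
   to 0, so that the trace term disappears in the limit. *)
Lemma weak_sharp_cutoff (psi : nat -> nat -> R -> R) (M alpha a : R) :
  (forall i, jet2 (psi i)) ->
  (forall i o x, (o <= 2)%N -> M < `|x| -> psi i o x = 0) ->
  (forall o x, (o <= 2)%N -> x < alpha -> psi 0%N o x = 0) ->
  psi 0%N 0%N a = 0 ->
  forall t, 0 < t <= T ->
  dot mu (tjet psi ord_zero) (marg P \1_`]-oo, a] t) =
  \int[leb]_(s in `]0, t]) dot mu (genx psi) (marg P \1_`]-oo, a] s).
Proof.
move=> jpsi psiM psia psi0a t tT.
have [C [C0' HC]] := etaj_bounded alpha a.
have [L [L0 HL]] : exists C, 0 <= C /\ forall x, `|psi 0%N 1%N x| <= C.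
  by apply: (@compact_support_bounded _ _ M); [exact: jet2_continuous|move=> x; exact: psiM].
have [K [K0 HK]] := @etaj1_mul_bounded R alpha a _ L (jpsi 0%N) psi0a HL (fun x => psia 0%N x isT).
(* A common radius for all supports; those of the cutoffs [etaj] lie in [alpha - 3, a + 3]. *)
pose M' := Num.max M (`|alpha - 3| + `|a + 3|).
have Wn n : dot mu (tjet psi ord_zero) (marg P (etaj alpha a n 0%N) t) =
  \int[leb]_(s in `]0, t]) dot mu (genx psi) (marg P (etaj alpha a n 0%N) s) +
  2^-1 * \int[leb]_(s in `]0, t])
    dot mu (fun y : X => etaj alpha a n 1%N ((y : 'rV[R]_k.+1) ord0 ord0) * tjet psi ord_zero y) (Q^~ s).
  apply: (@W (etaj alpha a n) psi M' (@jet2_etaj R alpha a n) jpsi _ _ t tT).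
  - move=> x; rewrite /M' gt_max => /andP[_ h]; apply: etaj0_supp.
    have [x0|x0] := leP 0 x.
      right; rewrite (ger0_norm x0) in h; have := ler_norm (a + 3); have := normr_ge0 (alpha - 3); lra.
    left; rewrite (ltr0_norm x0) in h; have := ler_norm (- (alpha - 3)); rewrite normrN.
    have := normr_ge0 (a + 3); lra.
  - by move=> i o x o2; rewrite /M' gt_max => /andP[h _]; exact: psiM.
have mS : measurable_fun setT (\1_`]-oo, a] : R -> R) by exact: measurable_indic.
have iC m : `|(\1_`]-oo, a] m : R)| <= Num.max C 1.
  by rewrite le_max indicE; case: (_ \in _); rewrite ?normr1 ?normr0 ?lexx ?orbT// ler01 orbT.
have eC n m : `|etaj alpha a n 0%N m| <= Num.max C 1 by rewrite le_max HC.
have CM0 : 0 < Num.max C 1 by rewrite lt_max C0'.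
have me n : measurable_fun setT (etaj alpha a n 0%N).
  apply: continuous_measurable_fun.
  exact: (@jet2_continuous R (etaj alpha a n) 0%N (@jet2_etaj R alpha a n) isT).
have tj0 o (x : 'rV[R]_k.+1) : (forall i, o i <= 2)%N -> x ord0 ord0 < alpha -> tjet psi o x = 0.
  by move=> o2 xa; rewrite /tjet /tprod big_ord_recl psia// mul0r.
have Lt := L2_tjet jpsi psiM (fun i => isT : (ord_zero i <= 2)%N).
have Lg := L2_genx jpsi psiM.
have c1 := @dot_marg_cvg R k P C0 mP PT PC alpha (Num.max C 1) _ _ CM0 me mS eC
  (fun m h => @etaj0_cvg R alpha a m h) _ Lt (fun x h => tj0 ord_zero x (fun=> isT) h) t.
have g0 (x : 'rV[R]_k.+1) : x ord0 ord0 < alpha -> genx psi x = 0.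
  move=> xa; rewrite /genx !big1 ?mulr0 ?addr0// => i _.
    by apply: tj0 => // l; exact: incr_le2.
  by rewrite tj0 ?mulr0// => l; exact: incr1_le2.
have c2 := @Rintegral_dot_marg_cvg R k P C0 mP PT PC alpha (Num.max C 1) _ _ CM0 me mS eC
  (fun m h => @etaj0_cvg R alpha a m h) _ Lg g0 t.
(* Majorant of the boundary weights in product form, so that [L2_tprod] applies: the uniform bound
   on etaj' psi_0 in the first coordinate, |psi_i| in the others. *)
pose hg (i : nat) : R -> R := if i is 0%N then (fun m => K * \1_`[alpha, a + 3] m)
  else (fun m => `|psi i 0%N m|).
have Lhg i : L2 leb (hg i).
  case: i => [|i] /=.
    apply: L2Z; apply: L2_indic => //.
    by rewrite /= lebesgue_measure_itv/=; case: ifP => _; rewrite ?ltry// -EFinD ltry.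
  apply: (@L2_compact_support _ _ M); last by move=> x xM; rewrite psiM// normr0.
  by move=> x; apply: cvg_norm; apply: jet2_continuous.
have c3 := @boundary_cvg0 R k Q mQ QI
  (fun n (y : X) => etaj alpha a n 1%N ((y : 'rV[R]_k.+1) ord0 ord0) * tjet psi ord_zero y)
  (tprod hg) t (L2_tprod _ Lhg).
have {}c3 : \int[leb]_(s in `]0, t])
    dot mu (fun y : X => etaj alpha a n 1%N ((y : 'rV[R]_k.+1) ord0 ord0) * tjet psi ord_zero y) (Q^~ s)
    @[n --> \oo] --> (0 : R).
  apply: c3.
  - move=> n; apply: measurable_funM; last exact: (L2_meas Lt).
    apply: (measurableT_comp _ (@measurable_coord R k.+1 ord0)).
    apply: continuous_measurable_fun.
    exact: (@jet2_continuous R (etaj alpha a n) 1%N (@jet2_etaj R alpha a n) isT).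
  - move=> n y; rewrite /tjet /tprod !big_ord_recl/= mulrA normrM.
    by apply: ler_pM => //; [exact: HK|rewrite normr_prod].
  - move=> y; have [ay|ya] := leP alpha ((y : 'rV[R]_k.+1) ord0 ord0).
      rewrite -[X in _ --> X](mul0r (tjet psi ord_zero y)).
      by apply: cvgM; [exact: etaj1_cvg|exact: cvg_cst].
    rewrite tj0//; under eq_fun do rewrite mulr0; exact: cvg_cst.
have c4 : dot mu (tjet psi ord_zero) (marg P (etaj alpha a n 0%N) t) @[n --> \oo] -->
   \int[leb]_(s in `]0, t]) dot mu (genx psi) (marg P \1_`]-oo, a] s) + 2^-1 * 0.
  under eq_fun do rewrite Wn.
  apply: cvgD; first exact: c2.
  by apply: cvgM; [exact: cvg_cst|exact: c3].
by have := cvg_unique _ c1 c4; rewrite mulr0 addr0; apply; exact: norm_hausdorff.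
Qed.

End sharp_cutoff.
End WeakFormulation.

(** * Sine test functions and the energy estimate *)

(* In each coordinate the test function is a C^2 cutoff [chi] times a sine vanishing at the
   endpoints of [al, be]. The cutoff vanishes near the boundary of the box, except on the face
   [x^1 = be 0 = a], where only the sine does: there the Dirichlet condition is used. *)
Section SineTests.
Variables (R : realType) (al be ga : nat -> R).
Hypotheses (albe : forall i, al i < be i) (gabe : forall i, ga i.+1 = be i.+1).
Local Notation leb := (@lebesgue_measure R).

(** Equal to 1 on [al + 3, ga - 3] and to 0 outside [al, ga]. In the first coordinate [ga] will be
    be + 3, which keeps the cutoff equal to 1 up to the face. *)
Definition chi (i : nat) : nat -> R -> R :=
  jmul (jaff (@jstep R) 1 (- al i)) (jaff (@jstep R) (-1) (ga i)).

Definition kap (nu : seq nat) (i : nat) : R := freq (al i) (be i) * (nth 0%N nu i).+1%:R.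

Definition psi (nu : seq nat) (i : nat) : nat -> R -> R :=
  jmul (chi i) (jsin (sysc (al i) (be i)) (kap nu i) (al i)).

Definition sI (i j : nat) : R -> R := sinI (al i) (be i) j.

(** What differentiation in the coordinate [l] makes of a product of sines, up to the frequency. *)
Definition mixI (l i j : nat) : R -> R :=
  if i == l then cosI (al i) (be i) j else sinI (al i) (be i) j.

Arguments chi : simpl never.
Arguments psi : simpl never.

Lemma jet2_chi i : jet2 (chi i).
Proof. by apply: jet2_jmul; apply: jet2_jaff; exact: jet2_jstep. Qed.

Lemma jet2_psi nu i : jet2 (psi nu i).
Proof. by apply: jet2_jmul; [exact: jet2_chi|exact: jet2_jsin]. Qed.

Lemma jaff_jstep_eq0 (c k x : R) o : (o <= 2)%N -> k * x + c <= 0 -> jaff (@jstep R) k c o x = 0.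
Proof. by move=> o2 h; rewrite /jaff jstep_le0// mulr0. Qed.

Lemma chi_eq0 i o x : (o <= 2)%N -> x <= al i \/ ga i <= x -> chi i o x = 0.
Proof.
move=> o2 [h|h].
  have h0 o' : (o' <= 2)%N -> jaff (@jstep R) 1 (- al i) o' x = 0.
    by move=> o2'; apply: jaff_jstep_eq0 => //; lra.
  by rewrite /chi /jmul; case: o o2 => [|[|[|//]]] _; rewrite !h0// ?(mul0r, mulr0, addr0).
have h0 o' : (o' <= 2)%N -> jaff (@jstep R) (-1) (ga i) o' x = 0.
  by move=> o2'; apply: jaff_jstep_eq0 => //; lra.
by rewrite /chi /jmul; case: o o2 => [|[|[|//]]] _; rewrite !h0// ?(mul0r, mulr0, addr0).
Qed.

Lemma psi_eq0 nu i o x : (o <= 2)%N -> x <= al i \/ ga i <= x -> psi nu i o x = 0.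
Proof.
move=> o2 h; rewrite /psi /jmul.
by case: o o2 => [|[|[|//]]] _; rewrite !(chi_eq0 _ h)// ?(mul0r, mulr0, addr0).
Qed.

Lemma chi_eq1 i x : al i + 3 <= x <= ga i - 3 -> chi i 0%N x = 1.
Proof.
move=> /andP[h1 h2]; rewrite /chi /jmul /jaff !expr0 !mul1r.
by rewrite !jstep_ge3 ?mulr1//; lra.
Qed.

(** The slopes are 1 and -1 for every box, so [D] does not depend on it; this makes the energy
    constant uniform. The 4 is the sum 1 + 2 + 1 of the Leibniz coefficients at order two. *)
Lemma chi_bounded : exists D, 1 <= D /\
  forall al' ga' o x, (o <= 2)%N ->
  `|jmul (jaff (@jstep R) 1 (- al')) (jaff (@jstep R) (-1) ga') o x| <= D.
Proof.
have [C [C0 HC]] := jstep_bounded R; exists (4 * C ^+ 2 + 1).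
have C2 : 0 <= C ^+ 2 by exact: sqr_ge0.
split; first by lra.
move=> al' ga' o x o2.
have h k c o' y : `|k| = 1 -> (o' <= 2)%N -> `|jaff (@jstep R) k c o' y| <= C.
  by move=> k1 o2'; rewrite /jaff normrM normrX k1 expr1n mul1r HC.
have h1 o' : (o' <= 2)%N -> `|jaff (@jstep R) 1 (- al') o' x| <= C by apply: h; rewrite normr1.
have h2 o' : (o' <= 2)%N -> `|jaff (@jstep R) (-1) ga' o' x| <= C by apply: h; rewrite normrN normr1.
have hh o1 o2' : (o1 <= 2)%N -> (o2' <= 2)%N ->
  `|jaff (@jstep R) 1 (- al') o1 x * jaff (@jstep R) (-1) ga' o2' x| <= C ^+ 2.
  by move=> i1 i2; rewrite normrM expr2 ler_pM// ?h1// h2.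
rewrite /jmul; case: o o2 => [|[|[|//]]] _.
- by apply: le_trans (hh 0%N 0%N isT isT) _; lra.
- apply: le_trans (ler_normD _ _) _.
  by have := hh 1%N 0%N isT isT; have := hh 0%N 1%N isT isT; lra.
- apply: le_trans (ler_normD _ _) _; apply: le_trans (lerD (ler_normD _ _) (lexx _)) _.
  rewrite [`|2 * _|]normrM (@ger0_norm _ 2)//.
  have := hh 2%N 0%N isT isT; have := hh 1%N 1%N isT isT; have := hh 0%N 2%N isT isT; lra.
Qed.

Section coordinate.
Variables (nu : seq nat) (i : nat) (x : R).
Hypothesis xi : i = 0%N -> x <= be 0%N.

(** Outside the box the cutoff vanishes with its derivatives, except past the right end in the first
    coordinate, which [xi] excludes. Hence truncating the sines to the box does not change [psi]. *)
Let out_or_in : (forall o, (o <= 2)%N -> chi i o x = 0) \/ al i <= x <= be i.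
Proof.
have [h|h] := leP x (al i); first by left=> o o2; apply: chi_eq0 => //; left.
have [h1|h1] := leP x (be i); first by right; rewrite (ltW h).
left=> o o2; apply: chi_eq0 => //; right.
by case: (i) xi h h1 => [/(_ erefl)|j _ _ /ltW]; [lra|rewrite gabe].
Qed.

Lemma psi0E : psi nu i 0%N x = chi i 0%N x * sI i (nth 0%N nu i) x.
Proof.
rewrite {1}/psi /jmul /sI /sinI indicE mem_setE in_itv/=.
case: out_or_in => [c0|->]; first by rewrite c0// !mul0r.
by rewrite /kap/=; ring.
Qed.

Lemma psi1E : psi nu i 1%N x = chi i 1%N x * sI i (nth 0%N nu i) x +
  kap nu i * (chi i 0%N x * cosI (al i) (be i) (nth 0%N nu i) x).
Proof.
rewrite {1}/psi /jmul /sI /sinI /cosI indicE mem_setE in_itv/=.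
case: out_or_in => [c0|->]; first by rewrite !c0// ?(mul0r, mulr0, addr0, subr0).
by rewrite /kap/=; ring.
Qed.

Lemma psi2E : psi nu i 2%N x = chi i 2%N x * sI i (nth 0%N nu i) x +
  2 * kap nu i * (chi i 1%N x * cosI (al i) (be i) (nth 0%N nu i) x) -
  kap nu i ^+ 2 * (chi i 0%N x * sI i (nth 0%N nu i) x).
Proof.
rewrite {1}/psi /jmul /sI /sinI /cosI indicE mem_setE in_itv/=.
case: out_or_in => [c0|->]; first by rewrite !c0// ?(mul0r, mulr0, addr0, subr0).
by rewrite /kap/=; ring.
Qed.

End coordinate.

Section tensor.
Variables (n : nat) (nu : seq nat) (x : 'rV[R]_n.+1).
Hypothesis x0 : x ord0 ord0 <= be 0%N.

Let xi (i : 'I_n.+1) : (i : nat) = 0%N -> x ord0 i <= be 0%N.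
Proof. by move=> i0; rewrite (_ : i = ord0)//; exact/val_inj. Qed.

Lemma tjet_psi0 : tjet (psi nu) ord_zero x = tjet chi ord_zero x * tens sI nu x.
Proof.
rewrite /tjet /tens /tprod -big_split/=; apply: eq_bigr => i _.
by rewrite /ord_zero psi0E//; exact: xi.
Qed.

Let rest (l : 'I_n.+1) (h : nat -> R -> R) : R := \prod_(i < n.+1 | i != l) h i (x ord0 i).

Let tprodD1 (l : 'I_n.+1) h : tprod h x = h l (x ord0 l) * rest l h.
Proof. by rewrite /tprod (bigD1 l). Qed.

Let rest_eq (l : 'I_n.+1) (h h' : nat -> R -> R) : (forall i : 'I_n.+1, i != l -> h i = h' i) -> rest l h = rest l h'.
Proof. by move=> hh; apply: eq_bigr => i il; rewrite hh. Qed.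

Let rest_psi (l : 'I_n.+1) : rest l (fun i => psi nu i 0%N) =
  rest l (fun i => chi i 0%N) * rest l (fun i => sI i (nth 0%N nu i)).
Proof.
rewrite /rest -big_split/=; apply: eq_bigr => i _.
by rewrite psi0E//; exact: xi.
Qed.

Let incr_neq (l i : 'I_n.+1) : i != l -> incr ord_zero l i = 0%N.
Proof. by move=> il; rewrite /incr -val_eqE/= in il *; rewrite (negbTE il). Qed.

Let incr2_neq (l i : 'I_n.+1) : i != l -> incr (incr ord_zero l) l i = 0%N.
Proof. by move=> il; rewrite {1}/incr -val_eqE/= in il *; rewrite (negbTE il) /incr (negbTE il). Qed.

Let tjet1 (D : nat -> nat -> R -> R) (l : 'I_n.+1) :
  tjet D (incr ord_zero l) x = D l 1%N (x ord0 l) * rest l (fun i => D i 0%N).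
Proof.
rewrite /tjet (tprodD1 l) /incr eqxx; congr (_ * _).
by apply: rest_eq => i il; have := incr_neq il; rewrite /incr => ->.
Qed.

Let tjet2 (D : nat -> nat -> R -> R) (l : 'I_n.+1) :
  tjet D (incr (incr ord_zero l) l) x = D l 2%N (x ord0 l) * rest l (fun i => D i 0%N).
Proof.
rewrite /tjet (tprodD1 l) /incr !eqxx; congr (_ * _).
by apply: rest_eq => i il; have := incr2_neq il; rewrite /incr => ->.
Qed.

Let tens_mix (l : 'I_n.+1) : tens (mixI l) nu x =
  cosI (al l) (be l) (nth 0%N nu l) (x ord0 l) * rest l (fun i => sI i (nth 0%N nu i)).
Proof.
rewrite /tens (tprodD1 l) /mixI eqxx; congr (_ * _); apply: rest_eq => i il.
by rewrite -val_eqE/= in il; rewrite (negbTE il).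
Qed.

Lemma tjet_psi1 (l : 'I_n.+1) : tjet (psi nu) (incr ord_zero l) x =
  tjet chi (incr ord_zero l) x * tens sI nu x +
  kap nu l * (tjet chi ord_zero x * tens (mixI l) nu x).
Proof.
rewrite !tjet1 tens_mix rest_psi psi1E; last exact: xi.
rewrite /tens (tprodD1 l) {1}/tjet (tprodD1 l (fun i => chi i (ord_zero i))) /ord_zero; ring.
Qed.

Lemma tjet_psi2 (l : 'I_n.+1) : tjet (psi nu) (incr (incr ord_zero l) l) x =
  tjet chi (incr (incr ord_zero l) l) x * tens sI nu x +
  2 * kap nu l * (tjet chi (incr ord_zero l) x * tens (mixI l) nu x) -
  kap nu l ^+ 2 * (tjet chi ord_zero x * tens sI nu x).
Proof.
rewrite !tjet2 !tjet1 tens_mix rest_psi psi2E; last exact: xi.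
rewrite /tens (tprodD1 l) {1}/tjet (tprodD1 l (fun i => chi i (ord_zero i))) /ord_zero; ring.
Qed.

End tensor.

Section generator.
Variables (n : nat) (B : 'rV[R]_n.+1 -> 'rV[R]_n.+1).

(** The kernels [Xc], [Ec], [Kc] sort the terms of the generator by the derivatives that fall on the
    sines: two for [Xc], one in direction [l] for [Ec l], none for [Kc]. In [Ec] the factor 2 of
    Leibniz cancels the 1/2 of the generator. *)
Definition Xc (x : 'rV[R]_n.+1) : R := tjet chi ord_zero x.

Definition Ec (l : 'I_n.+1) (x : 'rV[R]_n.+1) : R :=
  B x ord0 l * Xc x + tjet chi (incr ord_zero l) x.

Definition Kc (x : 'rV[R]_n.+1) : R :=
  \sum_(l < n.+1) (B x ord0 l * tjet chi (incr ord_zero l) x +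
    2^-1 * tjet chi (incr (incr ord_zero l) l) x).

Lemma genxE nu (x : 'rV[R]_n.+1) : x ord0 ord0 <= be 0%N ->
  genx B (psi nu) x = Kc x * tens sI nu x +
  \sum_(l < n.+1) kap nu l * (Ec l x * tens (mixI l) nu x) -
  2^-1 * (\sum_(l < n.+1) kap nu l ^+ 2) * (Xc x * tens sI nu x).
Proof.
move=> x0; rewrite /genx /Kc mulr_suml mulr_sumr -big_split/=.
rewrite (mulr_sumr _ _ _ 2^-1) (mulr_suml _ _ _ (Xc x * tens sI nu x)) -big_split -sumrB/=.
apply: eq_bigr => l _; by rewrite tjet_psi1// tjet_psi2// /Ec /Xc; field.
Qed.

Lemma kernels_bounded (D MB : R) : 0 <= MB -> 1 <= D ->
  (forall i o x, (o <= 2)%N -> `|chi i o x| <= D) -> (forall x i, `|B x ord0 i| <= MB) ->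
  let M := n.+1%:R * ((MB + 1) * D ^+ n.+1) in
  [/\ forall x, `|Xc x| <= M, forall l x, `|Ec l x| <= M & forall x, `|Kc x| <= M].
Proof.
move=> MB0 D1 chiD BM M.
have tD o x : (forall i, o i <= 2)%N -> `|tjet (n := n.+1) chi o x| <= D ^+ n.+1.
  move=> o2; rewrite /tjet /tprod normr_prod.
  apply: (@le_trans _ _ (\prod_(i < n.+1) D)); last by rewrite prodr_const card_ord.
  by apply: ler_prod => i _; rewrite normr_ge0 chiD.
have Dn : 0 <= D ^+ n.+1 by rewrite exprn_ge0//; lra.
have n1 : 1 <= n.+1%:R :> R by rewrite ler1n.
have ME : (MB + 1) * D ^+ n.+1 <= M.
  by rewrite /M ler_peMl// mulr_ge0//; lra.
have XD x : `|Xc x| <= D ^+ n.+1 by apply: tD.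
split.
- move=> x; apply: le_trans (XD x) _; apply: le_trans ME.
  by rewrite ler_peMl//; lra.
- move=> l x; apply: le_trans ME; rewrite mulrDl mul1r.
  apply: le_trans (ler_normD _ _) _; apply: lerD.
    by rewrite normrM ler_pM.
  by apply: tD => i; exact: incr1_le2.
- move=> x; apply: le_trans (ler_norm_sum _ _ _) _.
  have -> : M = \sum_(l < n.+1) (MB + 1) * D ^+ n.+1 by rewrite sumr_const card_ord /M mulr_natl.
  apply: ler_sum => l _; rewrite mulrDl mul1r.
  apply: le_trans (ler_normD _ _) _; apply: lerD.
    by rewrite normrM ler_pM// tD// => i; exact: incr1_le2.
  rewrite normrM ger0_norm//; apply: (@le_trans _ _ (1 * D ^+ n.+1)); last by rewrite mul1r.
  by rewrite ler_pM//; [lra|apply: tD => i; exact: incr_le2].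
Qed.

End generator.
End SineTests.

(** * The energy estimate on a box *)

Section EnergyEstimate.
Variables (R : realType) (k : nat).
Local Notation X := (g_sigma_algebraType (@open 'rV[R]_k.+1)).
Local Notation leb := (@lebesgue_measure R).
Local Notation mu := (lebV R k.+1).
Variables (B : 'rV[R]_k.+1 -> 'rV[R]_k.+1) (MB : R).
Hypotheses (mB : forall i, measurable_fun setT (fun x : X => B x ord0 i))
  (BM : forall x i, `|B x ord0 i| <= MB).
Variables (T C0 : R) (P : R -> X -> R -> R) (Q : X -> R -> R).
Hypothesis mP : measurable_fun setT (fun q : (X * R) * R => P q.2 q.1.1 q.1.2).
Hypothesis PT : forall m (x : 'rV[R]_k.+1) s, m < x ord0 ord0 -> P m x s = 0.
Hypothesis PC : forall s, (\int[mu]_x (absP P x s * absP P x s) <= C0%:E)%E.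
Hypothesis mQ : measurable_fun setT (fun q : R * X => Q q.2 q.1).
Hypothesis QI : forall b, L2 mu b -> (\int[leb]_s \int[mu]_y `|b y * Q y s|%:E < +oo)%E.
Hypothesis W : weak_tensor_identity B T P Q.
Variable a : R.

Definition Fa (s : R) : X -> R := marg P \1_`]-oo, a] s.

Let mind : measurable_fun setT (\1_`]-oo, a] : R -> R).
Proof. exact: measurable_indic. Qed.

Let indM m : `|(\1_`]-oo, a] m : R)| <= 1.
Proof. by rewrite indicE; case: (_ \in _); rewrite ?normr1 ?normr0. Qed.

Lemma L2_Fa s : L2 mu (Fa s).
Proof. exact: (@L2_marg R k P C0 mP PC _ 1 s ltr01 mind indM). Qed.

Lemma dot_Fa_le s : dot mu (Fa s) (Fa s) <= C0.
Proof.
have := @dot_marg_le R k P C0 mP PC _ 1 s ltr01 mind indM.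
by rewrite expr1n mul1r.
Qed.

(** For x^1 > a the conditions m <= a and m >= x^1 exclude each other. Identities for test functions
    are therefore only needed on x^1 <= a. *)
Lemma Fa_eq0 s (x : 'rV[R]_k.+1) : a < x ord0 ord0 -> Fa s x = 0.
Proof.
move=> ax; rewrite /Fa /marg /Rintegral integral0_eq//= => m _.
rewrite indicE mem_setE in_itv/=; have [ma|am] := leP m a; last by rewrite mul0r.
by rewrite PT ?mulr0//; exact: le_lt_trans ax.
Qed.

Lemma measurable_dot_Fa b : measurable_fun setT b -> measurable_fun setT (fun s => dot mu b (Fa s)).
Proof. by move=> mb; exact: (measurable_dot_marg mP mb mind). Qed.

Lemma L2_mulFa (g : X -> R) M s : measurable_fun setT g -> (forall x, `|g x| <= M) ->
  L2 mu (fun x => g x * Fa s x).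
Proof. by move=> mg gM; apply: (L2_bounded_mul mg gM); exact: L2_Fa. Qed.

Lemma dot_mulFa_le (g : X -> R) M s : measurable_fun setT g -> (forall x, `|g x| <= M) ->
  dot mu (fun x => g x * Fa s x) (fun x => g x * Fa s x) <= M ^+ 2 * dot mu (Fa s) (Fa s).
Proof.
move=> mg gM; have Lg := L2_mulFa s mg gM.
rewrite {2}/dot -RintegralZl//; last exact: L2_mul_integrable (L2_Fa s) (L2_Fa s).
apply: le_Rintegral => //; first exact: L2_mul_integrable.
  exact: (integrableZl measurableT (M ^+ 2) (L2_mul_integrable (L2_Fa s) (L2_Fa s))).
move=> x _; rewrite mulrACA -!expr2 ler_wpM2r ?sqr_ge0//.
rewrite -(real_normK (num_real (g x))) lerXn2r ?nnegrE//.
exact: le_trans (normr_ge0 _) (gM x).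
Qed.

(** Moving the kernel from the basis function to [Fa] yields coefficients of g times [Fa] in a fixed
    orthonormal system, to which Parseval and Bessel apply. *)
Lemma dot_mul_swap (g h : X -> R) s :
  dot mu (fun x => g x * h x) (Fa s) = dot mu (fun x => g x * Fa s x) h.
Proof. by apply: eq_Rintegral => x _; rewrite mulrAC. Qed.

Section box.
Variables (al be ga : nat -> R) (D M0 : R).
Hypotheses (albe : forall i, al i < be i) (gabe : forall i, ga i.+1 = be i.+1).
Hypotheses (be0 : be 0%N = a) (alM : forall i, - M0 <= al i) (gaM : forall i, ga i <= M0).
Hypotheses (D1 : 1 <= D) (chiD : forall i o x, (o <= 2)%N -> `|chi al ga i o x| <= D).
Local Notation psi := (psi al be ga).
Local Notation sI := (sI al be).
Local Notation mixI := (mixI al be).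
Local Notation kap := (kap al be).
Local Notation Xc := (@Xc R al ga k).
Local Notation Ec := (@Ec R al ga k B).
Local Notation Kc := (@Kc R al ga k B).
Let M := k.+1%:R * ((MB + 1) * D ^+ k.+1).

Let MB0 : 0 <= MB.
Proof. exact: le_trans (normr_ge0 _) (BM 0 ord0). Qed.

Let KM := @kernels_bounded R al ga k B D MB MB0 D1 chiD BM.

Let mtj o : (forall i, o i <= 2)%N -> measurable_fun setT (tjet (n := k.+1) (chi al ga) o : X -> R).
Proof.
move=> o2; apply: measurable_tprod => i; apply: continuous_measurable_fun.
exact: (@jet2_continuous R _ _ (jet2_chi al ga i) (o2 i)).
Qed.

Let mX : measurable_fun setT (Xc : X -> R).
Proof. exact: mtj. Qed.

Let mE l : measurable_fun setT (Ec l : X -> R).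
Proof.
apply: measurable_funD; last by apply: mtj => i; exact: incr1_le2.
by apply: measurable_funM; [exact: mB|exact: mX].
Qed.

Let mK : measurable_fun setT (Kc : X -> R).
Proof.
apply: (@measurable_sum _ _ _ _ _ _ (fun (l : 'I_k.+1) (x : X) =>
  B x ord0 l * tjet (chi al ga) (incr ord_zero l) x +
  2^-1 * tjet (chi al ga) (incr (incr ord_zero l) l) x)) => l.
apply: measurable_funD.
  by apply: measurable_funM; [exact: mB|apply: mtj => i; exact: incr1_le2].
by apply: measurable_funM => //; apply: mtj => i; exact: incr_le2.
Qed.

Let L2s nu : L2 mu (tens sI nu : X -> R).
Proof. by apply: L2_tprod => i; exact: L2_sinI. Qed.

Let L2m l nu : L2 mu (tens (mixI l) nu : X -> R).
Proof. by apply: L2_tprod => i; rewrite /mixI; case: ifP => _; [exact: L2_cosI|exact: L2_sinI]. Qed.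

Definition ucoef nu s := dot mu (fun x => Xc x * tens sI nu x) (Fa s).
Definition kcoef nu s := dot mu (fun x => Kc x * tens sI nu x) (Fa s).
Definition ecoef nu (l : 'I_k.+1) s := dot mu (fun x => Ec l x * tens (mixI l) nu x) (Fa s).

Let LX nu : L2 mu (fun x => Xc x * tens sI nu x).
Proof. by case: KM => h _ _; exact: (L2_bounded_mul mX h (L2s nu)). Qed.
Let LK nu : L2 mu (fun x => Kc x * tens sI nu x).
Proof. by case: KM => _ _ h; exact: (L2_bounded_mul mK h (L2s nu)). Qed.
Let LE l nu : L2 mu (fun x => Ec l x * tens (mixI l) nu x).
Proof. by case: KM => _ h _; exact: (L2_bounded_mul (mE l) (h l) (L2m l nu)). Qed.

Lemma ucoef_ode nu t : 0 < t <= T -> ucoef nu t = \int[leb]_(s in `]0, t])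
  (kcoef nu s + \sum_(l < k.+1) kap nu l * ecoef nu l s -
   2^-1 * (\sum_(l < k.+1) kap nu l ^+ 2) * ucoef nu s).
Proof.
move=> tT.
have psiM i o x : (o <= 2)%N -> M0 < `|x| -> psi nu i o x = 0.
  move=> o2 Mx; apply: psi_eq0 => //; have := alM i; have := gaM i.
  by have [x0|x0] := leP 0 x; [rewrite (ger0_norm x0) in Mx; right|
    rewrite (ltr0_norm x0) in Mx; left]; lra.
have psia o x : (o <= 2)%N -> x < al 0%N -> psi nu 0%N o x = 0.
  by move=> o2 xa; apply: psi_eq0 => //; left; exact: ltW.
(* As [be 0] is [a], the sine is evaluated at an integer multiple of pi. *)
have psi00 : psi nu 0%N 0%N a = 0.
  rewrite psi0E//; last by rewrite be0.
  rewrite /sI /sinI be0 (_ : freq _ _ * _ * _ = pi *+ (nth 0%N nu 0%N).+1).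
    by rewrite sin_pi_nat mulr0 mul0r mulr0.
  have := albe 0%N; rewrite be0 -subr_gt0 => h.
  by rewrite /freq -mulr_natr; field; rewrite gt_eqF.
have := weak_sharp_cutoff mB BM mP PT PC mQ QI W (jet2_psi al be ga nu) psiM psia psi00 tT.
rewrite -/(Fa t) => H.
have -> : ucoef nu t = dot mu (tjet (psi nu) ord_zero) (Fa t).
  (* The factorisation through truncated sines holds for x^1 <= a only; elsewhere [Fa] is 0. *)
  apply: eq_Rintegral => x _; have [xa|ax] := leP ((x : 'rV[R]_k.+1) ord0 ord0) a.
    by rewrite tjet_psi0// be0.
  by rewrite Fa_eq0// !mulr0.
rewrite H; apply: eq_Rintegral => s _; rewrite -/(Fa s).
transitivity (dot mu (fun x => Kc x * tens sI nu x +
    \sum_(l < k.+1) kap nu l * (Ec l x * tens (mixI l) nu x) -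
    2^-1 * (\sum_(l < k.+1) kap nu l ^+ 2) * (Xc x * tens sI nu x)) (Fa s)).
  apply: eq_Rintegral => x _; have [xa|ax] := leP ((x : 'rV[R]_k.+1) ord0 ord0) a.
    by rewrite (genxE _ gabe)// be0.
  by rewrite Fa_eq0// !mulr0.
have LF := L2_Fa s.
have LS : L2 mu (fun x => \sum_(l < k.+1) kap nu l * (Ec l x * tens (mixI l) nu x)).
  apply: (@L2_sum _ _ _ mu _ _ (fun (l : 'I_k.+1) (x : X) => kap nu l * (Ec l x * tens (mixI l) nu x))) => l.
  exact: L2Z.
rewrite dotBl//; [|exact: L2D|exact: L2Z].
rewrite dotDl// dotZl//; congr (_ + _ - _).
rewrite (@dot_suml _ _ _ mu _ _ (fun (l : 'I_k.+1) (x : X) => kap nu l * (Ec l x * tens (mixI l) nu x)))//.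
  by apply: eq_bigr => l _; rewrite dotZl.
by move=> l; exact: L2Z.
Qed.

(** A crude bound depending on [nu]: it only provides integrability in time and does not enter the
    final constant. *)
Let eM nu := C0 + (dot mu (fun x => Xc x * tens sI nu x) (fun x => Xc x * tens sI nu x) +
  dot mu (fun x => Kc x * tens sI nu x) (fun x => Kc x * tens sI nu x) +
  \sum_(l < k.+1) dot mu (fun x => Ec l x * tens (mixI l) nu x) (fun x => Ec l x * tens (mixI l) nu x)).

Let coef_bounded nu s : [/\ `|ucoef nu s| <= eM nu, `|kcoef nu s| <= eM nu &
  forall l, `|ecoef nu l s| <= eM nu].
Proof.
have S0 : 0 <= \sum_(l < k.+1) dot mu (fun x => Ec l x * tens (mixI l) nu x) (fun x => Ec l x * tens (mixI l) nu x).
  by apply: sumr_ge0 => l _; exact: dot_ge0.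
have U0 := dot_ge0 mu (fun x => Xc x * tens sI nu x).
have K0 := dot_ge0 mu (fun x => Kc x * tens sI nu x).
have FC := dot_Fa_le s.
split.
- by apply: le_trans (normr_dot_le (LX nu) (L2_Fa s)) _; rewrite /eM; lra.
- by apply: le_trans (normr_dot_le (LK nu) (L2_Fa s)) _; rewrite /eM; lra.
- move=> l; apply: le_trans (normr_dot_le (LE l nu) (L2_Fa s)) _; rewrite /eM.
  move: S0; rewrite (bigD1 l)//=.
  have : 0 <= \sum_(i < k.+1 | i != l) dot mu (fun x => Ec i x * tens (mixI i) nu x) (fun x => Ec i x * tens (mixI i) nu x).
    by apply: sumr_ge0 => i _; exact: dot_ge0.
  lra.
Qed.

Lemma ucoef_energy nu t : 0 < t <= T -> ((ucoef nu t ^+ 2)%:E <= \int[leb]_(s in `]0%R, t])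
  (kcoef nu s ^+ 2 + ucoef nu s ^+ 2 + \sum_(l < k.+1) ecoef nu l s ^+ 2)%:E)%E.
Proof.
move=> tT.
have mu_ : measurable_fun setT (ucoef nu) by apply: measurable_dot_Fa; exact: (L2_meas (LX nu)).
have mk_ : measurable_fun setT (kcoef nu) by apply: measurable_dot_Fa; exact: (L2_meas (LK nu)).
have me_ l : measurable_fun setT (ecoef nu l) by apply: measurable_dot_Fa; exact: (L2_meas (LE l nu)).
have := @energy_ode R k.+1 T (eM nu) (ucoef nu) (kcoef nu) (ecoef nu) (fun l => kap nu l) mu_ mk_ me_
  (fun s => let: And3 h _ _ := coef_bounded nu s in h)
  (fun s => let: And3 _ h _ := coef_bounded nu s in h)
  (fun l s => let: And3 _ _ h := coef_bounded nu s in h l)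
  (fun t tT => ucoef_ode nu tT) t tT.
rewrite -lee_fin => H; apply: le_trans H _.
have sq x : `|x| <= eM nu -> `|x ^+ 2| <= eM nu ^+ 2.
  by move=> h; rewrite normrX lerXn2r ?nnegrE//; exact: le_trans (normr_ge0 _) h.
rewrite /Rintegral fineK//; apply: integrable_fin_num => //.
apply: (@integrable_bounded_itv R _ (eM nu ^+ 2 + eM nu ^+ 2 + \sum_(l < k.+1) eM nu ^+ 2)).
  apply: measurable_funD; first by apply: measurable_funD; exact: measurable_funX.
  apply: (@measurable_sum _ _ _ _ _ _ (fun (l : 'I_k.+1) s => ecoef nu l s ^+ 2)) => l.
  exact: measurable_funX.
move=> s; have [hu hk he] := coef_bounded nu s.
apply: le_trans (ler_normD _ _) _; apply: lerD.
  by apply: le_trans (ler_normD _ _) _; apply: lerD; exact: sq.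
by apply: le_trans (ler_norm_sum _ _ _) _; apply: ler_sum => l _; exact: sq.
Qed.

Lemma orthonormal_sI i : orthonormal_seq leb (sI i).
Proof. exact: orthonormal_sinI. Qed.

Lemma orthonormal_mixI l i : orthonormal_seq leb (mixI l i).
Proof.
rewrite /mixI; case: (i == l); [exact: orthonormal_cosI|exact: orthonormal_sinI].
Qed.

(* The constant depends neither on the box nor on the level [a], only on the bounds [MB] and [D]
   of the drift and of the cutoffs. *)
Lemma box_energy t : 0 < t <= T ->
  dot mu (fun x => Xc x * Fa t x) (fun x => Xc x * Fa t x) <=
  k.+3%:R * M ^+ 2 * \int[leb]_(s in `]0, t]) dot mu (Fa s) (Fa s).
Proof.
move=> tT; have [XM EM KMM] := KM.
have LXF s := L2_mulFa s mX XM.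
rewrite -lee_fin.
apply: (@le_trans _ _ (multisum k.+1 (fun nu => (ucoef nu t ^+ 2)%:E))).
  rewrite (@eq_multisum _ _ _ (fun nu => (dot mu (fun x => Xc x * Fa t x) (tens sI nu) ^+ 2)%:E)); last first.
    by move=> nu; rewrite /ucoef dot_mul_swap.
  (* Parseval on the box: outside it either the cutoff vanishes or, beyond the face x^1 = a, [Fa]
     does. *)
  apply: (@parseval_tens R k.+1 sI (fun i => `[al i, be i]%classic)) => //.
  - exact: orthonormal_sI.
  - by move=> i g Lg g0; exact: (sine_parseval (albe i) Lg g0).
  - move=> x i /=; rewrite in_itv/= => /negP; rewrite negb_and -!ltNge => h.
    have [xa|ax] := leP (x ord0 ord0) a; last by rewrite Fa_eq0// mulr0.
    suff c0 : chi al ga i (ord_zero i) (x ord0 i) = 0.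
      by rewrite /Xc /tjet /tprod (bigD1 i)// c0/= !mul0r.
    apply: chi_eq0 => //; case/orP: h => [/ltW|] h; first by left.
    right; case: i h => -[|i] ii; last by rewrite gabe => /ltW.
    by rewrite (_ : Ordinal ii = ord0) ?be0 ?ltNge ?xa//; exact/val_inj.
apply: (@le_trans _ _ (multisum k.+1 (fun nu => \int[leb]_(s in `]0%R, t])
  (kcoef nu s ^+ 2 + ucoef nu s ^+ 2 + \sum_(l < k.+1) ecoef nu l s ^+ 2)%:E)%E)).
  apply: le_multisum => nu; first by rewrite lee_fin sqr_ge0.
  exact: ucoef_energy.
have mU nu : measurable_fun setT (ucoef nu) by apply: measurable_dot_Fa; exact: (L2_meas (LX nu)).
have mk_ nu : measurable_fun setT (kcoef nu) by apply: measurable_dot_Fa; exact: (L2_meas (LK nu)).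
have me_ nu l : measurable_fun setT (ecoef nu l) by apply: measurable_dot_Fa; exact: (L2_meas (LE l nu)).
have S0 nu s : 0 <= \sum_(l < k.+1) ecoef nu l s ^+ 2 by apply: sumr_ge0 => l _; exact: sqr_ge0.
have mS nu : measurable_fun setT (fun s => \sum_(l < k.+1) ecoef nu l s ^+ 2).
  apply: (@measurable_sum _ _ _ _ _ _ (fun (l : 'I_k.+1) s => ecoef nu l s ^+ 2)) => l.
  exact: measurable_funX.
have mA nu : measurable_fun setT (fun s =>
    (kcoef nu s ^+ 2 + ucoef nu s ^+ 2 + \sum_(l < k.+1) ecoef nu l s ^+ 2)%:E).
  by apply/measurable_EFinP; apply: measurable_funD => //; apply: measurable_funD; exact: measurable_funX.
have A0 nu s : (0 <= (kcoef nu s ^+ 2 + ucoef nu s ^+ 2 + \sum_(l < k.+1) ecoef nu l s ^+ 2)%:E)%E.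
  by rewrite lee_fin !addr_ge0 ?sqr_ge0.
have FC s : `|dot mu (Fa s) (Fa s)| <= C0 by rewrite ger0_norm ?dot_ge0// dot_Fa_le.
have mF : measurable_fun setT (fun s => dot mu (Fa s) (Fa s)).
  apply: (@measurable_Rintegral2 _ _ _ _ _ mu (fun q : R * X => Fa q.1 q.2 * Fa q.1 q.2)).
  have msw : measurable_fun setT (fun q : R * X => (q.2, q.1)).
    by apply: measurable_fun_pair; [exact: measurable_snd|exact: measurable_fst].
  by apply: measurable_funM; exact: (measurableT_comp (measurable_marg2 mP mind) msw).
have iF := @integrable_bounded_itv R _ C0 0 t mF FC.
rewrite -(@integral_multisum R _ _ leb _ _ (fun nu s => (kcoef nu s ^+ 2 + ucoef nu s ^+ 2 + \sum_(l < k.+1) ecoef nu l s ^+ 2)%:E))//.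
rewrite EFinM /Rintegral fineK; last exact: integrable_fin_num.
rewrite -ge0_integralZl//; first last.
- by rewrite lee_fin mulr_ge0 ?sqr_ge0.
- by move=> s _; rewrite lee_fin dot_ge0.
- by apply/measurable_EFinP; exact: measurable_funTS.
apply: ge0_le_integral => //.
- by move=> s _; exact: multisum_ge0.
- apply: measurable_funTS.
  exact: (@measurable_multisum R _ _ _ (fun nu s => (kcoef nu s ^+ 2 + ucoef nu s ^+ 2 + \sum_(l < k.+1) ecoef nu l s ^+ 2)%:E)).
- by apply: measurable_funTS; apply: emeasurable_funM => //; exact/measurable_EFinP.
move=> s _.
have bes (g : X -> R) e : measurable_fun setT g -> (forall x, `|g x| <= M) ->
    (forall i, orthonormal_seq leb (e i)) ->
  (multisum k.+1 (fun nu => (dot mu (fun x => g x * tens e nu x) (Fa s) ^+ 2)%:E) <=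
    (M ^+ 2 * dot mu (Fa s) (Fa s))%:E)%E.
  move=> mg gM oe; apply: le_trans (_ : _ <= (dot mu (fun x => g x * Fa s x) (fun x => g x * Fa s x))%:E)%E _.
    rewrite (@eq_multisum _ _ _ (fun nu => (dot mu (fun x => g x * Fa s x) (tens e nu) ^+ 2)%:E)); last first.
      by move=> nu; rewrite dot_mul_swap.
    by apply: bessel_tens => //; exact: L2_mulFa gM.
  by rewrite lee_fin; exact: dot_mulFa_le.
rewrite (@eq_multisum _ _ _ (fun nu => ((kcoef nu s ^+ 2)%:E + (ucoef nu s ^+ 2)%:E) + \sum_(l < k.+1) (ecoef nu l s ^+ 2)%:E)%E); last first.
  by move=> nu; rewrite !EFinD sumEFin.
rewrite multisumD; first last.
- by move=> nu; rewrite sumEFin lee_fin.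
- by move=> nu; rewrite -EFinD lee_fin addr_ge0 ?sqr_ge0.
rewrite multisumD; try by move=> nu; rewrite lee_fin sqr_ge0.
rewrite multisum_sum; last by move=> l nu; rewrite lee_fin sqr_ge0.
(* One Bessel bound for [kcoef], one for [ucoef] and k + 1 for the [ecoef]: this is the factor k +
   3. *)
apply: (@le_trans _ _ ((M ^+ 2 * dot mu (Fa s) (Fa s))%:E + (M ^+ 2 * dot mu (Fa s) (Fa s))%:E +
   \sum_(l < k.+1) (M ^+ 2 * dot mu (Fa s) (Fa s))%:E)%E).
  apply: leeD; first by apply: leeD; apply: bes => //; exact: orthonormal_sI.
  by apply: lee_sum => l _; apply: bes => //; exact: orthonormal_mixI.
rewrite sumEFin -!EFinD -EFinM lee_fin sumr_const card_ord -mulr_natl -[k.+3%:R]natr1 -[k.+2%:R]natr1.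
by rewrite le_eqVlt; apply/orP; left; apply/eqP; ring.
Qed.

End box.
End EnergyEstimate.

(** * Exhausting the half-space x^1 < a by boxes *)

Section Vanishing.
Variables (R : realType) (k : nat).
Local Notation X := (g_sigma_algebraType (@open 'rV[R]_k.+1)).
Local Notation leb := (@lebesgue_measure R).
Local Notation mu := (lebV R k.+1).
Variables (B : 'rV[R]_k.+1 -> 'rV[R]_k.+1) (MB : R).
Hypotheses (mB : forall i, measurable_fun setT (fun x : X => B x ord0 i))
  (BM : forall x i, `|B x ord0 i| <= MB).
Variables (T C0 : R) (P : R -> X -> R -> R) (Q : X -> R -> R).
Hypothesis mP : measurable_fun setT (fun q : (X * R) * R => P q.2 q.1.1 q.1.2).
Hypothesis PT : forall m (x : 'rV[R]_k.+1) s, m < x ord0 ord0 -> P m x s = 0.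
Hypothesis PC : forall s, (\int[mu]_x (absP P x s * absP P x s) <= C0%:E)%E.
Hypothesis mQ : measurable_fun setT (fun q : R * X => Q q.2 q.1).
Hypothesis QI : forall b, L2 mu b -> (\int[leb]_s \int[mu]_y `|b y * Q y s|%:E < +oo)%E.
Hypothesis W : weak_tensor_identity B T P Q.

(** The box is [a - N - 3, a] times [-N - 3, N + 3]^k. The margin 3 is the transition length of
    [jstep], so the cutoff is 1 on [a - N, a] times [-N, N]^k; with [ga] equal to a + 3 no margin is
    spent at the face x^1 = a. *)
Let al (a : R) (N i : nat) : R := (if i == 0%N then a else 0) - N%:R - 3.
Let be (a : R) (N i : nat) : R := if i == 0%N then a else N%:R + 3.
Let ga (a : R) (N i : nat) : R := (if i == 0%N then a else N%:R) + 3.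

Let albe a N i : al a N i < be a N i.
Proof. by rewrite /al /be; have := ler0n R N; case: (i == 0%N); lra. Qed.

Let Xc_cvg (a : R) (x : 'rV[R]_k.+1) : x ord0 ord0 <= a ->
  Xc (al a N) (ga a N) x @[N --> \oo] --> (1 : R).
Proof.
move=> xa; apply: cvg_near_cst.
near=> N.
have hN : `|a| + \sum_(i < k.+1) `|x ord0 i| <= N%:R by near: N; exact: nbhs_infty_ger.
rewrite /Xc /tjet /tprod big1// => i _; apply: chi_eq1.
have xi : `|a| + `|x ord0 i| <= N%:R.
  apply: le_trans hN; rewrite lerD2l (bigD1 i)//= lerDl; exact: sumr_ge0.
have := ler_norm (x ord0 i); have := ler_norm (- x ord0 i); rewrite normrN.
have := ler_norm a; have := normr_ge0 a; rewrite /al /ga.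
case: i xi => -[|i] ii xi /=; last by move=> *; apply/andP; split; lra.
rewrite (_ : Ordinal ii = ord0) in xi *; last exact/val_inj.
by move=> *; apply/andP; split; lra.
Unshelve. all: by end_near. Qed.

Lemma dot_Fa_eq0 (a t : R) : 0 < t <= T -> dot mu (Fa P a t) (Fa P a t) = 0.
Proof.
move=> tT; have [D [D1 HD]] := chi_bounded R.
have MB0 : 0 <= MB by exact: le_trans (normr_ge0 _) (BM 0 ord0).
pose M := k.+1%:R * ((MB + 1) * D ^+ k.+1).
have LF s := L2_Fa mP PC a s.
have mF : measurable_fun setT (fun s => dot mu (Fa P a s) (Fa P a s)).
  apply: (@measurable_Rintegral2 _ _ _ _ _ mu (fun q : R * X => Fa P a q.1 q.2 * Fa P a q.1 q.2)).
  have msw : measurable_fun setT (fun q : R * X => (q.2, q.1)).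
    by apply: measurable_fun_pair; [exact: measurable_snd|exact: measurable_fst].
  have mi : measurable_fun setT (\1_`]-oo, a] : R -> R) by exact: measurable_indic.
  by apply: measurable_funM; exact: (measurableT_comp (measurable_marg2 mP mi) msw).
apply: (@gronwall_zero R _ T (k.+3%:R * M ^+ 2) C0 mF _ _ _ t tT).
- by rewrite mulr_ge0 ?sqr_ge0.
- by move=> s; rewrite dot_ge0 (dot_Fa_le mP PC).
move=> {tT} {}t tT.
have box N := @box_energy R k B MB mB BM T C0 P Q mP PT PC mQ QI W a (al a N) (be a N) (ga a N) D
  (`|a| + N%:R + 3) (albe a N) (fun=> erefl) erefl.
have XM N x : `|@Xc R (al a N) (ga a N) k x| <= M.
  have [h _ _] := @kernels_bounded R (al a N) (ga a N) k B D MB MB0 D1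
    (fun i o y o2 => HD (al a N i) (ga a N i) o y o2) BM.
  exact: h.
have mX N : measurable_fun setT (@Xc R (al a N) (ga a N) k : X -> R).
  apply: measurable_tprod => i; apply: continuous_measurable_fun.
  exact: (@jet2_continuous R _ _ (jet2_chi (al a N) (ga a N) i)).
have c : \int[mu]_x ((Xc (al a N) (ga a N) x * Fa P a t x) * (Xc (al a N) (ga a N) x * Fa P a t x))
    @[N --> \oo] --> dot mu (Fa P a t) (Fa P a t).
  apply: (@Rintegral_dct _ _ R mu setT _ _ (fun x => M ^+ 2 * (Fa P a t x * Fa P a t x))) => //.
  - by move=> N; apply: measurable_funM; apply: measurable_funM => //; exact: (L2_meas (LF t)).
  - by apply: measurable_funM; exact: (L2_meas (LF t)).
  - apply: aeW => x _; have [xa|ax] := leP ((x : 'rV[R]_k.+1) ord0 ord0) a; last first.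
      by rewrite (Fa_eq0 PT)// !mulr0; under eq_fun do rewrite !mulr0; exact: cvg_cst.
    have h : Xc (al a N) (ga a N) x * Fa P a t x @[N --> \oo] --> Fa P a t x.
      rewrite -[X in _ --> X]mul1r; apply: cvgM; [exact: Xc_cvg|exact: cvg_cst].
    exact: (cvgM h h).
  - exact: (integrableZl measurableT (M ^+ 2) (L2_mul_integrable (LF t) (LF t))).
  - apply: aeW => x _ N; rewrite mulrACA -!expr2 normrM ler_pM//.
      by rewrite normrX lerXn2r ?nnegrE//; exact: le_trans (normr_ge0 _) (XM N x).
    by rewrite ger0_norm// sqr_ge0.
(* The limit inherits the bound of [box_energy], whose right-hand side does not depend on [N]. *)
apply: (cvgr_to_le c); near=> N.
apply: box => //.
- by move=> i; rewrite /al; have := ler_norm (- a); rewrite normrN; case: (i == 0%N); have := normr_ge0 a; lra.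
- by move=> i; rewrite /ga; have := ler_norm a; have := ler0n R N; case: (i == 0%N); have := normr_ge0 a; lra.
by move=> i o x o2; exact: HD.
Unshelve. all: by end_near. Qed.

Lemma Fa_ae_eq0 (a t : R) : 0 < t <= T -> {ae mu, forall x, Fa P a t x = 0}.
Proof.
move=> tT; have LF := L2_Fa mP PC a t.
have h : (\int[mu]_x (Fa P a t x ^+ 2)%:E = 0)%E.
  by rewrite -dotE// dot_Fa_eq0.
have mF2 : measurable_fun setT (fun x => (Fa P a t x ^+ 2)%:E).
  by apply/measurable_EFinP; apply: measurable_funX; exact: (L2_meas LF).
have := (@ae_eq_integral_abs _ _ R mu setT measurableT _ mF2).1.
rewrite (_ : (\int[mu]_(x in setT) `|(Fa P a t x ^+ 2)%:E|)%E = 0%E); last first.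
  by rewrite -h; apply: eq_integral => x _; rewrite gee0_abs// lee_fin sqr_ge0.
move=> /(_ erefl); apply: aeS => x /(_ I)/= /eqP.
by rewrite eqe sqrf_eq0 => /eqP.
Qed.

End Vanishing.

(** * Vanishing of the difference *)

Section HalfLines.
Variable R : realType.
Local Notation leb := (@lebesgue_measure R).

(** Dominated convergence extends the vanishing to all real half-lines. The primitive of [f] is then
    0, and by Lebesgue differentiation its derivative is [f] almost everywhere. *)
Lemma ae_eq0_half_lines (f : R -> R) : leb.-integrable setT (EFin \o f) ->
  (forall q : rat, \int[leb]_m (\1_`]-oo, (ratr q : R)] m * f m) = 0) ->
  {ae leb, forall m, f m = 0}.
Proof.
move=> fi f0.
have mf : measurable_fun setT f by apply/measurable_EFinP; exact: measurable_int fi.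
have F0 a : \int[leb]_m (\1_`]-oo, a] m * f m) = 0.
  (* The rationals approach [a] from the right, so that the closed half-lines shrink to ]-oo, a]. *)
  have q_ n : exists q : rat, a < ratr q < a + n.+1%:R^-1.
    by have [|q] := @rat_in_itvoo R a (a + n.+1%:R^-1); [rewrite ltrDl|rewrite in_itv/=; exists q].
  have [q hq] := choice q_.
  have c : \int[leb]_m (\1_`]-oo, (ratr (q n) : R)] m * f m) @[n --> \oo] -->
      \int[leb]_m (\1_`]-oo, a] m * f m).
    apply: (@Rintegral_dct _ _ R leb setT _ _ (fun m => `|f m|)) => //.
    - by move=> n; apply: measurable_funM => //; exact: measurable_indic.
    - by apply: measurable_funM => //; exact: measurable_indic.
    - apply: aeW => m _; apply: cvgM; last exact: cvg_cst.
      apply: cvg_near_cst; rewrite !indicE.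
      have [ma|am] := leP m a.
        apply: nearW => n; rewrite !indicE !mem_setE !in_itv/= ma.
        by rewrite (le_trans ma)// ltW//; case/andP: (hq n).
      have ma0 : 0 < m - a by rewrite subr_gt0.
      near=> n; rewrite !indicE !mem_setE !in_itv/= (leNgt m a) am/=.
      suff -> : (m <= ratr (q n)) = false by [].
      apply/negbTE; rewrite -ltNge; case/andP: (hq n) => _ /lt_trans; apply.
      rewrite -ltrBrDl; near: n.
      exact: (near_infty_natSinv_lt (PosNum ma0)).
    - exact: integrable_abse fi.
    - apply: aeW => m _ n; rewrite normrM ler_piMl// indicE.
      by case: (_ \in _); rewrite ?normr1 ?normr0.
  apply: (cvg_unique _ c); first exact: norm_hausdorff.
  rewrite (_ : (fun n => _) = cst 0); last by apply/funext => n; exact: f0.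
  exact: cvg_cst.
have iy y : leb.-integrable `]-oo, y] (EFin \o f).
  by apply: integrableS fi.
have lf : locally_integrable [set: R] f by have := integrable_locally measurableT fi; rewrite patch_setT.
have := FTC1Ny iy lf; apply: aeS => x [_ <-].
rewrite (_ : (fun x => _) = cst 0); first by rewrite derive1_cst.
apply/funext => y; rewrite Rintegral_mkcond -[RHS](F0 y); apply: eq_Rintegral => m _.
by rewrite patchE indicE; case: (_ \in _); rewrite ?mul1r ?mul0r.
Unshelve. all: by end_near. Qed.

End HalfLines.

Section Vanishing2.
Variables (R : realType) (k : nat).
Local Notation X := (g_sigma_algebraType (@open 'rV[R]_k.+1)).
Local Notation leb := (@lebesgue_measure R).
Local Notation mu := (lebV R k.+1).
Variables (C0 t : R) (P : R -> X -> R -> R).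
Hypothesis mP : measurable_fun setT (fun q : (X * R) * R => P q.2 q.1.1 q.1.2).
Hypothesis PC : forall s, (\int[mu]_x (absP P x s * absP P x s) <= C0%:E)%E.
Hypothesis F0 : forall a, {ae mu, forall x, Fa P a t x = 0}.

(** The exceptional set of x depends on the level, so only rational levels are used; [unpickle]
    enumerates them for a countable union of null sets. *)
Lemma P_ae_eq0 : {ae mu, forall x, {ae leb, forall m, P m x t = 0}}.
Proof.
have F0q : {ae mu, forall x, forall n : nat, if unpickle n is Some q then Fa P (ratr (q : rat)) t x = 0 else True}.
  apply: ae_foralln => n; case: (unpickle n) => [q|]; last exact: aeW.
  exact: F0.
apply: aeS (aeI F0q (absP_fin mP PC t)) => x [Fx xfin].
apply: ae_eq0_half_lines => [|q]; last by have := Fx (pickle q); rewrite pickleK.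
have := integrable_hP mP (h := fun=> 1) (M := 1) (measurable_cst _) _ xfin.
move=> /(_ ltac:(by move=> _; rewrite normr1)); congr (integrable _ _ _).
by apply/funext => m /=; rewrite mul1r.
Qed.

End Vanishing2.

(** * From weak solutions to tensor test functions *)

Section PairIntegrals.
Variables (R : realType) (k : nat).
Local Notation X := (g_sigma_algebraType (@open 'rV[R]_k.+1)).
Local Notation leb := (@lebesgue_measure R).
Local Notation mu := (lebV R k.+1).

Section single.
Variables (C0 : R) (P : R -> X -> R -> R).
Hypothesis mP : measurable_fun setT (fun q : (X * R) * R => P q.2 q.1.1 q.1.2).
Hypothesis PC : forall s, (\int[mu]_x (absP P x s * absP P x s) <= C0%:E)%E.
Variables (h : R -> R) (b : X -> R) (M s : R).
Hypotheses (mh : measurable_fun setT h) (hM : forall m, `|h m| <= M) (Lb : L2 mu b).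

Let M0 : 0 <= M. Proof. exact: le_trans (normr_ge0 _) (hM 0). Qed.

Let F (q : R * X) : R := h q.1 * b q.2 * P q.1 q.2 s.

Let mF : measurable_fun setT F.
Proof.
apply: measurable_funM.
  by apply: measurable_funM; [exact: measurableT_comp|apply: measurableT_comp => //; exact: (L2_meas Lb)].
have sw : measurable_fun setT (fun q : R * X => ((q.2, s), q.1)).
  apply: measurable_fun_pair; last exact: measurable_fst.
  by apply: measurable_fun_pair; [exact: measurable_snd|exact: measurable_cst].
exact: (measurableT_comp mP sw).
Qed.

(** The integral of |h b P| over m is at most M |b| times [absP], hence at most (M b)^2 plus the
    square of [absP], and both are integrable in x. *)
Lemma integrable_bhP : (leb \x mu)%E.-integrable setT (EFin \o F).
Proof.
apply/integrable21ltyP; first exact/measurable_EFinP.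
have mA := measurable_absP mP s.
have mb := L2_meas Lb.
have mMb : measurable_fun setT (fun y => M * b y) by apply: measurable_funM.
have mMb2 : measurable_fun setT (fun y : X => ((M * b y) ^+ 2)%:E).
  by apply/measurable_EFinP; exact: measurable_funX.
apply: (@le_lt_trans _ _ (\int[mu]_y (((M * b y) ^+ 2)%:E + absP P y s * absP P y s)%E)%E).
  apply: ge0_le_integral => //.
  - by move=> y _; apply: integral_ge0 => m _; rewrite abse_ge0.
  - have sw : measurable_fun setT (fun q : X * R => (q.2, q.1)).
      by apply: measurable_fun_pair; [exact: measurable_snd|exact: measurable_fst].
    apply: (@measurable_integral2 _ _ _ _ _ leb (fun q : X * R => `|(EFin \o F) (q.2, q.1)|)%E).
    apply: measurableT_comp => //; apply/measurable_EFinP.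
    exact: (measurableT_comp mF sw).
  - by apply: emeasurable_funD => //; apply: emeasurable_funM.
  move=> y _.
  apply: (@le_trans _ _ (\int[leb]_m (`|M * b y|%:E * `|P m y s|%:E))%E).
    apply: ge0_le_integral => //.
    - apply: measurableT_comp => //; apply/measurable_EFinP.
      by apply: (measurableT_comp mF); exact: measurable_pair2.
    - apply: emeasurable_funM => //; apply/measurable_EFinP; apply: measurableT_comp => //.
      exact: (measurable_P mP y s).
    move=> m _; rewrite /= -EFinM lee_fin /F/= !normrM !ler_wpM2r//.
    by rewrite (ger0_norm M0).
  rewrite ge0_integralZl//; last first.
    by apply/measurable_EFinP; apply: measurableT_comp => //; exact: (measurable_P mP y s).
  rewrite -/(absP P y s); have := absP_ge0 P y s; case: (absP P y s) => [r| |//] r0.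
    rewrite -!EFinM -EFinD lee_fin -[(M * b y) ^+ 2]real_normK ?num_real//.
    have := normr_ge0 (M * b y); move: `|_| => z z0; rewrite lee_fin in r0.
    by have := sqr_ge0 (z - r); nra.
  by rewrite mulyy addey ?leey.
rewrite ge0_integralD//; first last.
- by apply: emeasurable_funM.
- by move=> y _; rewrite mule_ge0// absP_ge0.
- by move=> y _; rewrite lee_fin sqr_ge0.
apply: lte_add_pinfty; last exact: le_lt_trans (PC s) (ltry _).
by case: (L2Z M Lb).
Qed.

Lemma L2_marg_bounded : L2 mu (marg P h s).
Proof.
apply: (@L2_marg R k P C0 mP PC h (M + 1) s _ mh); first by rewrite ltr_wpDl.
by move=> m; apply: le_trans (hM m) _; rewrite lerDl.
Qed.

(** [lint] integrates over m last and [marg] integrates over m first; Fubini exchanges the two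
    orders, thanks to [integrable_bhP]. *)
Lemma lint_bhP : lint (fun z : 'rV[R]_k.+2 => (F (@uncons0 R k.+1 z))%:E) = (dot mu b (marg P h s))%:E.
Proof.
have uK m x : @uncons0 R k.+1 (row_mx (m%:M : 'rV_1) (x : 'rV[R]_k.+1)) = (m, x).
  exact: (@cons0K R k.+1 (m, x)).
have mFu : measurable_fun setT (fun z : g_sigma_algebraType (@open 'rV[R]_k.+2) => (F (@uncons0 R k.+1 z))%:E).
  by apply/measurable_EFinP; exact: (measurableT_comp mF (@measurable_uncons0 R k.+1)).
have iF := integrable_bhP.
have iFu : (lebV R k.+2).-integrable setT (fun z : g_sigma_algebraType (@open 'rV[R]_k.+2) => (F (@uncons0 R k.+1 z))%:E).
  apply/integrableP; split => //.
  rewrite ge0_integral_lebVS//; last exact: measurableT_comp.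
  move/integrable12ltyP : iF => H.
  apply: le_lt_trans (H _); last exact/measurable_EFinP.
  rewrite le_eqVlt; apply/orP; left; apply/eqP; apply: eq_integral => m _; apply: eq_integral => x _.
  by rewrite uK.
rewrite lint_integral// integral_lebVS//.
transitivity (\int[leb]_m \int[mu]_x (EFin \o F) (m, x))%E.
  by apply: eq_integral => m _; apply: eq_integral => x _; rewrite uK.
rewrite Fubini// /dot /Rintegral fineK; last first.
  by apply: integrable_fin_num => //; exact: L2_mul_integrable Lb L2_marg_bounded.
apply: integral_ae_any; apply: aeS (absP_fin mP PC s) => x xfin _.
have ih := integrable_hP mP mh hM xfin.
rewrite /marg /Rintegral EFinM fineK; last exact: integrable_fin_num.
rewrite -integralZl//; apply: eq_integral => m _.
by rewrite /F/= -EFinM mulrCA mulrA.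
Qed.

End single.

Lemma dot_margB (P1 P2 : R -> X -> R -> R) (C1 C2 : R) (h : R -> R) (b : X -> R) (M s : R) :
  measurable_fun setT (fun q : (X * R) * R => P1 q.2 q.1.1 q.1.2) ->
  measurable_fun setT (fun q : (X * R) * R => P2 q.2 q.1.1 q.1.2) ->
  (forall s, (\int[mu]_x (absP P1 x s * absP P1 x s) <= C1%:E)%E) ->
  (forall s, (\int[mu]_x (absP P2 x s * absP P2 x s) <= C2%:E)%E) ->
  measurable_fun setT h -> (forall m, `|h m| <= M) -> L2 mu b ->
  dot mu b (marg (fun m x s => P1 m x s - P2 m x s) h s) =
  dot mu b (marg P1 h s) - dot mu b (marg P2 h s).
Proof.
move=> mP1 mP2 PC1 PC2 mh hM Lb.
rewrite /dot -RintegralB//; last 2 first.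
- exact: (L2_mul_integrable Lb (L2_marg_bounded mP1 PC1 s mh hM)).
- exact: (L2_mul_integrable Lb (L2_marg_bounded mP2 PC2 s mh hM)).
congr fine; apply: integral_ae_any.
apply: aeS (aeI (absP_fin mP1 PC1 s) (absP_fin mP2 PC2 s)) => x [f1 f2] _ /=.
congr EFin; rewrite -mulrBr; congr (_ * _).
rewrite /marg -RintegralB//; last 2 first.
- exact: (integrable_hP mP1 mh hM f1).
- exact: (integrable_hP mP2 mh hM f2).
by apply: eq_Rintegral => m _; rewrite mulrBr.
Qed.

Section trace_pairing.
Variable Q : X -> R -> R.
Hypothesis mQ : measurable_fun setT (fun q : R * X => Q q.2 q.1).
Hypothesis QI : forall b, L2 mu b -> (\int[leb]_s \int[mu]_y `|b y * Q y s|%:E < +oo)%E.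
Variable b : X -> R.
Hypothesis Lb : L2 mu b.

Lemma integrable_bQ : (leb \x mu)%E.-integrable setT (fun q : R * X => (b q.2 * Q q.2 q.1)%:E).
Proof.
have m1 : measurable_fun setT (fun q : R * X => (b q.2 * Q q.2 q.1)%:E).
  apply/measurable_EFinP; apply: measurable_funM => //.
  by apply: measurableT_comp => //; exact: (L2_meas Lb).
apply/integrable12ltyP; first exact: m1.
apply: le_lt_trans (QI Lb).
rewrite le_eqVlt; apply/orP; left; apply/eqP.
by apply: eq_integral => s _; apply: eq_integral => y _.
Qed.

Lemma ae_integrable_bQ : {ae leb, forall s, mu.-integrable setT (EFin \o (fun y => b y * Q y s))}.
Proof. by apply: aeS (ae_integrable1 integrable_bQ) => s. Qed.

Lemma integrable_dot_bQ : leb.-integrable setT (EFin \o (fun s => dot mu b (Q^~ s))).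
Proof.
have i1 := integrable_fubini_F integrable_bQ.
apply: le_integrable i1 => //.
  apply/measurable_EFinP.
  apply: (@measurable_Rintegral2 _ _ _ _ _ mu (fun q : R * X => b q.2 * Q q.2 q.1)).
  apply: measurable_funM => //.
  by apply: measurableT_comp => //; exact: (L2_meas Lb).
move=> s _; rewrite /dot /Rintegral /fubini_F/=.
by case: (\int[mu]_x _)%E => [r| |] //=; rewrite normr0 leey.
Qed.

End trace_pairing.
End PairIntegrals.

Section EsqrtBound.

Lemma measurable_esqrt (R : realType) : measurable_fun setT (@esqrt R).
Proof.
rewrite (_ : @esqrt R = fun e : \bar R => if e == +oo%E then +oo%E else (Num.sqrt (fine e))%:E); last first.
  by apply/funext => -[r| |] //=; rewrite sqrtr0.
apply: measurable_fun_ifT => //.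
  apply: (measurable_fun_bool true); rewrite setTI.
  rewrite (_ : _ @^-1` _ = [set +oo%E]); first exact: emeasurable_set1.
  by apply/seteqP; split => e /=; [move/eqP|move=> ->; exact: eqxx].
apply/measurable_EFinP.
apply: (@measurableT_comp _ _ _ _ _ _ (@Num.sqrt R)) => //.
by apply: continuous_measurable_fun; exact: sqrt_continuous.
Qed.

Lemma esqrt_ge0 (R : realType) (e : \bar R) : (0 <= esqrt e)%E.
Proof. by case: e => [r| |] //=; rewrite lee_fin sqrtr_ge0. Qed.

(** Cauchy-Schwarz with an infinite norm of [g] allowed: the added 1 makes the constant positive, so
    that the right-hand side is then infinite even if [b] has norm 0. *)
Lemma integral_mul_le_esqrt d (Y : measurableType d) (R : realType)
    (mu : {measure set Y -> \bar R}) (b g : Y -> R) : L2 mu b -> measurable_fun setT g ->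
  (\int[mu]_y `|b y * g y|%:E <=
   (Num.sqrt (dot mu b b) + 1)%:E * esqrt (\int[mu]_y (g y ^+ 2)%:E))%E.
Proof.
move=> Lb mg; have N0 : (0 <= \int[mu]_y (g y ^+ 2)%:E)%E.
  by apply: integral_ge0 => y _; rewrite lee_fin sqr_ge0.
have c0 : 0 < Num.sqrt (dot mu b b) + 1 by rewrite ltr_wpDl// sqrtr_ge0.
case E : (\int[mu]_y (g y ^+ 2)%:E)%E N0 => [r| |//] r0; last by rewrite /= gt0_muley ?leey.
have Lg : L2 mu g by split => //; rewrite E ltry.
have La (f : Y -> R) : L2 mu f -> L2 mu (fun y => `|f y|).
  move=> Lf; have mf := L2_meas Lf; apply: (@L2_le _ _ _ mu _ f) => //.
    exact: measurableT_comp.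
  by move=> y; rewrite normr_id.
have dn (f : Y -> R) : dot mu (fun y => `|f y|) (fun y => `|f y|) = dot mu f f.
  by apply: eq_Rintegral => y _; rewrite -normrM ger0_norm// -expr2 sqr_ge0.
have Eg : dot mu g g = r by apply: EFin_inj; rewrite dotE.
have -> : (\int[mu]_y `|b y * g y|%:E)%E = (dot mu (fun y => `|b y|) (fun y => `|g y|))%:E.
  rewrite /dot /Rintegral fineK; last first.
    by apply: integrable_fin_num => //; exact: (L2_mul_integrable (La _ Lb) (La _ Lg)).
  by apply: eq_integral => y _; rewrite normrM.
have := cauchy_schwarz (La _ Lb) (La _ Lg); rewrite !dn Eg => cs.
rewrite /= -EFinM lee_fin; apply: (@le_trans _ _ (Num.sqrt (dot mu b b) * Num.sqrt r)); last first.
  by rewrite ler_wpM2r ?sqrtr_ge0// lerDl.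
rewrite -sqrtrM ?dot_ge0//; apply: le_trans (ler_norm _) _.
by rewrite -sqrtr_sqr ler_wsqrtr.
Qed.

End EsqrtBound.

(** * Consequences of membership in the space X *)

Section FromX.
Variables (R : realType) (k : nat) (T : R).
Local Notation X := (g_sigma_algebraType (@open 'rV[R]_k.+1)).
Local Notation leb := (@lebesgue_measure R).
Local Notation mu := (lebV R k.+1).
Variable p : 'rV[R]_k.+2 -> R -> R.
Hypothesis Xp : inX T p.

(** Extension by zero, so that the bounds hold at all times and m runs over the whole line. *)
Definition pext (m : R) (x : X) (s : R) : R :=
  if `[< 0 < s <= T /\ inT (zpt m (x : 'rV[R]_k.+1)) >] then p (zpt m (x : 'rV[R]_k.+1)) s else 0.

Lemma inT_zpt m (x : 'rV[R]_k.+1) : inT (zpt m x) <-> x ord0 ord0 <= m.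
Proof. by rewrite /inT /zx1 /zm /zpt row_mx_lift row_mx_ord0. Qed.

Lemma pext_eq0 m (x : 'rV[R]_k.+1) s : m < x ord0 ord0 -> pext m x s = 0.
Proof.
move=> mx; rewrite /pext; case: asboolP => // -[_ /inT_zpt]; by rewrite leNgt mx.
Qed.

Lemma pextE m (x : 'rV[R]_k.+1) s : 0 < s <= T -> x ord0 ord0 <= m -> pext m x s = p (zpt m x) s.
Proof. by move=> sT xm; rewrite /pext asboolT//; split => //; exact/inT_zpt. Qed.

Lemma pext_out m (x : 'rV[R]_k.+1) s : ~~ (0 < s <= T) -> pext m x s = 0.
Proof. by move=> sT; rewrite /pext asboolF// => -[h]; rewrite h in sT. Qed.

Lemma measurable_pext : measurable_fun setT (fun q : (X * R) * R => pext q.2 q.1.1 q.1.2).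
Proof.
have [/rmeasP mW _] := Xp.
apply/measurable_EFinP.
have m1 : measurable_fun setT (fun q : (X * R) * R => @cons0 R k.+1 (q.2, q.1.1)).
  apply: (measurableT_comp (@measurable_cons0 R k.+1)).
  apply: measurable_fun_pair; first exact: measurable_snd.
  exact: (measurableT_comp measurable_fst measurable_fst).
have m2 : measurable_fun setT (fun q : (X * R) * R => @snocV R k.+2 (@cons0 R k.+1 (q.2, q.1.1), q.1.2)).
  apply: (measurableT_comp (@measurable_snocV R k.+2)).
  apply: measurable_fun_pair => //.
  exact: (measurableT_comp measurable_snd measurable_fst).
have := measurableT_comp mW m2; congr (measurable_fun _ _); apply/funext => -[[x s] m] /=.
rewrite /snocV /cons0 /= row_mxKl row_mxKr mxE eqxx mulr1n /pext /zpt.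
by case: ifP.
Qed.

Lemma absP_pextE x s : 0 < s <= T ->
  absP pext x s = (\int[leb]_(m in [set m | ((x : 'rV[R]_k.+1) ord0 ord0 <= m)%R]) `|p (zpt m (x : 'rV[R]_k.+1)) s|%:E)%E.
Proof.
move=> sT; rewrite /absP [RHS]integral_mkcond; apply: eq_integral => m _.
rewrite patchE; case: ifPn => [|]; first by rewrite inE/= => xm; rewrite pextE.
by rewrite notin_setE/= => /negP; rewrite -ltNge => mx; rewrite pext_eq0// normr0.
Qed.

Lemma absP_pext_bound : exists C, forall s, (\int[mu]_x (absP pext x s * absP pext x s) <= C%:E)%E.
Proof.
have [_ [Xa _]] := Xp; move: Xa; set S := ereal_sup _ => Soo.
(* The maximum with 0 covers the times outside ]0, T], where the integral is 0. *)
exists (Num.max (fine S) 0) => s.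
have [sT|sT] := boolP (0 < s <= T); last first.
  rewrite integral0_eq ?lee_fin ?le_max ?lexx ?orbT// => x _.
  rewrite /absP [X in (X * _)%E]integral0_eq ?mul0e// => m _.
  by rewrite pext_out// normr0.
have H : (\int[mu]_x (absP pext x s * absP pext x s) <= S)%E.
  apply: ereal_sup_ubound; exists s; first by rewrite /= in_itv.
  rewrite -ge0_lintE; last 2 first.
  - by apply: emeasurable_funM; exact: measurable_absP measurable_pext _.
  - by move=> x; rewrite mule_ge0// absP_ge0.
  by congr lint; apply/funext => x; rewrite (absP_pextE x sT).
apply: le_trans H _; move: Soo; case: S => [r| |] //= _.
  by rewrite lee_fin le_max lexx.
by rewrite leNye.
Qed.

(** [Q] is the measurable representative of the trace from condition (b), cut to ]0, T].
    Cauchy-Schwarz in y turns the L^1(L^2) bound into integrability against a fixed [b], and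
    [ae_snoc] reads the joint almost everywhere equality time by time. *)
Lemma trace_density : exists Q : X -> R -> R,
  [/\ measurable_fun setT (fun q : R * X => Q q.2 q.1),
      (forall b, L2 mu b -> (\int[leb]_s \int[mu]_y `|b y * Q y s|%:E < +oo)%E) &
      {ae leb, forall s, 0 < s <= T -> {ae mu, forall y : X, trace p (y : 'rV[R]_k.+1) s = Q y s}}].
Proof.
have [_ [_ [_ [g [/rmeasP mg [/aeP /ae_snoc aeg gI]]]]]] := Xp.
pose Q (y : X) (s : R) : R := if 0 < s <= T then g (row_mx (y : 'rV[R]_k.+1) (s%:M : 'rV_1)) else 0.
have mgs : measurable_fun setT (fun q : R * X => g (row_mx (q.2 : 'rV[R]_k.+1) (q.1%:M : 'rV_1))).
  have sw : measurable_fun setT (fun q : R * X => @snocV R k.+1 (q.2, q.1)).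
    apply: (measurableT_comp (@measurable_snocV R k.+1)).
    by apply: measurable_fun_pair; [exact: measurable_snd|exact: measurable_fst].
  by apply/measurable_EFinP; exact: (measurableT_comp mg sw).
have mT : measurable_fun setT (fun q : R * X => 0 < q.1 <= T).
  apply: (measurable_fun_bool true); rewrite setTI.
  rewrite (_ : _ @^-1` _ = fst @^-1` `]0, T]%classic); last first.
    by apply/seteqP; split => q /=; rewrite in_itv.
  rewrite -[X in measurable X]setTI; exact: measurable_fst.
have mQ : measurable_fun setT (fun q : R * X => Q q.2 q.1).
  by apply: measurable_fun_ifT.
exists Q; split => //; last first.
  by apply: aeS aeg => s H sT; apply: aeS H => y; rewrite row_mxKl row_mxKr mxE eqxx mulr1n /Q sT; exact.
move=> b Lb.
have mgs1 s : measurable_fun setT (fun y : X => g (row_mx (y : 'rV[R]_k.+1) (s%:M : 'rV_1))).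
  exact: (measurableT_comp mgs (measurable_pair1 s)).
pose N s := (\int[mu]_y (g (row_mx (y : 'rV[R]_k.+1) (s%:M : 'rV_1)) ^+ 2)%:E)%E.
have mN : measurable_fun setT N.
  apply: (@measurable_integral2 _ _ _ _ _ mu (fun q : R * X => (g (row_mx (q.2 : 'rV[R]_k.+1) (q.1%:M : 'rV_1)) ^+ 2)%:E)).
  by apply/measurable_EFinP; exact: measurable_funX.
have mb := L2_meas Lb.
pose c := Num.sqrt (dot mu b b) + 1.
have c0 : 0 <= c by rewrite addr_ge0// sqrtr_ge0.
have mE : measurable_fun setT (fun s => esqrt (N s)) by exact: (measurableT_comp (@measurable_esqrt R) mN).
have mH : measurable_fun setT (fun s => \int[mu]_y `|b y * Q y s|%:E)%E.
  apply: (@measurable_integral2 _ _ _ _ _ mu (fun q : R * X => `|b q.2 * Q q.2 q.1|%:E)).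
  by apply/measurable_EFinP; apply: measurableT_comp => //; apply: measurable_funM => //;
    exact: measurableT_comp.
rewrite (_ : (\int[leb]_s _)%E = (\int[leb]_(s in `]0%R, T]) \int[mu]_y `|b y * Q y s|%:E)%E); last first.
  rewrite [RHS]integral_mkcond; apply: eq_integral => s _; rewrite patchE mem_setE in_itv/=.
  case: ifPn => // sT; rewrite integral0_eq// => y _.
  by rewrite /Q (negbTE sT) mulr0 normr0.
apply: (@le_lt_trans _ _ (\int[leb]_(s in `]0%R, T]) (c%:E * esqrt (N s)))%E).
  apply: ge0_le_integral => //.
  - by move=> s _; apply: integral_ge0 => y _; rewrite lee_fin.
  - exact: measurable_funTS.
  - by apply: measurable_funTS; exact: emeasurable_funM.
  move=> s /=; rewrite in_itv/= => sT.
  by rewrite /Q sT; exact: integral_mul_le_esqrt.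
rewrite ge0_integralZl//; first last.
- by move=> s _; exact: esqrt_ge0.
- exact: measurable_funTS.
apply: lte_mul_pinfty => //.
apply: le_lt_trans gI; rewrite le_eqVlt; apply/orP; left; apply/eqP.
apply: eq_integral => s _; congr esqrt; rewrite ge0_lintE//.
  by apply/measurable_EFinP; exact: measurable_funX.
by move=> y; rewrite lee_fin sqr_ge0.
Qed.

End FromX.

(** * Measurability of a function with bounded partial derivatives *)

Section C1bMeasurable.
Variables (R : realType) (n : nat) (f : 'rV[R]_n -> R) (L : 'I_n -> R).
Hypotheses (fd : forall j x, derivable f x (delta_mx ord0 j))
  (fL : forall j x, `|pd f j x| <= L j).

Let e (j : 'I_n) : 'rV[R]_n := delta_mx ord0 j.

Let line_derive j (x : 'rV[R]_n) (t : R) : is_derive t 1 (fun t => f (x + t *: e j)) (pd f j (x + t *: e j)).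
Proof.
have H : (fun h => h^-1 *: (((fun t => f (x + t *: e j)) \o shift t) (h *: (1 : R)) - f (x + t *: e j))) =
    (fun h => h^-1 *: ((f \o shift (x + t *: e j)) (h *: e j) - f (x + t *: e j))).
  apply/funext => h /=; rewrite (_ : h *: (1 : R) = h); last exact: mulr1.
  by rewrite scalerDl addrCA.
apply: DeriveDef; first by rewrite /derivable H; exact: fd.
by rewrite /derive H.
Qed.

Let coord_lip_pos j (x : 'rV[R]_n) (h : R) : 0 < h -> `|f (x + h *: e j) - f x| <= L j * h.
Proof.
move=> h0.
have cf : {within `[0, h], continuous (fun t => f (x + t *: e j))}.
  apply: continuous_subspaceT => t; apply: differentiable_continuous.
  apply/derivable1_diffP; exact: (@ex_derive _ _ _ _ _ _ _ (line_derive j x t)).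
have [c _] := MVT h0 (fun t _ => line_derive j x t) cf.
rewrite scale0r addr0 subr0 => ->.
by rewrite normrM (gtr0_norm h0) ler_wpM2r// ltW.
Qed.

Lemma coord_lipschitz j (x : 'rV[R]_n) (h : R) : `|f (x + h *: e j) - f x| <= L j * `|h|.
Proof.
have [h0|h0|->] := ltrgtP h 0; last 2 first.
- by rewrite (gtr0_norm h0) coord_lip_pos.
- by rewrite scale0r addr0 subrr !normr0 mulr0.
- rewrite (ltr0_norm h0) distrC.
  have := @coord_lip_pos j (x + h *: e j) (- h); rewrite oppr_gt0 => /(_ h0).
  by rewrite scaleNr addrK.
Qed.

(** The increment is split into moves along one axis at a time, each controlled by the mean value
    theorem through the bound on that partial derivative. *)
Lemma continuous_bounded_pd : continuous f.
Proof.
have lip (s : seq 'I_n) (v x : 'rV[R]_n) :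
    `|f (x + \sum_(j <- s) v ord0 j *: e j) - f x| <= \sum_(j <- s) L j * `|v ord0 j|.
  elim: s x => [|j s IHs] x; first by rewrite !big_nil addr0 subrr normr0.
  rewrite !big_cons addrA.
  apply: le_trans (ler_distD (f (x + v ord0 j *: e j)) _ _) _.
  by rewrite [leRHS]addrC; apply: lerD; [exact: IHs|exact: coord_lipschitz].
move=> x; have Fx : Filter (nbhs x) by exact: nbhs_filter.
apply/(@cvgrPdist_le _ _ _ (nbhs x) Fx) => eps eps0.
have c1 j : (L j * `|(y - x) ord0 j| : R) @[y --> x] --> (0 : R).
  rewrite (_ : (fun y => _) = fun y : 'rV[R]_n => L j * `|y ord0 j - x ord0 j|); last first.
    by apply/funext => y; rewrite !mxE.
  have z : (0 : R) = L j * `|x ord0 j - x ord0 j| by rewrite subrr normr0 mulr0.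
  rewrite [X in _ --> X]z; apply: cvgM; first exact: cvg_cst.
  apply: cvg_norm; apply: cvgB; last exact: cvg_cst.
  exact: coord_continuous.
have cS (s : seq 'I_n) : (\sum_(j <- s) L j * `|(y - x) ord0 j| : R) @[y --> x] --> (0 : R).
  elim: s => [|j s IHs].
    by rewrite (_ : (fun y => _) = cst 0); [exact: cvg_cst|apply/funext => y; rewrite big_nil].
  rewrite (_ : (fun y => _) = fun y => L j * `|(y - x) ord0 j| + \sum_(j <- s) L j * `|(y - x) ord0 j|); last first.
    by apply/funext => y; rewrite big_cons.
  by rewrite -[X in _ --> X](addr0 (0 : R)); apply: cvgD.
have := (@cvgrPdist_le _ _ _ (nbhs x) Fx _ _).1 (cS (index_enum _)) _ eps0; apply: filterS => y.
rewrite sub0r normrN => h; rewrite distrC.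
have := lip (index_enum _) (y - x) x; rewrite /e -row_sum_delta (addrC x) subrK => /le_trans; apply.
exact: le_trans (ler_norm _) h.
Qed.

Lemma measurable_bounded_pd : measurable_fun setT (f : g_sigma_algebraType (@open 'rV[R]_n) -> R).
Proof.
apply/measurable_EFinP/rmeasP => a.
apply: sub_sigma_algebra.
rewrite (_ : _ @^-1` _ = f @^-1` [set r | a < r]); last first.
  by apply/seteqP; split => y /=; rewrite lte_fin.
by apply: open_comp; [move=> y _; exact: continuous_bounded_pd|exact: open_gt].
Qed.

End C1bMeasurable.

(** * The weak formulation on product test functions *)

Section FromWeak.
Variables (R : realType) (k : nat) (T : R) (B : 'rV[R]_k.+1 -> 'rV[R]_k.+1) (MB : R).
Local Notation X := (g_sigma_algebraType (@open 'rV[R]_k.+1)).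
Local Notation leb := (@lebesgue_measure R).
Local Notation mu := (lebV R k.+1).
Hypotheses (mB : forall i, measurable_fun setT (fun x : X => B x ord0 i))
  (BM : forall x i, `|B x ord0 i| <= MB).

Lemma jet2_supp1 (eta : nat -> R -> R) (M : R) : jet2 eta ->
  (forall x, M < `|x| -> eta 0%N x = 0) -> forall x, M < `|x| -> eta 1%N x = 0.
Proof.
move=> [e0 _ _] eM x Mx.
have near0 : \near x, cst 0 x = eta 0%N x.
  have : \forall y \near x, M < `|y| by move: (@norm_continuous R R x) => /cvgr_gt; apply.
  by apply: filterS => y /eM ->.
have H : is_derive x 1 (eta 0%N) 0 := near_eq_is_derive near0 (is_derive_cst 0 x 1).
by rewrite -(@derive_val _ _ _ _ _ _ _ (e0 x)) (@derive_val _ _ _ _ _ _ _ H).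
Qed.

Section tests.
Variables (eta : nat -> R -> R) (psi : nat -> nat -> R -> R) (M : R).
Hypotheses (jeta : jet2 eta) (jpsi : forall i, jet2 (psi i)).
Hypotheses (etaM : forall x, M < `|x| -> eta 0%N x = 0)
  (psiM : forall i o x, (o <= 2)%N -> M < `|x| -> psi i o x = 0).

Definition cons_jet (i : nat) : nat -> R -> R := if i is i'.+1 then psi i' else eta.

Let Phi : 'rV[R]_k.+2 -> R := tjet cons_jet ord_zero.

Let jD i : jet2 (cons_jet i).
Proof. by case: i. Qed.

Let C2c_Phi : C2c Phi.
Proof. by apply: (@C2c_tjet R k.+2 cons_jet jD M) => -[|i] x Mx; [exact: etaM|exact: psiM]. Qed.

Lemma tjet_cons o m (x : 'rV[R]_k.+1) :
  tjet cons_jet o (zpt m x) = eta (o 0%N) m * tjet psi (fun i => o i.+1) x.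
Proof. exact: tprodS. Qed.

Let pd_m m (x : 'rV[R]_k.+1) : pd Phi ord0 (zpt m x) = eta 1%N m * tjet psi ord_zero x.
Proof. by rewrite (pd_tjet jD)// tjet_cons. Qed.

Let gen_Phi m (x : 'rV[R]_k.+1) : gen B Phi (zpt m x) = eta 0%N m * genx B psi x.
Proof.
have pdl i : pd Phi (lift ord0 i) = tjet cons_jet (incr ord_zero i.+1).
  by apply/funext => z; rewrite (pd_tjet jD).
have pdll (i : 'I_k.+1) z : pd (tjet cons_jet (incr ord_zero i.+1)) (lift ord0 i) z =
    tjet cons_jet (incr (incr ord_zero i.+1) i.+1) z.
  by rewrite (pd_tjet jD)// /incr /ord_zero; case: ifP.
rewrite /gen /genx mulrDr; congr (_ + _).
  rewrite mulr_sumr; apply: eq_bigr => i _.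
  by rewrite pdl tjet_cons {1}/zpt row_mxKr mulrCA.
rewrite mulrCA; congr (_ * _); rewrite mulr_sumr; apply: eq_bigr => i _.
by rewrite pdl pdll tjet_cons.
Qed.

Variables (f0 : 'rV[R]_k.+1 -> R) (p : 'rV[R]_k.+2 -> R -> R) (Q : X -> R -> R).
Hypothesis Wp : weak_solution T B f0 p.
Hypothesis mQ : measurable_fun setT (fun q : R * X => Q q.2 q.1).
Hypothesis QI : forall b, L2 mu b -> (\int[leb]_s \int[mu]_y `|b y * Q y s|%:E < +oo)%E.
Hypothesis traceQ :
  {ae leb, forall s, 0 < s <= T -> {ae mu, forall y : X, trace p (y : 'rV[R]_k.+1) s = Q y s}}.

Let Xp : inX T p. Proof. by case: Wp. Qed.
Let mP := measurable_pext Xp.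

Definition diag_weight (y : X) : R := eta 1%N ((y : 'rV[R]_k.+1) ord0 ord0) * tjet psi ord_zero y.

Let Ltj : L2 mu (tjet psi ord_zero : X -> R).
Proof. by apply: (L2_tjet _ jpsi psiM). Qed.

Let Lgx : L2 mu (genx B psi : X -> R).
Proof. exact: (L2_genx mB BM jpsi psiM). Qed.

Let ceta o : (o <= 2)%N -> continuous (eta o).
Proof. by move=> o2; exact: (jet2_continuous jeta o2). Qed.

Lemma L2_diag_weight : L2 mu diag_weight.
Proof.
have [C [_ HC]] := compact_support_bounded (@ceta 1%N isT) (jet2_supp1 jeta etaM).
apply: (@L2_bounded_mul _ _ R mu C (tjet psi ord_zero : X -> R)
  (fun y : X => eta 1%N ((y : 'rV[R]_k.+1) ord0 ord0))); [|by move=> y; exact: HC|exact: Ltj].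
apply: (measurableT_comp _ (@measurable_coord R k.+1 ord0)).
by apply: continuous_measurable_fun; exact: ceta.
Qed.

Let meta : measurable_fun setT (eta 0%N).
Proof. by apply: continuous_measurable_fun; exact: ceta. Qed.

Lemma integrable_dot_marg (b : X -> R) t : L2 mu b ->
  leb.-integrable `]0, t] (EFin \o (fun s => dot mu b (marg (pext T p) (eta 0%N) s))).
Proof.
move=> Lb; have [C0 PC] := absP_pext_bound Xp.
have [C [C_0 HC]] := compact_support_bounded (@ceta 0%N isT) etaM.
have C1 : 0 < C + 1 by rewrite ltr_wpDl.
have HC1 m : `|eta 0%N m| <= C + 1 by apply: le_trans (HC m) _; rewrite lerDl.
apply: (@integrable_bounded_itv R _ (dot mu b b + (C + 1) ^+ 2 * C0)).
  exact: (measurable_dot_marg mP (L2_meas Lb) meta).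
move=> s; apply: le_trans (normr_dot_le Lb (L2_marg mP PC s C1 meta HC1)) _.
by rewrite lerD2l; exact: (dot_marg_le mP PC s C1 meta HC1).
Qed.

Let lint_pair (b : X -> R) (F : 'rV[R]_k.+2 -> R) s : 0 < s <= T -> L2 mu b ->
  (forall m (x : 'rV[R]_k.+1), F (zpt m x) = eta 0%N m * b x) ->
  lint (fun z => if `[< inT z >] then (F z * p z s)%:E else 0%E) =
  (dot mu b (marg (pext T p) (eta 0%N) s))%:E.
Proof.
move=> sT Lb FE; have [C0 PC] := absP_pext_bound Xp.
have [C [_ HC]] := compact_support_bounded (@ceta 0%N isT) etaM.
rewrite -(lint_bhP mP PC s meta HC Lb); congr lint; apply/funext => z.
rewrite -[in LHS](@uncons0K R k.+1 z); case: (@uncons0 R k.+1 z) => m x /=.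
rewrite -/(zpt m (x : 'rV[R]_k.+1)) FE.
case: asboolP => [/inT_zpt xm|]; first by rewrite pextE.
by move=> /inT_zpt /negP; rewrite -ltNge => mx; rewrite pext_eq0// mulr0.
Qed.

(** The term in the initial datum as a real number, common to both solutions; its finiteness is
    extracted from the equation in [weak_identity1]. *)
Definition init_pairing : R := fine (lint (fun y : 'rV[R]_k.+1 =>
  (Phi (pt (y ord0 ord0) (y ord0 ord0) (rsubmx (y : 'rV[R]_(1 + k)))) * f0 y)%:E)).

Lemma weak_identity1 t : 0 < t <= T ->
  dot mu (tjet psi ord_zero) (marg (pext T p) (eta 0%N) t) =
  init_pairing + \int[leb]_(s in `]0, t]) dot mu (genx B psi) (marg (pext T p) (eta 0%N) s) +
  2^-1 * \int[leb]_(s in `]0, t]) dot mu diag_weight (Q^~ s).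
Proof.
have [_ /(_ Phi C2c_Phi) WE] := Wp.
set e0 := lint (fun y => (_ * f0 y)%:E) in WE.
move=> tT; have := WE t tT; rewrite /init_pairing -/e0.
rewrite (lint_pair tT Ltj); last by move=> m x; exact: tjet_cons.
have -> : (\int[leb]_(s in `]0%R, t]) lint (fun z => if `[< inT z >] then (p z s * gen B Phi z)%:E else 0%E))%E =
    (\int[leb]_(s in `]0, t]) dot mu (genx B psi) (marg (pext T p) (eta 0%N) s))%:E.
  rewrite /Rintegral fineK; last exact: integrable_fin_num (integrable_dot_marg t Lgx).
  apply: eq_integral => s; rewrite mem_setE => sI.
  have /andP[s0 st] : 0 < s <= t by move: sI; rewrite in_itv.
  have sT : 0 < s <= T by rewrite s0 (le_trans st)//; case/andP: tT.
  rewrite -(lint_pair sT Lgx gen_Phi).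
  by apply: (congr1 (@lint R k.+2)); apply/funext => z; rewrite mulrC.
have -> : (\int[leb]_(s in `]0%R, t]) lint (fun y : 'rV[R]_k.+1 =>
    (pd Phi ord0 (pt (y ord0 ord0) (y ord0 ord0) (rsubmx (y : 'rV[R]_(1 + k)))) * trace p y s)%:E))%E =
    (\int[leb]_(s in `]0, t]) dot mu diag_weight (Q^~ s))%:E.
  have iD := integrable_dot_bQ mQ QI L2_diag_weight.
  rewrite /Rintegral fineK; last first.
    by apply: integrable_fin_num => //; exact: integrableS iD.
  (* Here [trace] is replaced by [Q], for almost every time and then for almost every y inside
     [lint]. *)
  apply: integral_ae_any; apply: aeS (aeI traceQ (ae_integrable_bQ mQ QI L2_diag_weight)) => s [trs si].
  move=> sI; have /andP[s0 st] : 0 < s <= t by move: sI; rewrite /= in_itv.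
  have sT : 0 < s <= T by rewrite s0 (le_trans st)//; case/andP: tT.
  rewrite /dot /Rintegral fineK; last exact: integrable_fin_num si.
  rewrite -lint_integral//; apply: lint_ae; apply: aeS (trs sT) => y ->.
  congr (_ * _)%:E; rewrite /pt -[RHS]pd_m; congr (pd _ _ (zpt _ _)).
  exact: (@uncons0K R k y).
(* All other terms are finite, so the equation rules out an infinite initial term. *)
rewrite -EFinM; case: (e0) => [r| |] //= H.
by apply: EFin_inj; rewrite H !EFinD.
Qed.

End tests.
End FromWeak.

(** * The difference of two solutions *)

Section Difference.
Variables (R : realType) (k : nat).
Local Notation X := (g_sigma_algebraType (@open 'rV[R]_k.+1)).
Local Notation leb := (@lebesgue_measure R).
Local Notation mu := (lebV R k.+1).

Lemma absPB_bound (P1 P2 : R -> X -> R -> R) (C1 C2 s : R) :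
  measurable_fun setT (fun q : (X * R) * R => P1 q.2 q.1.1 q.1.2) ->
  measurable_fun setT (fun q : (X * R) * R => P2 q.2 q.1.1 q.1.2) ->
  (\int[mu]_x (absP P1 x s * absP P1 x s) <= C1%:E)%E ->
  (\int[mu]_x (absP P2 x s * absP P2 x s) <= C2%:E)%E ->
  (\int[mu]_x (absP (fun m x s => (P1 m x s - P2 m x s)%R) x s *
     absP (fun m x s => (P1 m x s - P2 m x s)%R) x s) <= (2 * C1 + 2 * C2)%:E)%E.
Proof.
move=> mP1 mP2 PC1 PC2.
have mP : measurable_fun setT (fun q : (X * R) * R => P1 q.2 q.1.1 q.1.2 - P2 q.2 q.1.1 q.1.2).
  exact: measurable_funB.
have mA (P : R -> X -> R -> R) (mP' : measurable_fun setT (fun q : (X * R) * R => P q.2 q.1.1 q.1.2)) :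
    measurable_fun setT (fun x => absP P x s * absP P x s)%E.
  by apply: emeasurable_funM; exact: (measurable_absP mP').
have A0 (P : R -> X -> R -> R) x : (0 <= absP P x s * absP P x s)%E by rewrite mule_ge0// absP_ge0.
apply: (@le_trans _ _ (\int[mu]_x (2%:E * (absP P1 x s * absP P1 x s) + 2%:E * (absP P2 x s * absP P2 x s))%E)%E).
  apply: ge0_le_integral => //.
  - exact: (mA (fun m x s => P1 m x s - P2 m x s)).
  - by apply: emeasurable_funD; apply: emeasurable_funM => //; exact: mA.
  move=> x _.
  have tri : (absP (fun m x s => (P1 m x s - P2 m x s)%R) x s <= absP P1 x s + absP P2 x s)%E.
    have mi (P : R -> X -> R -> R) (mP' : measurable_fun setT (fun q : (X * R) * R => P q.2 q.1.1 q.1.2)) :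
        measurable_fun setT (fun m => `|P m x s|%:E).
      by apply/measurable_EFinP; apply: measurableT_comp => //; exact: (measurable_P mP' x s).
    rewrite /absP -ge0_integralD//; [|exact: mi|exact: mi].
    apply: ge0_le_integral => //.
    - exact: (mi (fun m x s => P1 m x s - P2 m x s)).
    - by apply: emeasurable_funD; exact: mi.
    by move=> m _; rewrite -EFinD lee_fin ler_normB.
  have := absP_ge0 P1 x s; have := absP_ge0 P2 x s.
  have := absP_ge0 (fun m x s => (P1 m x s - P2 m x s)%R) x s.
  move: tri; move: (absP _ x s) (absP P1 x s) (absP P2 x s) => u v w tri u0 w0 v0.
  (* If one of the two integrals is infinite, so is the right-hand side; the finite case is (v +
     w)^2 <= 2 v^2 + 2 w^2. *)
  case: v v0 tri => [v| |//] v0; last first.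
    by move=> _; apply: (le_trans (leey _)); rewrite mulyy gt0_muley// leeDl// mule_ge0// mule_ge0.
  case: w w0 => [w| |//] w0; last first.
    by move=> _; apply: (le_trans (leey _)); rewrite mulyy gt0_muley// leeDr// mule_ge0// mule_ge0.
  case: u u0 => [u| |//] u0; last by rewrite leye_eq.
  rewrite -!EFinM -EFinD !lee_fin => uvw; rewrite !lee_fin in u0 v0 w0.
  have h1 : u * u <= (v + w) * (v + w) by rewrite ler_pM.
  by apply: le_trans h1 _; have := sqr_ge0 (v - w); nra.
rewrite ge0_integralD//; first last.
- by apply: emeasurable_funM => //; exact: mA.
- by move=> x _; rewrite mule_ge0.
- by apply: emeasurable_funM => //; exact: mA.
- by move=> x _; rewrite mule_ge0.
rewrite !ge0_integralZl//; [|exact: mA|exact: mA].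
by rewrite [leRHS]EFinD !EFinM; apply: leeD; apply: lee_wpmul2l.
Qed.

Lemma trace_pairingB (Q1 Q2 : X -> R -> R) (b : X -> R) :
  measurable_fun setT (fun q : R * X => Q1 q.2 q.1) ->
  measurable_fun setT (fun q : R * X => Q2 q.2 q.1) ->
  measurable_fun setT b ->
  (\int[leb]_s \int[mu]_y `|b y * Q1 y s|%:E < +oo)%E ->
  (\int[leb]_s \int[mu]_y `|b y * Q2 y s|%:E < +oo)%E ->
  (\int[leb]_s \int[mu]_y `|b y * (Q1 y s - Q2 y s)|%:E < +oo)%E.
Proof.
move=> mQ1 mQ2 mb I1 I2.
have mi (Q : X -> R -> R) : measurable_fun setT (fun q : R * X => Q q.2 q.1) ->
    measurable_fun setT (fun q : R * X => `|b q.2 * Q q.2 q.1|%:E).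
  move=> mQ; apply/measurable_EFinP; apply: measurableT_comp => //; apply: measurable_funM => //.
  exact: measurableT_comp.
have mi1 (Q : X -> R -> R) s : measurable_fun setT (fun q : R * X => Q q.2 q.1) ->
    measurable_fun setT (fun y : X => `|b y * Q y s|%:E).
  by move=> mQ; exact: (measurableT_comp (mi Q mQ) (measurable_pair1 s)).
have mi2 (Q : X -> R -> R) : measurable_fun setT (fun q : R * X => Q q.2 q.1) ->
    measurable_fun setT (fun s => \int[mu]_y `|b y * Q y s|%:E)%E.
  by move=> mQ; apply: (@measurable_integral2 _ _ _ _ _ mu (fun q : R * X => `|b q.2 * Q q.2 q.1|%:E)); exact: mi.
have i0 (Q : X -> R -> R) s : (0 <= \int[mu]_y `|b y * Q y s|%:E)%E.
  by apply: integral_ge0 => y _; rewrite lee_fin.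
have mQ : measurable_fun setT (fun q : R * X => Q1 q.2 q.1 - Q2 q.2 q.1) by exact: measurable_funB.
apply: (@le_lt_trans _ _ (\int[leb]_s (\int[mu]_y `|b y * Q1 y s|%:E + \int[mu]_y `|b y * Q2 y s|%:E)%E)%E).
  apply: ge0_le_integral => //.
  - by move=> s _; exact: (i0 (fun y s => Q1 y s - Q2 y s)).
  - exact: (mi2 (fun y s => Q1 y s - Q2 y s)).
  - by apply: emeasurable_funD; exact: mi2.
  move=> s _; rewrite -ge0_integralD//; [|exact: mi1|exact: mi1].
  apply: ge0_le_integral => //.
  - exact: (mi1 (fun y s => Q1 y s - Q2 y s)).
  - by apply: emeasurable_funD; exact: mi1.
  by move=> y _; rewrite -EFinD lee_fin mulrBr ler_normB.
rewrite ge0_integralD//; [|exact: mi2|exact: mi2].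
exact: (lte_add_pinfty I1 I2).
Qed.

Variables (T : R) (B : 'rV[R]_k.+1 -> 'rV[R]_k.+1) (MB : R).
Hypotheses (mB : forall i, measurable_fun setT (fun x : X => B x ord0 i))
  (BM : forall x i, `|B x ord0 i| <= MB).
Variables (f0 : 'rV[R]_k.+1 -> R) (p1 p2 : 'rV[R]_k.+2 -> R -> R).
Hypotheses (W1 : weak_solution T B f0 p1) (W2 : weak_solution T B f0 p2).

Definition pdiff m (x : X) s : R := pext T p1 m x s - pext T p2 m x s.

Let X1 : inX T p1. Proof. by case: W1. Qed.
Let X2 : inX T p2. Proof. by case: W2. Qed.

Lemma measurable_pdiff : measurable_fun setT (fun q : (X * R) * R => pdiff q.2 q.1.1 q.1.2).
Proof. by apply: measurable_funB; exact: measurable_pext. Qed.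

(** The identities of the two solutions subtract and the initial pairings, being the same real
    number, cancel: [pdiff] satisfies the identity with zero datum, so [Fa] vanishes at every
    level. *)
Lemma pdiff_ae_eq0 t : 0 < t <= T -> {ae mu, forall x, {ae leb, forall m, pdiff m x t = 0}}.
Proof.
move=> tT; have [C1 PC1] := absP_pext_bound X1; have [C2 PC2] := absP_pext_bound X2.
have mP1 := measurable_pext X1; have mP2 := measurable_pext X2.
have [Q1 [mQ1 QI1 tr1]] := trace_density X1; have [Q2 [mQ2 QI2 tr2]] := trace_density X2.
have PT m (x : 'rV[R]_k.+1) s : m < x ord0 ord0 -> pdiff m x s = 0.
  by move=> mx; rewrite /pdiff !pext_eq0// subrr.
have PC s := absPB_bound mP1 mP2 (PC1 s) (PC2 s).
pose Q (y : X) s := Q1 y s - Q2 y s.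
have mQ : measurable_fun setT (fun q : R * X => Q q.2 q.1) by exact: measurable_funB.
have QI b : L2 mu b -> (\int[leb]_s \int[mu]_y `|b y * Q y s|%:E < +oo)%E.
  by move=> Lb; apply: trace_pairingB => //; [exact: (L2_meas Lb)|exact: QI1|exact: QI2].
apply: (P_ae_eq0 measurable_pdiff PC) => a.
apply: (Fa_ae_eq0 mB BM measurable_pdiff PT PC mQ QI _ _ tT).
move=> eta psi M jeta jpsi etaM psiM {}t {}tT.
have E1 := weak_identity1 mB BM jeta jpsi etaM psiM W1 mQ1 QI1 tr1 tT.
have E2 := weak_identity1 mB BM jeta jpsi etaM psiM W2 mQ2 QI2 tr2 tT.
have ceta : continuous (eta 0%N) by exact: (@jet2_continuous R eta 0%N jeta isT).
have meta : measurable_fun setT (eta 0%N) by exact: continuous_measurable_fun.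
have [C [_ HC]] := compact_support_bounded ceta etaM.
have Ltj : L2 mu (tjet psi ord_zero : X -> R) by apply: (L2_tjet _ jpsi psiM).
have Lgx : L2 mu (genx B psi : X -> R) by exact: (L2_genx mB BM jpsi psiM).
have Ldw : L2 mu (diag_weight eta psi : X -> R) by apply: (@L2_diag_weight R k eta psi M).
have mB' b s : L2 mu b -> dot mu b (marg pdiff (eta 0%N) s) =
    dot mu b (marg (pext T p1) (eta 0%N) s) - dot mu b (marg (pext T p2) (eta 0%N) s).
  by move=> Lb; exact: (dot_margB s mP1 mP2 PC1 PC2 meta HC Lb).
have eG : \int[leb]_(s in `]0, t]) dot mu (genx B psi) (marg pdiff (eta 0%N) s) =
    \int[leb]_(s in `]0, t]) dot mu (genx B psi) (marg (pext T p1) (eta 0%N) s) -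
    \int[leb]_(s in `]0, t]) dot mu (genx B psi) (marg (pext T p2) (eta 0%N) s).
  rewrite -RintegralB//; last 2 first.
  - exact: (integrable_dot_marg jeta etaM W1 t Lgx).
  - exact: (integrable_dot_marg jeta etaM W2 t Lgx).
  by apply: eq_Rintegral => s _; exact: mB'.
have eH : \int[leb]_(s in `]0, t]) dot mu (diag_weight eta psi) (Q^~ s) =
    \int[leb]_(s in `]0, t]) dot mu (diag_weight eta psi) (Q1^~ s) -
    \int[leb]_(s in `]0, t]) dot mu (diag_weight eta psi) (Q2^~ s).
  have iQ (Q' : X -> R -> R) : measurable_fun setT (fun q : R * X => Q' q.2 q.1) ->
      (forall b, L2 mu b -> (\int[leb]_s \int[mu]_y `|b y * Q' y s|%:E < +oo)%E) ->
      leb.-integrable `]0, t] (EFin \o (fun s => dot mu (diag_weight eta psi) (Q'^~ s))).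
    move=> mQ' QI'; have := integrable_dot_bQ mQ' QI' Ldw; exact: integrableS.
  rewrite -RintegralB//; [|exact: iQ|exact: iQ].
  congr fine; apply: integral_ae_any.
  apply: aeS (aeI (ae_integrable_bQ mQ1 QI1 Ldw) (ae_integrable_bQ mQ2 QI2 Ldw)) => s [i1 i2] _.
  congr EFin; rewrite /dot -RintegralB//.
  by apply: eq_Rintegral => y _; rewrite -mulrBr.
have alg (i g1 g2 h1 h2 : R) : i + g1 + 2^-1 * h1 - (i + g2 + 2^-1 * h2) =
  (g1 - g2) + 2^-1 * (h1 - h2) by ring.
apply: (etrans (mB' _ t Ltj)); rewrite E1 E2 alg.
exact: (congr2 (fun u v => u + 2^-1 * v) (esym eG) (esym eH)).
Qed.

Lemma absP_pdiff_eq0 t : (\int[mu]_x absP pdiff x t = 0)%E.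
Proof.
have [tT|tT] := boolP (0 < t <= T); last first.
  rewrite integral0_eq// => x _; rewrite /absP integral0_eq// => m _.
  by rewrite /pdiff !pext_out// subrr normr0.
rewrite (@integral_ae_any _ _ _ mu setT _ (cst 0%E)); first exact: integral0.
apply: aeS (pdiff_ae_eq0 tT) => x h _.
rewrite /absP (@integral_ae_any _ _ _ leb setT _ (cst 0%E)); first exact: integral0.
by apply: aeS h => m -> _; rewrite normr0.
Qed.

Let d (w : g_sigma_algebraType (@open 'rV[R]_(k.+2 + 1))) : R :=
  let z := @uncons0 R k.+1 (lsubmx (w : 'rV[R]_(k.+2 + 1))) in
  pdiff z.1 z.2 (rsubmx (w : 'rV[R]_(k.+2 + 1)) ord0 ord0).

Let measurable_d : measurable_fun setT d.
Proof.
have mz := measurableT_comp (@measurable_uncons0 R k.+1) (@measurable_lsubmx R k.+2).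
have mt : measurable_fun setT (fun w : g_sigma_algebraType (@open 'rV[R]_(k.+2 + 1)) =>
    rsubmx (w : 'rV[R]_(k.+2 + 1)) ord0 ord0).
  have := @measurable_coord R (k.+2 + 1) (rshift k.+2 ord0); congr (measurable_fun _ _).
  by apply/funext => w; rewrite mxE.
have mq : measurable_fun setT (fun w : g_sigma_algebraType (@open 'rV[R]_(k.+2 + 1)) =>
    (((@uncons0 R k.+1 (lsubmx (w : 'rV[R]_(k.+2 + 1)))).2, rsubmx (w : 'rV[R]_(k.+2 + 1)) ord0 ord0),
     (@uncons0 R k.+1 (lsubmx (w : 'rV[R]_(k.+2 + 1)))).1)).
  apply: measurable_fun_pair; last exact: (measurableT_comp measurable_fst mz).
  by apply: measurable_fun_pair => //; exact: (measurableT_comp measurable_snd mz).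
exact: (measurableT_comp measurable_pdiff mq).
Qed.

(** At each time [pdiff] vanishes almost everywhere; Tonelli, applied to the jointly measurable |d|,
    turns this into a single null set in (m, x, t). *)
Lemma integral_abs_diff : (\int[lebV R (k.+2 + 1)]_w `|d w|%:E = 0)%E.
Proof.
have md : measurable_fun setT (fun w => `|d w|%:E).
  by apply/measurable_EFinP; exact: measurableT_comp.
rewrite ge0_integral_lebV_snoc//.
have mdz : measurable_fun setT (fun q : g_sigma_algebraType (@open 'rV[R]_k.+2) * R => `|d (snocV q)|%:E).
  exact: (measurableT_comp md (@measurable_snocV R k.+2)).
rewrite (@fubini_tonelli _ _ _ _ R (lebV R k.+2) leb (fun q => `|d (snocV q)|%:E))//.
rewrite integral0_eq// => t _.
rewrite ge0_integral_lebVS//; last exact: (measurableT_comp mdz (measurable_pair2 t)).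
have dE m (x : 'rV[R]_k.+1) : d (snocV (row_mx (m%:M : 'rV_1) x, t)) = pdiff m x t.
  rewrite /d /snocV row_mxKl row_mxKr mxE eqxx mulr1n.
  by rewrite (@cons0K R k.+1 (m, x) : uncons0 (row_mx (m%:M : 'rV_1) x) = (m, x : X)).
transitivity (\int[leb]_m \int[mu]_x `|pdiff m x t|%:E)%E.
  by apply: eq_integral => m _; apply: eq_integral => x _; rewrite dE.
have mq : measurable_fun setT (fun q : R * X => `|pdiff q.1 q.2 t|%:E).
  apply/measurable_EFinP; apply: measurableT_comp => //.
  have sw : measurable_fun setT (fun q : R * X => ((q.2, t), q.1)).
    apply: measurable_fun_pair; last exact: measurable_fst.
    by apply: measurable_fun_pair; [exact: measurable_snd|exact: measurable_cst].
  exact: (measurableT_comp measurable_pdiff sw).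
rewrite (@fubini_tonelli _ _ _ _ R leb mu (fun q => `|pdiff q.1 q.2 t|%:E))//.
exact: absP_pdiff_eq0.
Qed.

Lemma weak_solution_ae_unique : ae (fun w : 'rV[R]_(k.+2 + 1) =>
  let z := lsubmx w in let t := rsubmx w ord0 ord0 in
  0 < t <= T -> inT z -> p1 z t = p2 z t).
Proof.
apply/aeP.
have md : measurable_fun setT (EFin \o d) by exact/measurable_EFinP.
have := (@ae_eq_integral_abs _ _ R (lebV R (k.+2 + 1)) setT measurableT _ md).1.
move=> /(_ integral_abs_diff); apply: aeS => w /(_ I)[dw] /=; move: dw; rewrite /d /=.
move: (rsubmx _ ord0 ord0) (lsubmx _) => t z dw tT zT.
have zE : zpt (z ord0 ord0) (rsubmx (z : 'rV[R]_(1 + k.+1))) = z by exact: (@uncons0K R k.+1 z).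
have xm : (rsubmx (z : 'rV[R]_(1 + k.+1)) : 'rV[R]_k.+1) ord0 ord0 <= z ord0 ord0.
  by apply/inT_zpt; rewrite zE.
case: dw; rewrite /pdiff !pextE// zE => dw.
by apply/eqP; rewrite -subr_eq0; apply/eqP.
Qed.

End Difference.

Unset Implicit Arguments.

(* d = k.+1 >= 1 *)
Theorem theorem2 (R : realType) (k : nat) (T : R)
    (B : 'rV[R]_k.+1 -> 'rV[R]_k.+1) (f0 : 'rV[R]_k.+1 -> R)
    (p1 p2 : 'rV[R]_k.+2 -> R -> R) :
  0 < T ->
  C1b B ->
  rmeas (fun y => (f0 y)%:E) ->
  (lint (fun y => `|f0 y|%:E) < +oo)%E ->
  (lint (fun y => (f0 y ^+ 2)%:E) < +oo)%E ->
  weak_solution T B f0 p1 ->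
  weak_solution T B f0 p2 ->
  ae (fun w : 'rV[R]_(k.+2 + 1) =>
        let z := lsubmx w in
        let t := rsubmx w ord0 ord0 in
        0 < t <= T -> inT z -> p1 z t = p2 z t).
Proof.
move=> _ [[MB BM] BC] _ _ _ W1 W2.
have mB (i : 'I_k.+1) : measurable_fun setT
    (fun x : g_sigma_algebraType (@open 'rV[R]_k.+1) => B x ord0 i).
  have [L HL] := choice (fun j => (BC i j).2.2).
  exact: (@measurable_bounded_pd R k.+1 (fun y => B y ord0 i) L (fun j x => (BC i j).1 x) HL).
have BM' x (i : 'I_k.+1) : `|B x ord0 i| <= MB.
  apply: le_trans (BM x); rewrite /Num.norm/= mx_normrE.
  exact: (le_bigmax _ _ (ord0, i)).
exact: (weak_solution_ae_unique mB BM' W1 W2).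
Qed.
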